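(* Let $n\ge5$, let $r$ be the rank function of the generic $C_2^1$-cofactor matroid $\mathcal{C}^1_{2,n}$, and let $F\subseteq E(K_n)$. Then $r(F)=\min\{|F_0|+\mathrm{val}_D(\mathcal{X})\}$, where the minimum is taken over all $F_0\subseteq F$ and all $4$-shellable, $2$-thin covers $\mathcal{X}$ of $F\setminus F_0$ whose sets have size at least five.
   Context: $\mathcal{C}^1_{2,n}$ is defined as follows. Take vertices $v_1,\dots,v_n$ of $K_n$ and points $p(v_i)=(x_i,y_i)\in\mathbb{R}^2$ with algebraically independent coordinates over $\mathbb{Q}$. It is the row matroid of the $|E(K_n)|\times 3n$ matrix with three columns per vertex. The row of edge $v_iv_j$ with $i<j$ has $D_{ij}=((x_i-x_j)^2,(x_i-x_j)(y_i-y_j),(y_i-y_j)^2)$ in the columns of $v_i$, $-D_{ij}$ in the columns of $v_j$, and zeros elsewhere. Let $\mathcal{X}$ be a family of subsets of $V(K_n)$. - A hinge is a pair $\{x,y\}$ with $X_i\cap X_j=\{x,y\}$ for two distinct members $X_i,X_j$. $H(\mathcal{X})$ is the set of hinges. - $\deg_{\mathcal{X}}(h)$ is the number of members containing the hinge $h$. - $\mathcal{X}$ is $2$-thin if distinct members meet in at most two vertices. - $\mathcal{X}$ is $4$-shellable if its members can be ordered $(X_1,\dots,X_m)$ with $|X_i\cap\bigcup_{j<i}X_j|\le4$ for $2\le i\le m$. - $\mathcal{X}$ is a cover of an edge set $F'$ if each member has at least five elements and each edge of $F'$ has both endpoints in some member. - $\mathrm{val}_D(\mathcal{X})=\sum_{X\in\mathcal{X}}(3|X|-6)-\sum_{h\in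 H(\mathcal{X})}(\deg_{\mathcal{X}}(h)-1)$. *)

(* Defs.v *)
From HB Require Import structures.
From mathcomp Require Import all_boot all_order all_algebra.
From mathcomp Require Import mpoly.
From mathcomp Require Import reals.
Set Implicit Arguments. Unset Strict Implicit. Unset Printing Implicit Defensive.
Import Order.TTheory GRing.Theory Num.Theory.
Local Open Scope ring_scope.

Definition edge (n : nat) := {p : 'I_n * 'I_n | p.1 < p.2}%N.

Definition coords (R : nzRingType) (n : nat) (x y : 'I_n -> R) : 'I_(n + n) -> R :=
  fun i => match split i with inl a => x a | inr b => y b end.

Definition alg_indep_Q (R : numFieldType) (n : nat) (x y : 'I_n -> R) : Prop :=
  forall p : {mpoly rat[n + n]},
    (map_mpoly (ratr : rat -> R) p).@[coords x y] = 0 -> p = 0.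

Definition Dvec (R : nzRingType) (n : nat) (x y : 'I_n -> R) (i j : 'I_n) (k : 'I_3) : R :=
  let dx := x i - x j in let dy := y i - y j in
  if val k == 0%N then dx ^+ 2 else if val k == 1%N then dx * dy else dy ^+ 2.

(* The row of edge v_i v_j (i<j), as an n x 3 matrix: row v = the three
   columns of vertex v. D_ij at v_i, -D_ij at v_j, zeros elsewhere. *)
Definition cofactor_row (R : nzRingType) (n : nat) (x y : 'I_n -> R) (e : edge n)
  : 'M[R]_(n, 3) :=
  let i := (val e).1 in let j := (val e).2 in
  \matrix_(v, k) (if v == i then Dvec x y i j k
                  else if v == j then - Dvec x y i j k else 0).

Definition cofactor_rank (R : fieldType) (n : nat) (x y : 'I_n -> R)
  (F : {set edge n}) : nat :=
  \rank (\sum_(e in F) <<mxvec (cofactor_row x y e)>>)%MS.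

Section Families.
Variable n : nat.
Implicit Types (XX : {set {set 'I_n}}) (h : {set 'I_n}).

Definition hinges XX : {set {set 'I_n}} :=
  [set h : {set 'I_n} | (#|h| == 2)%N &&
     [exists X in XX, exists Y in XX, (X != Y) && (X :&: Y == h)]].

Definition hdeg XX h : nat := #|[set X in XX | h \subset X]|.

Definition two_thin XX : Prop :=
  forall X Y, X \in XX -> Y \in XX -> X != Y -> (#|X :&: Y| <= 2)%N.

Definition four_shellable XX : Prop :=
  exists s : seq {set 'I_n}, [/\ uniq s, (forall X, (X \in s) = (X \in XX)) &
    forall i, (1 <= i < size s)%N ->
      (#|nth set0 s i :&: \bigcup_(j < i) nth set0 s j| <= 4)%N].

Definition is_cover XX (F' : {set edge n}) : Prop :=
  (forall X, X \in XX -> 5 <= #|X|)%N /\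
  (forall e, e \in F' -> exists2 X, X \in XX & ((val e).1 \in X) && ((val e).2 \in X)).

Definition valD XX : int :=
  (\sum_(X in XX) ((3 * #|X|)%:Z - 6))
  - \sum_(h in hinges XX) ((hdeg XX h)%:Z - 1).
End Families.

Definition admissible (n : nat) (F F0 : {set edge n}) (XX : {set {set 'I_n}}) : Prop :=
  [/\ F0 \subset F, four_shellable XX, two_thin XX & is_cover XX (F :\: F0)].

(* Main.v *)
Require Import Defs.
From HB Require Import structures.
From mathcomp Require Import all_boot all_order all_algebra.
From mathcomp Require Import mpoly.
From mathcomp Require Import reals boolp.
From mathcomp Require Import ring lra zify.
Set Implicit Arguments. Unset Strict Implicit. Unset Printing Implicit Defensive.
Import Order.TTheory GRing.Theory Num.Theory.
Local Open Scope ring_scope.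

(** Dually to the row space, a motion attaches a binary quadratic form [Q_i] to
    every vertex and must satisfy [(Q_i - Q_j)(p_i - p_j) = 0] on the edges; all
    dependencies come from the self-stress of [K_5] on points in general position.
    The ranks at an algebraically independent configuration are maximal, and stay
    so when a vertex is moved generically along a line; letting it reach a line
    through two other vertices gives the local information about stars.

    Let [A] be the closure of [F] and [XX] the family of maximal cliques of [A]
    with at least five vertices.  It is 2-thin because two cliques sharing three
    vertices merge.  It is 4-shellable because a subfamily each of whose members
    meets the union of the others in five vertices would span, by averaging over
    all orders of inserting the vertices, a graph of rank above [3|U|].  The key
    point is that every self-stress of [A] is a sum of self-stresses of cliques.
    In a counterexample on the fewest vertices [U], every star has rank at least
    four over the rest, and rank four forces a special position: five neighbours
    [c], [x_1], .., [x_4] where [c] is adjacent to the pairwise nonadjacent [x_i].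
    Special vertices with a common centre [c] are pairwise nonadjacent, and if
    there are [k] of them, comparing the motion spaces for three positions of [c]
    shows that the star of [c] has rank at least [2k + 5]; hence the average star
    rank is at least five, too much for a minimal dependent set in a nonrigid
    graph.  Counting stresses yields [r(F) >= |F_0| + val_D(XX)], and the reverse
    inequality follows by submodularity along a shelling. *)

(** * Motions and ranks *)

(** Algebraic independence is used once, to reach [good]; every later argument is semicontinuity
    plus a polynomial identity. Special position can only lower ranks, so a star independent there
    is independent generically, while a relation valid at generic points of a line is polynomial in
    the parameter and can be read off at the excluded points. The obstacle is the fifth edge at a
    vertex. Three edges are independent because a binary quadratic form has three coefficients; a
    fourth is independent as soon as two of the four neighbours are nonadjacent; a fifth can fail.
    The failures are rigid enough to classify: on the quadruple of neighbours only a two-parameter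
    family of stretches survives. The bound [2k + 5] is a difference: a centre together with its [k]
    special vertices contributes at least [6k + 5], and without the centre these vertices contribute
    at most [4k]. A special vertex is one short of rank five, and a centre has a surplus of at least
    its number of special vertices, so the deficits cancel in the sum. Averaging aims at more than
    three edges per vertex, since a complete graph on [U] has rank [3|U| - 6]. *)

Section Edges.
Variable n : nat.
Implicit Types (e : edge n) (F G : {set edge n}) (i j k l v : 'I_n) (U X : {set 'I_n}).

Definition e1 e : 'I_n := (val e).1.
Definition e2 e : 'I_n := (val e).2.
Definition joins e i j := (val e == (i, j)) || (val e == (j, i)).
Definition adj F i j := [exists e in F, joins e i j].
Definition within U : {set edge n} := [set e | (e1 e \in U) && (e2 e \in U)].
Definition star v (s : seq 'I_n) : {set edge n} := [set e | has (joins e v) s].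
Definition inc v e := (v == e1 e) || (v == e2 e).
Definition avoids F v := forall e, e \in F -> ~~ inc v e.

Lemma e12_neq e : e1 e != e2 e.
Proof. by have := valP e; rewrite /e1 /e2 -val_eqE /= => h; rewrite neq_ltn h. Qed.

Lemma joinsC e i j : joins e i j = joins e j i.
Proof. by rewrite /joins orbC. Qed.

Lemma joins_e e : joins e (e1 e) (e2 e).
Proof. by rewrite /joins /e1 /e2 -surjective_pairing eqxx. Qed.

Lemma joins_cases e i j : joins e i j -> (e1 e = i /\ e2 e = j) \/ (e1 e = j /\ e2 e = i).
Proof. by case/orP=> /eqP h; [left|right]; rewrite /e1 /e2 h. Qed.

Lemma joins_inj e e' i j : joins e i j -> joins e' i j -> e = e'.
Proof.
move=> h h'; apply: val_inj.
have := valP e; have := valP e'; move: h h' => /orP[] /eqP-> /orP[] /eqP-> //= a b;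
 by have := ltn_trans a b; rewrite ltnn.
Qed.

Lemma joins_ex i j : i != j -> exists e, joins e i j.
Proof.
rewrite -val_eqE neq_ltn => /orP[] h.
  by exists (exist (fun p : 'I_n * 'I_n => (p.1 < p.2)%N) (i, j) h); rewrite /joins /= eqxx.
by exists (exist (fun p : 'I_n * 'I_n => (p.1 < p.2)%N) (j, i) h); rewrite /joins /= eqxx orbT.
Qed.

Lemma joins_neq e i j : joins e i j -> i != j.
Proof. by case/joins_cases=> [[<- <-]|[<- <-]]; rewrite ?e12_neq // eq_sym e12_neq. Qed.

Lemma adjP F i j : reflect (exists2 e, e \in F & joins e i j) (adj F i j).
Proof. by apply: (iffP exists_inP). Qed.

Lemma adjC F i j : adj F i j = adj F j i.
Proof. by apply/adjP/adjP=> -[e eF]; rewrite joinsC; exists e. Qed.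

Lemma adj_neq F i j : adj F i j -> i != j.
Proof. by case/adjP=> e _ /joins_neq. Qed.

Lemma adjE F e i j : joins e i j -> adj F i j = (e \in F).
Proof.
move=> h; apply/adjP/idP=> [[e' eF h']|eF]; last by exists e.
by rewrite (joins_inj h h').
Qed.

Lemma adjS F G i j : F \subset G -> adj F i j -> adj G i j.
Proof. by move=> /subsetP s /adjP[e /s eG h]; apply/adjP; exists e. Qed.

Lemma within_joins U e i j : joins e i j -> (e \in within U) = (i \in U) && (j \in U).
Proof. by move=> /joins_cases[] [h1 h2]; rewrite inE h1 h2 // andbC. Qed.

Lemma star_joins e v s : e \in star v s -> exists2 j, j \in s & joins e v j.
Proof. by rewrite inE => /hasP. Qed.

Lemma joins_star e v s j : j \in s -> joins e v j -> e \in star v s.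
Proof. by move=> js h; rewrite inE; apply/hasP; exists j. Qed.

Lemma inc_joins e v i j : joins e i j -> inc v e = (v == i) || (v == j).
Proof. by move=> /joins_cases[] [h1 h2]; rewrite /inc h1 h2 // orbC. Qed.

Lemma within_avoids F U v : v \notin U -> avoids (F :&: within U) v.
Proof.
move=> vU e; rewrite !inE => /andP[_ /andP[h1 h2]].
by apply/norP; split; apply: contraNneq vU => ->.
Qed.

Lemma star_cons v i s : star v (i :: s) = star v [:: i] :|: star v s.
Proof. by apply/setP=> e; rewrite !inE /= orbF. Qed.

Lemma star1 e v i : joins e v i -> star v [:: i] = [set e].
Proof.
move=> h; apply/setP=> e'; rewrite !inE /= orbF; apply/idP/eqP=> [h'|->//].
exact: joins_inj h' h.
Qed.

Lemma card_star v s : uniq s -> v \notin s -> #|star v s| = size s.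
Proof.
elim: s => [|i s IH] /=; first by move=> _ _; rewrite [star _ _](_ : _ = set0) ?cards0 //; apply/setP=> e; rewrite !inE.
move=> /andP[is_ us]; rewrite inE negb_or => /andP[vi vs].
have [e he] := joins_ex vi.
rewrite star_cons (star1 he) cardsU1 IH // inE; case: hasP => //= -[j js hj].
case/joins_cases: he => -[h1 h2]; case/joins_cases: hj => -[h3 h4].
- by move: is_; rewrite -h2 h4 js.
- by move: vi; rewrite -h1 h3 -h2 h4 -h3 h1 eqxx.
- by move: vs; rewrite -h2 h4 js.
- by move: is_; rewrite -h1 h3 js.
Qed.

Lemma starS v s t : {subset s <= t} -> star v s \subset star v t.
Proof. by move=> st; apply/subsetP=> e /star_joins[j /st jt h]; apply: joins_star jt h. Qed.

Lemma eq_star v s t : s =i t -> star v s = star v t.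
Proof. by move=> st; apply/eqP; rewrite eqEsubset !starS // => x; rewrite st. Qed.

Lemma star_within v s X : v \in X -> {subset s <= X} -> star v s \subset within X.
Proof.
by move=> vX sX; apply/subsetP=> e /star_joins[j /sX jX h]; rewrite (within_joins _ h) vX.
Qed.

End Edges.

Section Rank.
Variables (R : realFieldType) (n : nat).
Implicit Types (e : edge n) (F G H : {set edge n}) (i j k l v : 'I_n)
  (p : 'I_n -> R * R) (q : 'M[R]_(n, 3)).

Definition o0 : 'I_3 := ord0.
Definition o1 : 'I_3 := lift ord0 ord0.
Definition o2 : 'I_3 := lift ord0 (lift ord0 ord0).

(* A motion assigns to each vertex a binary quadratic form, given by its
   three coefficients; [evq q i d] is the value at [d] of the form at [i]. *)
Definition evq q i (d : R * R) : R :=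
  q i o0 * d.1 ^+ 2 + q i o1 * (d.1 * d.2) + q i o2 * d.2 ^+ 2.
Definition dv p i j : R * R := ((p i).1 - (p j).1, (p i).2 - (p j).2).
Definition stretch p i j q : R := evq q i (dv p i j) - evq q j (dv p i j).
Definition motion p F q := forall e, e \in F -> stretch p (e1 e) (e2 e) q = 0.

Definition rw p e : 'rV[R]_(n * 3) :=
  mxvec (cofactor_row (fun i => (p i).1) (fun i => (p i).2) e).
Definition Sp p F : 'M[R]_(n * 3) := (\sum_(e in F) <<rw p e>>)%MS.
Definition rk p F : nat := cofactor_rank (fun i => (p i).1) (fun i => (p i).2) F.

Lemma rkE p F : rk p F = \rank (Sp p F). Proof. by []. Qed.

Lemma stretchC p i j q : stretch p j i q = - stretch p i j q.
Proof. by rewrite /stretch /evq /dv /=; ring. Qed.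

Lemma stretch_joins p e i j q : joins e i j ->
  (stretch p (e1 e) (e2 e) q == 0) = (stretch p i j q == 0).
Proof. by case/joins_cases=> -[-> ->] //; rewrite stretchC oppr_eq0. Qed.

Lemma motion_adj p F q i j : motion p F q -> adj F i j -> stretch p i j q = 0.
Proof. by move=> m /adjP[e /m /eqP h /stretch_joins hs]; apply/eqP; rewrite -hs. Qed.

Lemma motionP p F q : (forall i j, adj F i j -> stretch p i j q = 0) -> motion p F q.
Proof. by move=> h e eF; apply: h; apply/adjP; exists e => //; apply: joins_e. Qed.

Lemma motionS p F G q : F \subset G -> motion p G q -> motion p F q.
Proof. by move=> /subsetP s m e /s /m. Qed.

Lemma motionU p F G q : motion p (F :|: G) q <-> motion p F q /\ motion p G q.
Proof.
split=> [m|[mF mG] e]; last by rewrite inE => /orP[/mF|/mG].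
by split=> e h; apply: m; rewrite inE h ?orbT.
Qed.

Lemma stretchD p i j q q' : stretch p i j (q + q') = stretch p i j q + stretch p i j q'.
Proof. by rewrite /stretch /evq /dv /= !mxE; ring. Qed.
Lemma stretchZ p i j c q : stretch p i j (c *: q) = c * stretch p i j q.
Proof. by rewrite /stretch /evq /dv /= !mxE; ring. Qed.
Lemma stretch0 p i j : stretch p i j 0 = 0.
Proof. by rewrite /stretch /evq /dv /= !mxE; ring. Qed.

Lemma motionD p F q q' : motion p F q -> motion p F q' -> motion p F (q + q').
Proof. by move=> m m' e eF; rewrite stretchD m // m' // addr0. Qed.
Lemma motionZ p F c q : motion p F q -> motion p F (c *: q).
Proof. by move=> m e eF; rewrite stretchZ m // mulr0. Qed.
Lemma motion0 p F : motion p F 0.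
Proof. by move=> e eF; rewrite stretch0. Qed.

Lemma rw_dot p e q : rw p e *m (mxvec q)^T = (stretch p (e1 e) (e2 e) q)%:M.
Proof.
pose d : 'rV[R]_3 := \row_k Dvec (fun i => (p i).1) (fun i => (p i).2) (e1 e) (e2 e) k.
have -> : rw p e = mxvec ((delta_mx 0 (e1 e) - delta_mx 0 (e2 e) : 'rV[R]_n)^T *m d).
  rewrite /rw; congr mxvec; apply/matrixP=> v k.
  rewrite !mxE big_ord1 !mxE eqxx /= -/(e1 e) -/(e2 e).
  case: (eqVneq v (e1 e)) => [->|nv]; first by rewrite (negbTE (e12_neq e)) subr0 mul1r.
  by case: eqP => _; rewrite sub0r ?mulN1r // oppr0 mul0r.
rewrite mxvec_dotmul mulmxBl -!rowE; apply/matrixP=> a b; rewrite !ord1 !mxE eqxx mulr1n.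
rewrite !big_ord_recl big_ord0 !mxE /stretch /evq /dv /Dvec /=.
by rewrite -/o0 -/o1 -/o2; ring.
Qed.

Lemma Sp_dot p F (u : 'rV[R]_(n * 3)) q :
  motion p F q -> (u <= Sp p F)%MS -> u *m (mxvec q)^T = 0.
Proof.
move=> m /sub_sumsmxP[w ->]; rewrite mulmx_suml big1 // => e eF.
have /submxP[D ->] : (w e *m <<rw p e>> <= rw p e)%MS.
  by apply: submx_trans (submxMl _ _) _; rewrite genmxE.
by rewrite -mulmxA rw_dot m // raddf0 mulmx0.
Qed.

(** The columns of the cokernel matrix of [Sp p F] are motions, and some column detects any vector
    outside the row space. *)
Lemma Sp_witness p F (u : 'rV[R]_(n * 3)) : ~~ (u <= Sp p F)%MS ->
  exists2 q, motion p F q & u *m (mxvec q)^T != 0.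
Proof.
rewrite submxE => /rV0Pn[b hb].
pose c := cokermx (Sp p F) *m delta_mx b (0 : 'I_1).
exists (vec_mx c^T); rewrite ?vec_mxK ?trmxK.
  move=> e eF; have := rw_dot p e (vec_mx c^T); rewrite vec_mxK trmxK.
  have /eqP -> : rw p e *m c == 0.
    rewrite mulmxA; suff /eqP -> : rw p e *m cokermx (Sp p F) == 0 by rewrite mul0mx.
    by rewrite -submxE; apply: (sumsmx_sup e) => //; rewrite genmxE.
  by move=> /matrixP/(_ 0 0); rewrite !mxE eqxx mulr1n.
apply: contraNneq hb; rewrite mulmxA -colE => /matrixP/(_ 0 0).
by rewrite [LHS]mxE => ->; rewrite mxE.
Qed.

Lemma SpP p F (u : 'rV[R]_(n * 3)) :
  (forall q, motion p F q -> u *m (mxvec q)^T = 0) -> (u <= Sp p F)%MS.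
Proof.
by move=> h; apply: contraT => /Sp_witness[q /h ->]; rewrite eqxx.
Qed.

Definition clos p F e := (rw p e <= Sp p F)%MS.

Lemma closP p F e :
  clos p F e <-> (forall q, motion p F q -> stretch p (e1 e) (e2 e) q = 0).
Proof.
split=> [h q m|h].
  by have := Sp_dot m h; rewrite rw_dot => /matrixP/(_ 0 0); rewrite !mxE eqxx mulr1n.
by apply: SpP => q m; rewrite rw_dot h // raddf0.
Qed.

Lemma not_clos p F e : ~~ clos p F e -> exists2 q, motion p F q & stretch p (e1 e) (e2 e) q != 0.
Proof.
by move=> /Sp_witness[q m h]; exists q => //; apply: contraNneq h; rewrite rw_dot => ->; rewrite raddf0.
Qed.

Lemma SpS p F G : F \subset G -> (Sp p F <= Sp p G)%MS.
Proof.
move=> /subsetP s; apply/sumsmx_subP=> e eF; apply: (sumsmx_sup e); first exact: s.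
exact: submx_refl.
Qed.

Lemma SpU p F G : (Sp p (F :|: G) :=: Sp p F + Sp p G)%MS.
Proof.
apply/eqmxP/andP; split.
  apply/sumsmx_subP=> e; rewrite inE => /orP[eF|eG].
    apply: submx_trans (addsmxSl _ _); exact: (sumsmx_sup e).
  apply: submx_trans (addsmxSr _ _); exact: (sumsmx_sup e).
by rewrite addsmx_sub !SpS // ?subsetUl ?subsetUr.
Qed.

Lemma rkS p F G : F \subset G -> (rk p F <= rk p G)%N.
Proof. by move=> s; rewrite !rkE mxrankS // SpS. Qed.

Lemma rk_card p F : (rk p F <= #|F|)%N.
Proof.
rewrite rkE; apply: leq_trans (mxrank_sum_leqif _).1 _ => /=.
rewrite -sum1_card leq_sum // => e _; by rewrite genmxE rank_leq_row.
Qed.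

Lemma rk_submod p F G : (rk p (F :|: G) + rk p (F :&: G) <= rk p F + rk p G)%N.
Proof.
rewrite !rkE (SpU p F G) -(mxrank_sum_cap (Sp p F) (Sp p G)) leq_add2l mxrankS //.
by rewrite sub_capmx !SpS // ?subsetIl ?subsetIr.
Qed.

Lemma rkU p F G : (rk p (F :|: G) <= rk p F + #|G|)%N.
Proof.
have := rk_submod p F G; have := rk_card p G; lia.
Qed.

Lemma clos_in p F e : e \in F -> clos p F e.
Proof. by move=> eF; apply: (sumsmx_sup e) => //; rewrite genmxE. Qed.

Lemma closS p F G e : F \subset G -> clos p F e -> clos p G e.
Proof. by move=> s h; apply: submx_trans h (SpS _ s). Qed.

Lemma Sp_clos p F G : (forall e, e \in G -> clos p F e) -> (Sp p G <= Sp p F)%MS.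
Proof. by move=> h; apply/sumsmx_subP=> e /h; rewrite genmxE. Qed.

Lemma rk_clos p F G : (forall e, e \in G -> clos p F e) -> rk p (F :|: G) = rk p F.
Proof.
move=> h; rewrite !rkE (SpU p F G); apply: eqmx_rank.
by rewrite addsmxSl andbT addsmx_sub submx_refl Sp_clos.
Qed.

Lemma rk_clos_le p F G : (forall e, e \in G -> clos p F e) -> (rk p G <= rk p F)%N.
Proof. by move=> h; rewrite -(rk_clos h) rkS // subsetUr. Qed.

Lemma clos_rk p F e : (rk p (e |: F) <= rk p F)%N -> clos p F e.
Proof.
rewrite !rkE => h; have s : (Sp p F <= Sp p (e |: F))%MS by apply: SpS; apply: subsetUr.
have : (Sp p (e |: F) <= Sp p F)%MS by rewrite -(geq_leqif (mxrank_leqif_sup s)).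
by apply: submx_trans; apply: clos_in; rewrite setU11.
Qed.

Lemma clos_rkU p F G : (rk p (F :|: G) <= rk p F)%N -> forall e, e \in G -> clos p F e.
Proof.
move=> h e eG; apply: clos_rk; apply: leq_trans h; apply: rkS.
by apply/subsetP=> x; rewrite !inE => /orP[/eqP->|->//]; rewrite eG orbT.
Qed.

Lemma rk_nclos p F e : ~~ clos p F e -> rk p (e |: F) = (rk p F).+1.
Proof.
move=> h; apply/eqP; rewrite eqn_leq; apply/andP; split.
  by have := rkU p F [set e]; rewrite cards1 addn1 setUC.
by rewrite ltnNge; apply: contra h => h; apply: clos_rk.
Qed.

Lemma eq_rk p p' F :
  (forall e, e \in F -> rw p e = rw p' e) -> rk p F = rk p' F.
Proof. by move=> h; rewrite !rkE /Sp; congr mxrank; apply: eq_bigr => e /h->. Qed.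

Lemma rk_set0 p : rk p set0 = 0%N.
Proof. by have := rk_card p set0; rewrite cards0; case: rk. Qed.

Lemma clos_motion p F G q : (forall e, e \in G -> clos p F e) -> motion p F q -> motion p G q.
Proof. by move=> h m e /h /closP; apply. Qed.

Definition linform (L : 'M[R]_(n, 3) -> R) := forall c q q', L (q + c *: q') = L q + c * L q'.

Lemma linform_stretch p i j : linform (stretch p i j).
Proof. by move=> c q q'; rewrite stretchD stretchZ. Qed.

Lemma linform_sub L L' c : linform L -> linform L' -> linform (fun q => L q - c * L' q).
Proof. by move=> h h' d q q'; rewrite h h'; ring. Qed.

Lemma linform_sum (s : seq 'I_n) (c : 'I_n -> R) (L : 'I_n -> 'M[R]_(n, 3) -> R) :
  (forall j, linform (L j)) -> linform (fun q => \sum_(j <- s) c j * L j q).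
Proof.
move=> h d q q'; rewrite mulr_sumr -big_split /=; apply: eq_bigr => j _.
by rewrite h; ring.
Qed.

(** A linear form that vanishes wherever another one does is a multiple of it. If the edge already
    lies in the closure of [F], its stretch is identically zero and so is [L], which explains the
    constant 0. *)
Lemma functional_edge p F v i L : linform L -> v != i ->
  (forall q, motion p (star v [:: i] :|: F) q -> L q = 0) ->
  exists c, forall q, motion p F q -> L q = c * stretch p v i q.
Proof.
move=> lL vi h; have [e he] := joins_ex vi; rewrite (star1 he) in h.
have h' q : motion p F q -> stretch p v i q = 0 -> L q = 0.
  move=> m s; apply/h/motionU; split=> // e'; rewrite inE => /eqP->.
  by apply/eqP; rewrite (stretch_joins _ _ he) s.
case: (boolP (clos p F e)) => [/closP cl|/not_clos[q0 m0]].
  exists 0 => q m; rewrite mul0r; apply: h' => //; apply/eqP.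
  by rewrite -(stretch_joins _ _ he) cl.
rewrite (stretch_joins _ _ he) => s0.
exists (L q0 / stretch p v i q0) => q m.
have mm : motion p F (q + (- (stretch p v i q / stretch p v i q0)) *: q0).
  by apply: motionD => //; apply: motionZ.
have := h' _ mm; rewrite linform_stretch lL mulNr divfK // subrr => /(_ erefl) E.
by apply/eqP; rewrite -subr_eq0 -E; apply/eqP; ring.
Qed.

(** Lagrange multipliers, found by peeling off one star edge at a time with [functional_edge]. *)
Lemma functional_star p F v s L : linform L -> uniq s -> v \notin s ->
  (forall q, motion p (F :|: star v s) q -> L q = 0) ->
  exists c : 'I_n -> R, forall q, motion p F q -> L q = \sum_(j <- s) c j * stretch p v j q.
Proof.
elim: s F L => [|i s IH] F L lL.
  move=> _ _ h; exists (fun=> 0) => q m; rewrite big_nil; apply/h/motionU; split=> // e.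
  by rewrite !inE.
move=> /= /andP[is_ us]; rewrite inE negb_or => /andP[vi vs] h.
have [|c hc] := IH (star v [:: i] :|: F) _ lL us vs.
  by move=> q m; apply: h; rewrite star_cons setUCA setUA.
pose L' q := L q - 1 * \sum_(j <- s) c j * stretch p v j q.
have lL' : linform L' by apply: linform_sub => //; apply: linform_sum => j; apply: linform_stretch.
have [|d hd] := @functional_edge p F v i _ lL' vi.
  by move=> q /hc; rewrite /L' mul1r => ->; rewrite subrr.
exists (fun j => if j == i then d else c j) => q m.
rewrite big_cons eqxx; have := hd _ m; rewrite /L' mul1r => /eqP; rewrite subr_eq => /eqP->.
congr (_ + _); rewrite [LHS]big_seq [RHS]big_seq; apply: eq_bigr => j js.
by case: eqP => // ji; move: is_; rewrite -ji js.
Qed.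

(** This turns a rank deficiency of a star into an equation between stretches valid on all motions
    of [F]; later rank hypotheses are exploited in this form. *)
Lemma star_dep p F v s : uniq s -> v \notin s ->
  (rk p (F :|: star v s) < rk p F + size s)%N ->
  exists c : 'I_n -> R, (exists2 j, j \in s & c j != 0) /\
    forall q, motion p F q -> \sum_(j <- s) c j * stretch p v j q = 0.
Proof.
elim: s => [|i s IH] /=.
  by rewrite addn0 => _ _ h; have := leq_trans h (rkS p (subsetUl F (star v [::]))); rewrite ltnn.
move=> /andP[is_ us]; rewrite inE negb_or => /andP[vi vs] h.
have [h'|h'] := ltnP (rk p (F :|: star v s)) (rk p F + size s).
  have [c [[j js cj] hc]] := IH us vs h'.
  exists (fun k => if k == i then 0 else c k); split.
    exists j; rewrite ?inE ?js ?orbT //; case: (j =P i) => // ji; by move: is_; rewrite -ji js.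
  move=> q m; rewrite big_cons eqxx mul0r add0r; apply: etrans (hc q m); rewrite [LHS]big_seq [RHS]big_seq.
  by apply: eq_bigr => k ks; case: eqP => // ki; move: is_; rewrite -ki ks.
have [e he] := joins_ex vi.
rewrite star_cons (star1 he) setUCA addnS ltnS in h.
have /closP cl : clos p (F :|: star v s) e by apply: clos_rk; apply: leq_trans h h'.
have [|c hc] := @functional_star p F v s _ (linform_stretch p v i) us vs.
  by move=> q m; apply/eqP; rewrite -(stretch_joins _ _ he) cl.
exists (fun k => if k == i then 1 else - c k); split.
  by exists i; rewrite ?inE ?eqxx // oner_neq0.
move=> q m; rewrite big_cons eqxx mul1r (hc q m) -[X in X + _]mul1r.
rewrite mul1r [X in X + _]big_seq [X in _ + X]big_seq -big_split /= big1 // => k ks.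
by case: eqP => [ki|_]; [move: is_; rewrite -ki ks|rewrite mulNr subrr].
Qed.

End Rank.

(** * Generic configurations *)

Section Transfer.
Variables (R : realFieldType).

Lemma mxrank_mxsub (m k m' k' : nat) (f : 'I_m' -> 'I_m) (g : 'I_k' -> 'I_k) (A : 'M[R]_(m, k)) :
  (\rank (mxsub f g A) <= \rank A)%N.
Proof.
rewrite mxsubrc; apply: leq_trans (mxrankS (rowsub_sub _ _)) _.
rewrite -mxrank_tr -[leqRHS]mxrank_tr trmx_mxsub.
exact: mxrankS (rowsub_sub _ _).
Qed.

(* Lower semicontinuity of the rank: a nonvanishing maximal minor at one
   specialization bounds the rank from below wherever that minor survives. *)
Lemma rank_transfer (S : comNzRingType) (m k : nat) (M : 'M[S]_(m, k)) (f : {rmorphism S -> R}) :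
  exists s : S, f s != 0 /\
    forall g : {rmorphism S -> R}, g s != 0 -> (\rank (map_mx f M) <= \rank (map_mx g M))%N.
Proof.
set A := map_mx f M; set h := maxrankfun A.
have fB : row_full (rowsub h A)^T.
  by rewrite /row_full mxrank_tr; have := maxrowsub_free A; rewrite /row_free.
set h' := fullrankfun fB.
have E (g : {rmorphism S -> R}) : g (\det (mxsub h h' M)) = \det (mxsub h h' (map_mx g M)).
  by rewrite -det_map_mx; congr (\det _); apply/matrixP=> i j; rewrite !mxE.
have D : mxsub h h' A = (rowsub h' (rowsub h A)^T)^T.
  by rewrite trmx_mxsub trmxK -mxsub_comp.
exists (\det (mxsub h h' M)); split=> [|g].
  by rewrite E -unitfE -unitmxE D unitmx_tr fullrowsub_unit.
rewrite E -unitfE -unitmxE => u.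
by apply: leq_trans (mxrank_mxsub h h' _); rewrite (mxrank_unit u).
Qed.

(** Polynomial dependence on a line parameter, kept extensional so that identities can be written
    with brackets and evaluated by rewriting. *)
Definition polyfun (f : R -> R) := exists P : {poly R}, forall t, P.[t] = f t.

Lemma polyfun_const c : polyfun (fun=> c). Proof. by exists c%:P => t; rewrite hornerC. Qed.
Lemma polyfun_id : polyfun (fun t => t). Proof. by exists 'X => t; rewrite hornerX. Qed.
Lemma polyfunD f g : polyfun f -> polyfun g -> polyfun (fun t => f t + g t).
Proof. by case=> P hP [Q hQ]; exists (P + Q) => t; rewrite hornerD hP hQ. Qed.
Lemma polyfunM f g : polyfun f -> polyfun g -> polyfun (fun t => f t * g t).
Proof. by case=> P hP [Q hQ]; exists (P * Q) => t; rewrite hornerM hP hQ. Qed.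
Lemma polyfunN f : polyfun f -> polyfun (fun t => - f t).
Proof. by case=> P hP; exists (- P) => t; rewrite hornerN hP. Qed.

Lemma poly_inf (P : {poly R}) : (forall t, P.[t] = 0) -> P = 0.
Proof.
move=> h; apply/eqP; apply: contraT => nz.
pose s : seq R := [seq i%:R | i <- iota 0 (size P)].
have := max_poly_roots nz (rs := s).
rewrite size_map size_iota ltnn map_inj_uniq ?iota_uniq; last first.
  by move=> i j /eqP; rewrite eqr_nat => /eqP.
by move=> ->//; apply/allP=> x _; apply/rootP.
Qed.

(** The continuation principle: an identity proved at the good positions extends to the special
    ones, which are among the roots of [g]. *)
Lemma polyfun_cofinite f (g : {poly R}) : polyfun f -> g != 0 ->
  (forall t, g.[t] != 0 -> f t = 0) -> forall t, f t = 0.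
Proof.
case=> P hP g0 h t; rewrite -hP.
suff /eqP : P * g = 0 by rewrite mulf_eq0 (negbTE g0) orbF => /eqP->; rewrite horner0.
apply: poly_inf => s; rewrite hornerM; case: (eqVneq g.[s] 0) => [->|/h]; first by rewrite mulr0.
by rewrite hP => ->; rewrite mul0r.
Qed.

Lemma poly_pick (g : {poly R}) : g != 0 -> exists2 t, g.[t] != 0 & t != 0.
Proof.
move=> g0; have g0' : g * 'X != 0 by rewrite mulf_neq0 ?polyX_eq0.
pose s : seq R := [seq i%:R | i <- iota 0 (size (g * 'X))].
have us : uniq s.
  by rewrite map_inj_uniq ?iota_uniq // => i j /eqP; rewrite eqr_nat => /eqP.
case: (boolP (all (root (g * 'X)) s)) => [h|/allPn[t _]].
  by have := max_poly_roots g0' h us; rewrite size_map size_iota ltnn.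
rewrite /root hornerM hornerX mulf_eq0 negb_or => /andP[]; by exists t.
Qed.

End Transfer.

Ltac polyfun_tac :=
  repeat first [ apply: polyfun_const | apply: polyfun_id | apply: polyfunD | apply: polyfunN
               | apply: polyfunM ].

Section Good.
Variables (R : realFieldType) (n : nat).
Implicit Types (e : edge n) (F G H : {set edge n}) (i j k l v : 'I_n)
  (p : 'I_n -> R * R) (q : 'M[R]_(n, 3)).

Definition rowmx (S : nzRingType) (x y : 'I_n -> S) F : 'M[S]_(#|{: edge n}|, n * 3) :=
  \matrix_(r, c) (if enum_val r \in F then mxvec (cofactor_row x y (enum_val r)) 0 c else 0).

Lemma rank_rowmx (x y : 'I_n -> R) F : cofactor_rank x y F = \rank (rowmx x y F).
Proof.
rewrite /cofactor_rank; apply: eqmx_rank; apply/andP; split.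
  apply/sumsmx_subP=> e eF; rewrite genmxE.
  have -> : mxvec (cofactor_row x y e) = row (enum_rank e) (rowmx x y F).
    by apply/rowP=> c; rewrite !mxE enum_rankK eF.
  exact: row_sub.
apply/row_subP=> r; case: (boolP (enum_val r \in F)) => rF.
  apply: (sumsmx_sup (enum_val r)) => //; rewrite genmxE.
  suff -> : row r (rowmx x y F) = mxvec (cofactor_row x y (enum_val r)) by [].
  by apply/rowP=> c; rewrite !mxE rF.
suff -> : row r (rowmx x y F) = 0 by apply: sub0mx.
by apply/rowP=> c; rewrite !mxE (negbTE rF).
Qed.

Lemma map_rowmx (S T : comNzRingType) (f : {rmorphism S -> T}) (x y : 'I_n -> S) F :
  map_mx f (rowmx x y F) = rowmx (f \o x) (f \o y) F.
Proof.
apply/matrixP=> r c; rewrite !mxE; case: ifP => _; last by rewrite rmorph0.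
case/mxvec_indexP: c => i k; rewrite !mxvecE !mxE /Dvec /=.
by do 4?case: ifP => _; rewrite ?rmorphN ?rmorphXn ?rmorphM ?rmorphB ?rmorph0.
Qed.

Definition moved p v z : 'I_n -> R * R := fun i => if i == v then z else p i.
Definition mid (a b : R * R) (t : R) : R * R := (a.1 + t * (b.1 - a.1), a.2 + t * (b.2 - a.2)).
(* Every rank is as large as possible at [p]; moving a vertex of a good
   configuration along a line keeps it good for all but finitely many parameters. *)
Definition good p := forall F p', (rk p' F <= rk p F)%N.

Lemma moved_neq p v z i : i != v -> moved p v z i = p i.
Proof. by rewrite /moved => /negbTE->. Qed.
Lemma moved_eq p v z : moved p v z v = z.
Proof. by rewrite /moved eqxx. Qed.
Lemma mid0 (a b : R * R) : mid a b 0 = a.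
Proof. by rewrite /mid !mul0r !addr0 -surjective_pairing. Qed.
Lemma mid1 (a b : R * R) : mid a b 1 = b.
Proof. by rewrite /mid !mul1r !(addrC _ (_ - _)) !subrK -surjective_pairing. Qed.

Lemma eq_cof p p' F : p =1 p' -> rk p F = rk p' F.
Proof.
move=> h; apply: eq_rk => e _; rewrite /rw; congr mxvec; apply/matrixP=> i k.
by rewrite !mxE /Dvec !h.
Qed.

Lemma good_ext p p' : p =1 p' -> good p -> good p'.
Proof. by move=> h g F p''; rewrite -(eq_cof _ h). Qed.

(** Along the line the rows have entries in [{poly R}]. For each of the finitely many edge sets,
    [rank_transfer] at parameter 0 provides a polynomial that guards its rank; [g] is the product of
    all of them. *)
Lemma good_move p v z : good p -> exists2 g : {poly R}, g != 0 &
  forall t, g.[t] != 0 -> good (moved p v (mid (p v) z t)).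
Proof.
move=> gp.
pose x i : {poly R} := if i == v then (p v).1%:P + 'X * (z.1 - (p v).1)%:P else (p i).1%:P.
pose y i : {poly R} := if i == v then (p v).2%:P + 'X * (z.2 - (p v).2)%:P else (p i).2%:P.
have E t F : rk (moved p v (mid (p v) z t)) F = \rank (map_mx (horner_eval t) (rowmx x y F)).
  rewrite map_rowmx -rank_rowmx /rk /cofactor_rank.
  congr mxrank; apply: eq_bigr => e _; congr (<<mxvec _>>)%MS; apply/matrixP=> i k; rewrite !mxE.
  have hx j : (moved p v (mid (p v) z t) j).1 = (horner_eval t \o x) j.
    by rewrite /moved /x /= /horner_eval; case: eqP => _; rewrite !hornerE.
  have hy j : (moved p v (mid (p v) z t) j).2 = (horner_eval t \o y) j.
    by rewrite /moved /y /= /horner_eval; case: eqP => _; rewrite !hornerE.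
  by rewrite /Dvec !hx !hy.
have [s hs] := fin_all_exists (fun F => rank_transfer (rowmx x y F) (horner_eval 0)).
exists (\prod_F s F).
  apply/prodf_neq0 => F _; have [+ _] := hs F; apply: contraNneq => ->.
  by rewrite rmorph0.
move=> t; rewrite horner_prod => /prodf_neq0 ht F p'.
apply: leq_trans (gp F p') _; rewrite E; have [_ h] := hs F.
have -> : rk p F = rk (moved p v (mid (p v) z 0)) F.
  by apply: eq_cof => i; rewrite mid0 /moved; case: eqP => // ->.
by rewrite E; apply: h; apply: ht.
Qed.

Lemma good_rk p p' F : good p -> good p' -> rk p F = rk p' F.
Proof. by move=> g g'; apply/eqP; rewrite eqn_leq g g'. Qed.

Lemma stretch_moved p v z i j q : i != v -> j != v ->
  stretch (moved p v z) i j q = stretch p i j q.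
Proof. by move=> iv jv; rewrite /stretch /dv !moved_neq. Qed.

Lemma avoids_neq F v e : avoids F v -> e \in F -> (e1 e != v) && (e2 e != v).
Proof. by move=> a /a; rewrite /inc negb_or ![v == _]eq_sym. Qed.

Lemma motion_moved p v z F q : avoids F v -> motion (moved p v z) F q <-> motion p F q.
Proof.
by move=> av; split=> m e eF; have := m e eF; have /andP[h1 h2] := avoids_neq av eF;
  rewrite stretch_moved.
Qed.

Lemma rk_moved p v z F : avoids F v -> rk (moved p v z) F = rk p F.
Proof.
move=> av; apply: eq_rk => e eF; have /andP[h1 h2] := avoids_neq av eF.
rewrite /rw; congr mxvec; apply/matrixP=> i k; rewrite !mxE /Dvec.
by rewrite -/(e1 e) -/(e2 e) !moved_neq.
Qed.

End Good.

(** * Brackets and the stress of the complete graph on five points *)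

Section Brackets.
Variables (R : realFieldType).
Implicit Types (a b c d : R * R).

Definition br a b c : R := (b.1 - a.1) * (c.2 - a.2) - (b.2 - a.2) * (c.1 - a.1).

Lemma br_swap23 a b c : br a c b = - br a b c. Proof. by rewrite /br; ring. Qed.
Lemma br_swap12 a b c : br b a c = - br a b c. Proof. by rewrite /br; ring. Qed.
Lemma br_mid a b c d t : br (mid a b t) c d = br a c d + t * (br b c d - br a c d).
Proof. by rewrite /br /mid /=; ring. Qed.

(* Lagrange interpolation: four values of a binary quadratic form are dependent. *)
Lemma lagrange4 (al be ga : R) (d1 d2 d3 d4 : R * R) :
  let f (d : R * R) := al * d.1 ^+ 2 + be * (d.1 * d.2) + ga * d.2 ^+ 2 in
  let w (d d' : R * R) := d.1 * d'.2 - d.2 * d'.1 in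
  f d1 * (w d2 d3 * w d2 d4 * w d3 d4) - f d2 * (w d1 d3 * w d1 d4 * w d3 d4)
  + f d3 * (w d1 d2 * w d1 d4 * w d2 d4) - f d4 * (w d1 d2 * w d1 d3 * w d2 d3) = 0.
Proof.
case: d1 d2 d3 d4 => [x1 y1] [x2 y2] [x3 y3] [x4 y4] f w; rewrite /f /w /=; ring.
Qed.

End Brackets.

Section Geometry.
Variables (R : realFieldType) (n : nat).
Implicit Types (e : edge n) (F G H : {set edge n}) (i j k l m v : 'I_n)
  (p : 'I_n -> R * R) (q : 'M[R]_(n, 3)) (s : seq 'I_n) (X Y : {set 'I_n}).

(* [B p i j k] is twice the signed area of the triangle [i j k]. *)
Definition B p i j k := br (p i) (p j) (p k).

Lemma B23 p i j k : B p i k j = - B p i j k. Proof. exact: br_swap23. Qed.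
Lemma B12 p i j k : B p j i k = - B p i j k. Proof. exact: br_swap12. Qed.
Lemma B_nz23 p i j k : (B p i k j == 0) = (B p i j k == 0).
Proof. by rewrite /B br_swap23 oppr_eq0. Qed.
Lemma B_nz12 p i j k : (B p j i k == 0) = (B p i j k == 0).
Proof. by rewrite /B br_swap12 oppr_eq0. Qed.

Ltac bnz := first [ assumption | rewrite B_nz12; assumption | rewrite B_nz23; assumption
  | rewrite B_nz12 B_nz23; assumption | rewrite B_nz23 B_nz12; assumption
  | rewrite B_nz12 B_nz23 B_nz12; assumption ].

(* The normalised stretch of the edge [i j]: its coefficients are those of the
   self-stress of the complete graph on [i j k l m], see [K5_rel]. *)
Definition term p q i j k l m := stretch p i j q / (B p i j k * B p i j l * B p i j m).
Definition hterm p q i j k l m := evq q i (dv p i j) / (B p i j k * B p i j l * B p i j m).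

(** The denominator has three brackets, each changing sign when the ends are exchanged. Hence the
    difference in [stretch] becomes a sum of two half-edge contributions of the same shape. *)
Lemma termE p q i j k l m : term p q i j k l m = hterm p q i j k l m + hterm p q j i k l m.
Proof.
rewrite /term /hterm /stretch mulrBl; congr (_ + _).
have -> : evq q j (dv p i j) = evq q j (dv p j i) by rewrite /evq /dv /=; ring.
have -> : B p j i k * B p j i l * B p j i m = - (B p i j k * B p i j l * B p i j m).
  by rewrite /B !(br_swap12 (p i)); ring.
by rewrite invrN mulrN.
Qed.

(** Lagrange interpolation at [i]: after division by all six brackets, the four half-edges at a
    vertex cancel. *)
Lemma hterm4 p q i j k l m :
  B p i j k != 0 -> B p i j l != 0 -> B p i j m != 0 -> B p i k l != 0 ->
  B p i k m != 0 -> B p i l m != 0 ->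
  hterm p q i j k l m + hterm p q i k j l m + hterm p q i l j k m + hterm p q i m j k l = 0.
Proof.
move=> h1 h2 h3 h4 h5 h6.
have := lagrange4 (q i o0) (q i o1) (q i o2) (dv p i j) (dv p i k) (dv p i l) (dv p i m).
rewrite /= -/(evq q i (dv p i j)) -/(evq q i (dv p i k)) -/(evq q i (dv p i l)) -/(evq q i (dv p i m)).
have w x y : (dv p i x).1 * (dv p i y).2 - (dv p i x).2 * (dv p i y).1 = B p i x y.
  by rewrite /B /br /dv /=; ring.
rewrite !w /hterm (B23 p i j k) (B23 p i j l) (B23 p i j m) (B23 p i k l) (B23 p i k m) (B23 p i l m).
set a := evq q i _; set b := evq q i _; set c := evq q i _; set d := evq q i _.
move=> E; rewrite -[RHS](mul0r ((B p i j k * B p i j l * B p i j m * B p i k l * B p i k m * B p i l m)^-1)) -E.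
by field; rewrite h1 h2 h3 h4 h5 h6.
Qed.

Definition genpos p := forall i j k, uniq [:: i; j; k] -> B p i j k != 0.

(* The self-stress of a complete graph on five points in general position. *)
Lemma K5_rel p q i j k l m :
  B p i j k != 0 -> B p i j l != 0 -> B p i j m != 0 -> B p i k l != 0 -> B p i k m != 0 ->
  B p i l m != 0 -> B p j k l != 0 -> B p j k m != 0 -> B p j l m != 0 -> B p k l m != 0 ->
  (term p q i j k l m + term p q i k j l m + term p q i l j k m + term p q i m j k l)
  + (term p q j k i l m + term p q j l i k m + term p q j m i k l
  + term p q k l i j m + term p q k m i j l + term p q l m i j k) = 0.
Proof.
move=> h1 h2 h3 h4 h5 h6 h7 h8 h9 h10.
(* The twenty half-edges are grouped by their vertex, and each of the five groups vanishes. *)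
have E1 : hterm p q i j k l m + hterm p q i k j l m + hterm p q i l j k m + hterm p q i m j k l = 0.
  by apply: hterm4; bnz.
have E2 : hterm p q j i k l m + hterm p q j k i l m + hterm p q j l i k m + hterm p q j m i k l = 0.
  by apply: hterm4; bnz.
have E3 : hterm p q k i j l m + hterm p q k j i l m + hterm p q k l i j m + hterm p q k m i j l = 0.
  by apply: hterm4; bnz.
have E4 : hterm p q l i j k m + hterm p q l j i k m + hterm p q l k i j m + hterm p q l m i j k = 0.
  by apply: hterm4; bnz.
have E5 : hterm p q m i j k l + hterm p q m j i k l + hterm p q m k i j l + hterm p q m l i j k = 0.
  by apply: hterm4; bnz.
by rewrite !termE; lra.
Qed.

Definition form_at v (al be ga : R) : 'M[R]_(n, 3) :=
  \matrix_(i, k) (if i == v then (if k == o0 then al else if k == o1 then be else ga) else 0).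

Lemma stretch_form p v j al be ga : j != v ->
  stretch p v j (form_at v al be ga)
  = al * (dv p v j).1 ^+ 2 + be * ((dv p v j).1 * (dv p v j).2) + ga * (dv p v j).2 ^+ 2.
Proof. by move=> jv; rewrite /stretch /evq !mxE eqxx (negbTE jv) /= !mul0r !addr0 subr0. Qed.

Lemma motion_form p F v al be ga : avoids F v -> motion p F (form_at v al be ga).
Proof.
move=> av e eF; have /andP[h1 h2] := avoids_neq av eF.
by rewrite /stretch /evq !mxE (negbTE h1) (negbTE h2) !mul0r !addr0 subrr.
Qed.

(** A form placed at [v] alone is a motion of any graph avoiding [v]. A relation between stretches
    at [v] therefore restricts to a relation between the values of an arbitrary quadratic form in
    the edge directions. *)
Lemma star_forms p F v s (c : 'I_n -> R) : avoids F v -> v \notin s ->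
  (forall q, motion p F q -> \sum_(j <- s) c j * stretch p v j q = 0) ->
  forall al be ga, \sum_(j <- s) c j * (al * (dv p v j).1 ^+ 2
     + be * ((dv p v j).1 * (dv p v j).2) + ga * (dv p v j).2 ^+ 2) = 0.
Proof.
move=> av vs h al be ga; apply: etrans (h _ (motion_form p al be ga av)).
rewrite [LHS]big_seq [RHS]big_seq; apply: eq_bigr => j js; rewrite stretch_form //.
by apply: contraNneq vs => <-.
Qed.

Definition wd p v i j := (dv p v i).1 * (dv p v j).2 - (dv p v i).2 * (dv p v j).1.
Lemma wdE p v i j : wd p v i j = B p v i j.
Proof. by rewrite /wd /B /br /dv /=; ring. Qed.

(* Test the relation on the form at [v] that vanishes in the directions of [a] and [b]. *)
Lemma star_forms2 p F v s (c : 'I_n -> R) : avoids F v -> v \notin s ->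
  (forall q, motion p F q -> \sum_(j <- s) c j * stretch p v j q = 0) ->
  forall a b, \sum_(j <- s) c j * (B p v j a * B p v j b) = 0.
Proof.
move=> av vs h a b.
have := star_forms av vs h ((dv p v a).2 * (dv p v b).2)
  (- ((dv p v a).1 * (dv p v b).2 + (dv p v a).2 * (dv p v b).1)) ((dv p v a).1 * (dv p v b).1).
by move=> E; apply: etrans E; apply: eq_bigr => j _; rewrite -!wdE /wd; ring.
Qed.

Lemma B_same p v i : B p v i i = 0. Proof. by rewrite /B /br; ring. Qed.

Lemma star_indep p F v s : uniq s -> v \notin s ->
  (forall c : 'I_n -> R, (forall q, motion p F q -> \sum_(j <- s) c j * stretch p v j q = 0) ->
     forall j, j \in s -> c j = 0) ->
  rk p (F :|: star v s) = (rk p F + size s)%N.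
Proof.
move=> us vs h; apply/eqP; rewrite eqn_leq; apply/andP; split.
  by apply: leq_trans (rkU _ _ _) _; rewrite card_star.
rewrite leqNgt; apply/negP=> /(star_dep us vs)[c [[j js cj] hc]].
by move: cj; rewrite (h c hc j js) eqxx.
Qed.

(** For each pair of the three directions there is a form vanishing on both, and it isolates the
    coefficient of the third edge. *)
Lemma star3 p F v i j k : avoids F v -> uniq [:: v; i; j; k] ->
  B p v i j != 0 -> B p v i k != 0 -> B p v j k != 0 ->
  rk p (F :|: star v [:: i; j; k]) = (rk p F + 3)%N.
Proof.
move=> av /= /andP[vs us] h1 h2 h3; apply: star_indep => // c hc.
have E := star_forms2 av vs hc.
have := E j k; have := E i k; have := E i j.
rewrite !big_cons !big_nil !B_same !(mulr0, mul0r, addr0, add0r) => /eqP e1 /eqP e2 /eqP e3 x.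
move: e1 e2 e3; rewrite !mulf_eq0 (B23 p v i j) (B23 p v i k) (B23 p v j k) !oppr_eq0.
rewrite (negbTE h1) (negbTE h2) (negbTE h3) !orbF => /eqP e1 /eqP e2 /eqP e3.
by rewrite !inE => /or3P[] /eqP->.
Qed.

Lemma star2 p F v i j : avoids F v -> uniq [:: v; i; j] -> B p v i j != 0 ->
  rk p (F :|: star v [:: i; j]) = (rk p F + 2)%N.
Proof.
move=> av /= /andP[vs us] h1; apply: star_indep => // c hc.
have E := star_forms2 av vs hc.
have := E j j; have := E i i.
rewrite !big_cons !big_nil !B_same !(mulr0, mul0r, addr0, add0r) => /eqP e1 /eqP e2 x.
move: e1 e2; rewrite !mulf_eq0 (B23 p v i j) !oppr_eq0.
rewrite (negbTE h1) !orbF => /eqP e1 /eqP e2.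
by rewrite !inE => /orP[] /eqP->.
Qed.

Lemma star1_indep p F v i : avoids F v -> v != i -> p v != p i ->
  rk p (F :|: star v [:: i]) = (rk p F + 1)%N.
Proof.
move=> av vi h1; apply: star_indep => //; first by rewrite inE.
move=> c hc j; rewrite inE => /eqP->.
have := star_forms av _ hc 1 0 1; rewrite inE => /(_ vi); rewrite big_seq1 mul0r addr0 !mul1r => /eqP.
rewrite mulf_eq0 => /orP[/eqP//|]; rewrite paddr_eq0 ?sqr_ge0 // !sqrf_eq0 /= !subr_eq0 => /andP[/eqP a /eqP b].
by move: h1; rewrite (surjective_pairing (p v)) a b -surjective_pairing eqxx.
Qed.

(** In four directions the relation is unique up to a scalar, and it is the star part of the stress
    in [K5_rel]. That identity exchanges it for the six edges opposite to [v], which involve [F]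
    alone. *)
Lemma star4_coef p v i j k l (c : 'I_n -> R) :
  B p v i j != 0 -> B p v i k != 0 -> B p v i l != 0 -> B p v j k != 0 ->
  B p v j l != 0 -> B p v k l != 0 -> B p i j k != 0 -> B p i j l != 0 ->
  B p i k l != 0 -> B p j k l != 0 ->
  (forall a b, \sum_(x <- [:: i; j; k; l]) c x * (B p v x a * B p v x b) = 0) ->
  exists s : R, (s = 0 -> forall x, x \in [:: i; j; k; l] -> c x = 0) /\
    forall q, \sum_(x <- [:: i; j; k; l]) c x * stretch p v x q =
      s * (term p q i j v k l + term p q i k v j l + term p q i l v j k
       + term p q j k v i l + term p q j l v i k + term p q k l v i j).
Proof.
move=> h1 h2 h3 h4 h5 h6 h7 h8 h9 h10 E.
(* Killing two of the directions [j], [k], [l] leaves two coefficients; the three choices express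
   all of them through that of [i]. *)
have := E k l; have := E j l; have := E j k.
rewrite !big_cons !big_nil !B_same !(mulr0, mul0r, addr0, add0r).
rewrite (B23 p v j k) (B23 p v j l) (B23 p v k l) => e2 e3 e4.
pose s := c i * (B p v i j * B p v i k * B p v i l).
have cj : c j = s / (B p v j i * B p v j k * B p v j l).
  rewrite /s (B23 p v i j); apply/eqP; rewrite -subr_eq0; apply/eqP.
  rewrite -[RHS](mul0r (B p v j k * B p v j l)^-1) -e4.
  by field; rewrite h1 h4 h5.
have ck : c k = s / (B p v k i * B p v k j * B p v k l).
  rewrite /s (B23 p v i k) (B23 p v j k); apply/eqP; rewrite -subr_eq0; apply/eqP.
  rewrite -[RHS](mul0r (- (B p v j k * B p v k l))^-1) -e3.
  by field; rewrite h2 h4 h6.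
have cl : c l = s / (B p v l i * B p v l j * B p v l k).
  rewrite /s (B23 p v i l) (B23 p v j l) (B23 p v k l); apply/eqP; rewrite -subr_eq0; apply/eqP.
  rewrite -[RHS](mul0r (B p v j l * B p v k l)^-1) -e2.
  by field; rewrite h3 h5 h6.
have ci : c i = s / (B p v i j * B p v i k * B p v i l).
  by rewrite /s; field; rewrite h1 h2 h3.
exists (- s); split=> [/eqP|q].
  rewrite oppr_eq0 => /eqP s0 x; rewrite !inE.
  by move=> /or4P[] /eqP->; rewrite ?ci ?cj ?ck ?cl s0 mul0r.
have := K5_rel q h1 h2 h3 h4 h5 h6 h7 h8 h9 h10.
have -> : \sum_(x <- [:: i; j; k; l]) c x * stretch p v x q
   = s * (term p q v i j k l + term p q v j i k l + term p q v k i j l + term p q v l i j k).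
  rewrite !big_cons big_nil addr0 ci cj ck cl /term; field.
  by rewrite ?(B23 p v i j) ?(B23 p v i k) ?(B23 p v i l) ?(B23 p v j k) ?(B23 p v j l) ?(B23 p v k l) !oppr_eq0 h1 h2 h3 h4 h5 h6.
by rewrite addrC => /eqP; rewrite addr_eq0 => /eqP->; rewrite mulNr mulrN opprK.
Qed.

Lemma star4_rel p F v i j k l q : avoids F v -> uniq [:: v; i; j; k; l] ->
  B p v i j != 0 -> B p v i k != 0 -> B p v i l != 0 -> B p v j k != 0 ->
  B p v j l != 0 -> B p v k l != 0 -> B p i j k != 0 -> B p i j l != 0 ->
  B p i k l != 0 -> B p j k l != 0 ->
  (rk p (F :|: star v [:: i; j; k; l]) < rk p F + 4)%N -> motion p F q ->
  term p q i j v k l + term p q i k v j l + term p q i l v j k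
  + term p q j k v i l + term p q j l v i k + term p q k l v i j = 0.
Proof.
move=> av /= /andP[vs us] h1 h2 h3 h4 h5 h6 h7 h8 h9 h10 /(@star_dep _ _ p F v [:: i; j; k; l] us vs)[c [[x xs cx] hc]] mq.
have [s [s0 hs]] := star4_coef h1 h2 h3 h4 h5 h6 h7 h8 h9 h10 (star_forms2 av vs hc).
have /eqP := hc _ mq; rewrite hs mulf_eq0 => /orP[/eqP/s0 h|/eqP//].
by rewrite (h x xs) eqxx in cx.
Qed.

End Geometry.

Ltac ucut u :=
  let h := fresh "ne" in have h := u; rewrite /= ?inE ?negb_or -?andbA ?andbT in h;
  repeat (let a := fresh "ne" in case/andP: h => a h).
Ltac uniqs := rewrite /= ?inE ?negb_or -?andbA ?andbT; repeat (apply/andP; split);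
  first [ done | assumption | rewrite eq_sym; assumption ].

(** * Brackets along a line, and general position of good configurations *)

Section Lines.
Variable R : realFieldType.

(** At the root of the first affine function only the first product survives. The evaluation is done
    homogeneously at [(b1, -a1)], so that [b1] may be zero. *)
Lemma three_lines1 (k1 k2 k3 a1 b1 a2 b2 a3 b3 : R) :
  (forall t, k1 * ((a2 + t * b2) * (a3 + t * b3)) + k2 * ((a1 + t * b1) * (a3 + t * b3))
    + k3 * ((a1 + t * b1) * (a2 + t * b2)) = 0) ->
  a2 * b1 - b2 * a1 != 0 -> a3 * b1 - b3 * a1 != 0 -> k1 = 0.
Proof.
move=> h h2 h3; have := h 0; have := h 1; have := h (-1) => e1 e2 e3.
apply/eqP; rewrite -(mulIr_eq0 _ (mulIf (mulf_neq0 h2 h3))).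
set e := (X in X = 0) in e1; set f := (X in X = 0) in e2; set g := (X in X = 0) in e3.
(* The values at [-1], [1] and [0], called [e], [f], [g], recover the three coefficients of the
   quadratic polynomial. *)
have -> : k1 * ((a2 * b1 - b2 * a1) * (a3 * b1 - b3 * a1))
  = g * b1 ^+ 2 - (f - e) / 2 * a1 * b1 + ((f + e) / 2 - g) * a1 ^+ 2.
  by rewrite /e /f /g; field.
by rewrite e1 e2 e3; apply/eqP; field.
Qed.

Lemma three_lines (k1 k2 k3 a1 b1 a2 b2 a3 b3 : R) :
  (forall t, k1 * ((a2 + t * b2) * (a3 + t * b3)) + k2 * ((a1 + t * b1) * (a3 + t * b3))
    + k3 * ((a1 + t * b1) * (a2 + t * b2)) = 0) ->
  a2 * b1 - b2 * a1 != 0 -> a3 * b1 - b3 * a1 != 0 -> a3 * b2 - b3 * a2 != 0 ->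
  [/\ k1 = 0, k2 = 0 & k3 = 0].
Proof.
move=> h h1 h2 h3.
have S x y z w : x * w - y * z != 0 -> z * y - w * x != 0 :> R.
  by move=> u; rewrite (_ : _ - _ = - (x * w - y * z)) ?oppr_eq0 //; ring.
split; first exact: three_lines1 h h1 h2.
  by apply: (@three_lines1 k2 k1 k3 a2 b2 a1 b1 a3 b3) (S _ _ _ _ h1) h3 => t; rewrite -(h t); ring.
by apply: (@three_lines1 k3 k1 k2 a3 b3 a1 b1 a2 b2) (S _ _ _ _ h2) (S _ _ _ _ h3) => t; rewrite -(h t); ring.
Qed.

Lemma plucker (a b c d e : R * R) :
  br a c e * br b c d - br b c e * br a c d = - (br a b c * br c d e).
Proof. by rewrite /br; ring. Qed.

End Lines.

Section Generic.
Variables (R : realFieldType) (n : nat).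
Implicit Types (e : edge n) (F G H A : {set edge n}) (i j k l m v a b c y : 'I_n)
  (p : 'I_n -> R * R) (q : 'M[R]_(n, 3)) (s : seq 'I_n) (X Y : {set 'I_n}).

(** The three edge directions are proportional, so the forms at [i] and [j] both agree with the form
    at [v] along the common line. *)
Lemma collinear_stretch p v i j t q : p v = mid (p i) (p j) t -> t != 0 -> t != 1 ->
  stretch p v i q = 0 -> stretch p v j q = 0 -> stretch p i j q = 0.
Proof.
move=> E t0 t1 h1 h2; have t1' : 1 - t != 0 by rewrite subr_eq0 eq_sym.
have -> : stretch p i j q = stretch p v j q / (1 - t) ^+ 2 - stretch p v i q / t ^+ 2.
  by rewrite /stretch /evq /dv E /mid /=; field; rewrite t0 t1'.
by rewrite h1 h2 !mul0r subr0.
Qed.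

(** A triangle has rank three at noncollinear points but at most two at collinear ones, where one
    edge lies in the closure of the others; maximality of the rank excludes the latter. *)
Lemma good_genpos p : good p -> genpos p.
Proof.
move=> gp i j k u; apply/negP=> /eqP B0.
have [ij ik jk] : [/\ i != j, i != k & j != k].
  by move: u; rewrite /= !inE negb_or andbT => /andP[/andP[-> ->] ->].
pose p' x : R * R := if x == i then (0, 0) else if x == j then (1, 0) else (0, 1).
have aj : avoids (set0 : {set edge n}) j by move=> e; rewrite inE.
have ak : avoids (set0 :|: star j [:: i]) k.
  move=> e; rewrite !inE /= orbF => h; rewrite (inc_joins _ h) negb_or.
  by rewrite ![k == _]eq_sym jk ik.
have r3 : rk p' ((set0 :|: star j [:: i]) :|: star k [:: i; j]) = 3%N.
  rewrite star2 //.
  - rewrite (star1_indep aj); rewrite ?rk_set0 //; first by rewrite eq_sym.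
    by rewrite /p' eqxx [j == i]eq_sym (negbTE ij) eqxx xpair_eqE eqxx andbT oner_eq0.
  - by rewrite /= !inE negb_or ![k == _]eq_sym ik jk ij.
  - rewrite /B /br /p' eqxx ![_ == i]eq_sym (negbTE ij) (negbTE ik) ![k == j]eq_sym (negbTE jk) eqxx /=.
    by rewrite [X in X != 0](_ : _ = 1) ?oner_eq0 //; ring.
have := gp ((set0 :|: star j [:: i]) :|: star k [:: i; j]) p'; rewrite r3.
have [e1 h1] := joins_ex ij; have [e2 h2] := joins_ex ik; have [e3 h3] := joins_ex jk.
have -> : (set0 :|: star j [:: i]) :|: star k [:: i; j] = [set e1; e2; e3].
  rewrite joinsC in h1; rewrite joinsC in h2; rewrite joinsC in h3.
  by rewrite (star_cons k) (star1 h1) (star1 h2) (star1 h3) set0U setUA.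
rewrite leqNgt => /negP; apply; rewrite ltnS.
have two F e : clos p F e -> (#|F| <= 2)%N -> (rk p (e |: F) <= 2)%N.
  move=> h f; apply: leq_trans f; apply: leq_trans (rk_card p F); rewrite setUC.
  by rewrite rk_clos // => x; rewrite inE => /eqP->.
have c2 (x y : edge n) : (#|[set x; y]| <= 2)%N by rewrite cards2; case: eqP.
(* Coincident points are separated first: the edge then has zero stretch, and no direction is
   available for the proportionality argument. *)
case: (eqVneq (p i) (p k)) => [E|nik].
  rewrite setUAC setUC; apply: two (c2 _ _); apply/closP=> q _; apply/eqP.
  by rewrite (stretch_joins _ _ h2) /stretch /evq /dv E /= !subrr; apply/eqP; ring.
case: (eqVneq (p j) (p k)) => [E|njk].
  rewrite setUC; apply: two (c2 _ _); apply/closP=> q _; apply/eqP.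
  by rewrite (stretch_joins _ _ h3) /stretch /evq /dv E /= !subrr; apply/eqP; ring.
rewrite -setUA; apply: two (c2 _ _); apply/closP=> q m; apply/eqP.
have /eqP m2 := m e2 (set21 _ _); have /eqP m3 := m e3 (set22 _ _).
rewrite (stretch_joins _ _ h2) in m2; rewrite (stretch_joins _ _ h3) in m3.
rewrite (stretch_joins _ _ h1).
have [sc Es] : exists sc : R, dv p j k = (sc * (dv p i k).1, sc * (dv p i k).2).
  have : ((dv p i k).1 != 0) || ((dv p i k).2 != 0).
    rewrite -negb_and; apply: contra nik => /andP[].
    by rewrite /dv /= !subr_eq0 (surjective_pairing (p i)) (surjective_pairing (p k)) xpair_eqE => -> ->.
  have Bz : (dv p j k).2 * (dv p i k).1 = (dv p j k).1 * (dv p i k).2.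
    by apply/eqP; rewrite -subr_eq0 -B0 /B /br /dv /=; apply/eqP; ring.
  case/orP=> d0.
    exists ((dv p j k).1 / (dv p i k).1); by rewrite divfK // mulrAC -Bz mulfK.
  exists ((dv p j k).2 / (dv p i k).2); by rewrite divfK // mulrAC Bz mulfK.
have sc0 : sc != 0.
  apply: contra_neq njk => sc0; move: Es; rewrite sc0 !mul0r /dv => -[/eqP + /eqP].
  rewrite !subr_eq0 => /eqP ha /eqP hb.
  by rewrite (surjective_pairing (p j)) (surjective_pairing (p k)) ha hb.
have Ed : dv p i j = ((1 - sc) * (dv p i k).1, (1 - sc) * (dv p i k).2).
  move: Es; rewrite /dv /= => -[/(canRL (subrK _)) Ea /(canRL (subrK _)) Eb].
  by rewrite Ea Eb; congr pair; ring.
have E x0 x1 x2 (t d1 d2 : R) : x0 * (t * d1) ^+ 2 + x1 * (t * d1 * (t * d2))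
  + x2 * (t * d2) ^+ 2 = t ^+ 2 * (x0 * d1 ^+ 2 + x1 * (d1 * d2) + x2 * d2 ^+ 2) by ring.
move: m2 m3; rewrite /stretch Es Ed /evq /= !E -!mulrBr subr_eq0 => /eqP ->.
rewrite mulf_eq0 sqrf_eq0 (negbTE sc0) /= => h.
by rewrite mulf_eq0; apply/orP; right; rewrite -oppr_eq0 opprB.
Qed.

Lemma K5_zero p i j k l m q : genpos p -> uniq [:: i; j; k; l; m] ->
  stretch p i j q = 0 -> stretch p i k q = 0 -> stretch p i l q = 0 -> stretch p i m q = 0 ->
  stretch p j k q = 0 -> stretch p j l q = 0 -> stretch p j m q = 0 ->
  stretch p k l q = 0 -> stretch p k m q = 0 -> stretch p l m q = 0.
Proof.
move=> g u s1 s2 s3 s4 s5 s6 s7 s8 s9.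
ucut u.
have E := @K5_rel _ _ p q i j k l m.
do 10! (specialize (E ltac:(apply: g; uniqs))).
move: E; rewrite /term s1 s2 s3 s4 s5 s6 s7 s8 s9 !mul0r !add0r => /eqP.
rewrite mulf_eq0 invr_eq0 !mulf_eq0 => /orP[/eqP//|].
have [b1 b2 b3] : [/\ B p l m i != 0, B p l m j != 0 & B p l m k != 0].
  by split; apply: g; uniqs.
by rewrite (negbTE b1) (negbTE b2) (negbTE b3).
Qed.

End Generic.

(** * Flats, cliques and dependent stars *)

Section Flats.
Variables (R : realFieldType) (n : nat).
Implicit Types (e : edge n) (F G H A : {set edge n}) (i j k l m v a b c y : 'I_n)
  (p : 'I_n -> R * R) (q : 'M[R]_(n, 3)) (s : seq 'I_n) (U X Y : {set 'I_n}).

Definition flat p A := forall i j, i != j ->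
  (forall q, motion p A q -> stretch p i j q = 0) -> adj A i j.
Definition cliq A X := forall i j, i \in X -> j \in X -> i != j -> adj A i j.

Lemma flat_clos p A e : flat p A -> clos p A e -> e \in A.
Proof.
move=> f /closP h; rewrite -(adjE A (joins_e e)).
exact: f (e12_neq e) h.
Qed.

Lemma flat_witness p A i j : flat p A -> i != j -> ~~ adj A i j ->
  exists2 q, motion p A q & stretch p i j q != 0.
Proof.
move=> f ij na; have [e he] := joins_ex ij.
case: (boolP (clos p A e)) => [/(flat_clos f)|/not_clos[q m h]].
  by rewrite -(adjE A he) (negbTE na).
by exists q => //; rewrite -(stretch_joins _ _ he).
Qed.

Lemma flat_good p p' A : good p -> good p' -> flat p A -> flat p' A.
Proof.
move=> g g' f i j ij h; have [e he] := joins_ex ij; rewrite (adjE A he).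
apply: (flat_clos f); apply: clos_rk.
rewrite (good_rk (e |: A) g g') (good_rk A g g') setUC rk_clos // => e'.
rewrite inE => /eqP->; apply/closP=> q m; apply/eqP; rewrite (stretch_joins _ _ he).
by apply/eqP; apply: h.
Qed.

Lemma flat_K5 p A i j k l m : genpos p -> flat p A -> uniq [:: i; j; k; l; m] ->
  adj A i j -> adj A i k -> adj A i l -> adj A i m -> adj A j k -> adj A j l -> adj A j m ->
  adj A k l -> adj A k m -> adj A l m.
Proof.
move=> g f u a1 a2 a3 a4 a5 a6 a7 a8 a9; apply: f; first by ucut u.
by move=> q mq; apply: (K5_zero g u); apply: (motion_adj mq).
Qed.

(** With [a], [b], [c] and [v], any further vertex of [Y] spans a complete graph on five vertices
    that lacks one edge, and flatness supplies that edge. *)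
Lemma cliq_attach p A Y v a b c : genpos p -> flat p A -> cliq A Y -> v \notin Y ->
  a \in Y -> b \in Y -> c \in Y -> uniq [:: a; b; c] ->
  adj A v a -> adj A v b -> adj A v c -> cliq A (v |: Y).
Proof.
move=> g f cY vY aY bY cY' u va vb vc.
have key y : y \in Y -> adj A v y.
  move=> yY; case: (eqVneq y a) => [->//|ya]; case: (eqVneq y b) => [->//|yb].
  case: (eqVneq y c) => [->//|yc].
  have nv z : z \in Y -> v != z by move=> zY; apply: contraNneq vY => ->.
  have va' := nv a aY; have vb' := nv b bY; have vc' := nv c cY'; have vy' := nv y yY.
  ucut u; rewrite adjC; apply: (@flat_K5 p A a b c y v g f);
    solve [ by rewrite adjC | by apply: cY => //; uniqs | by uniqs ].
move=> i j; rewrite !inE => /orP[/eqP->|iY] /orP[/eqP->|jY]; rewrite ?eqxx // => ij.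
- exact: key.
- by rewrite adjC; apply: key.
- exact: cY.
Qed.

Lemma set3P (X : {set 'I_n}) : (2 < #|X|)%N ->
  exists a b c, [/\ a \in X, b \in X, c \in X & uniq [:: a; b; c]].
Proof.
move=> h; have := enum_uniq X; have := mem_enum X; rewrite cardE in h.
case: (enum X) h => [|a [|b [|c s]]] //= _ mem u.
exists a, b, c; split; try by rewrite -mem !inE eqxx ?orbT.
by move: u; rewrite !inE !negb_or -!andbA andbT => /and5P[-> -> _ -> _].
Qed.

Lemma cliq_merge p A X Y : genpos p -> flat p A -> cliq A X -> cliq A Y ->
  (2 < #|X :&: Y|)%N -> cliq A (X :|: Y).
Proof.
move=> g f cX cY /set3P[a [b [c [aI bI cI u]]]].
have [m] := ubnP #|Y :\: X|; elim: m X cX aI bI cI => // m IH X cX aI bI cI.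
rewrite ltnS; case: (set_0Vmem (Y :\: X)) => [E|[v vD]] h.
  by rewrite (_ : X :|: Y = X) //; apply/setUidPl; rewrite -setD_eq0 E.
move: (vD) (aI) (bI) (cI); rewrite !inE => /andP[vX vY] /andP[aX aY] /andP[bX bY] /andP[cX' cY'].
have nv z : z \in X -> v != z by move=> zX; apply: contraNneq vX => ->.
have cvX : cliq A (v |: X).
  by apply: (cliq_attach g f cX vX aX bX cX' u); apply: cY => //; apply: nv.
have -> : X :|: Y = (v |: X) :|: Y by apply/setP=> z; rewrite !inE; case: eqP => [->|]; rewrite ?vY ?orbT.
apply: IH => //; try by rewrite !inE ?aX ?bX ?cX' ?aY ?bY ?cY' orbT.
apply: leq_trans h; rewrite [leqRHS](cardsD1 v) vD add1n ltnS; apply: subset_leq_card.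
by apply/subsetP=> z; rewrite !inE negb_or => /andP[/andP[-> ->] ->].
Qed.

Lemma within_add v Y : v \notin Y -> within (v |: Y) = within Y :|: star v (enum Y).
Proof.
move=> vY; apply/setP=> e; rewrite inE [RHS]inE; apply/idP/orP.
  rewrite !inE => /andP[/orP[/eqP h1|h1] /orP[/eqP h2|h2]].
  - by have := e12_neq e; rewrite h1 h2 eqxx.
  - right; apply/hasP; exists (e2 e); rewrite ?mem_enum //.
    by rewrite -h1; apply: joins_e.
  - right; apply/hasP; exists (e1 e); rewrite ?mem_enum //.
    by rewrite joinsC -h2; apply: joins_e.
  - by rewrite h1 h2; left.
case=> [|/star_joins[y]]; first by rewrite !inE => /andP[-> ->]; rewrite !orbT.
rewrite mem_enum => yY h; case: (joins_cases h) => -[E1 E2]; by rewrite E1 E2 !inE eqxx yY ?orbT.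
Qed.

Lemma star_clos3 p F Y v a b c : genpos p -> within Y \subset F -> v \notin Y ->
  a \in Y -> b \in Y -> c \in Y -> uniq [:: a; b; c] ->
  forall e, e \in star v (enum Y) -> clos p (F :|: star v [:: a; b; c]) e.
Proof.
move=> g /subsetP wF vY aY bY cY u e /star_joins[y]; rewrite mem_enum => yY he.
apply/closP=> q /motionU[mF ms]; apply/eqP; rewrite (stretch_joins _ _ he).
have vv z : z \in [:: a; b; c] -> stretch p v z q = 0.
  move=> zs; have /joins_ex[e' he'] : v != z.
    by apply: contraNneq vY => ->; move: zs; rewrite !inE => /or3P[] /eqP->.
  have /ms/eqP : e' \in star v [:: a; b; c] by apply: joins_star he'.
  by rewrite (stretch_joins _ _ he') => /eqP.
case: (boolP (y \in [:: a; b; c])) => [/vv->//|]; rewrite !inE !negb_or => /and3P[ya yb yc].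
have ww x z : x \in Y -> z \in Y -> x != z -> stretch p x z q = 0.
  move=> xY zY /joins_ex[e' he']; have /wF/mF/eqP : e' \in within Y by rewrite (within_joins _ he') xY.
  by rewrite (stretch_joins _ _ he') => /eqP.
have nv z : z \in Y -> v != z by move=> zY; apply: contraNneq vY => ->.
have va' := nv a aY; have vb' := nv b bY; have vc' := nv c cY; have vy' := nv y yY.
ucut u; rewrite stretchC oppr_eq0; apply/eqP.
apply: (@K5_zero _ _ p a b c y v q g);
  solve [ by rewrite stretchC vv ?oppr0 // !inE eqxx ?orbT | by apply: ww => //; uniqs | by uniqs ].
Qed.

Lemma good_neq p i j : good p -> i != j -> p i != p j.
Proof.
move=> g ij; apply/negP=> /eqP E; have [e he] := joins_ex ij.
pose p' x : R * R := if x == i then (0, 0) else (1, 1).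
have a0 : avoids (set0 : {set edge n}) i by move=> e'; rewrite inE.
have := g (set0 :|: star i [:: j]) p'; rewrite star1_indep //; last first.
  by rewrite /p' eqxx [j == i]eq_sym (negbTE ij) xpair_eqE negb_and eq_sym oner_eq0.
rewrite (star1 he) rk_clos ?rk_set0 // => e'; rewrite inE => /eqP->.
apply/closP=> q _; apply/eqP; rewrite (stretch_joins _ _ he) /stretch /evq /dv E /= !subrr.
by apply/eqP; ring.
Qed.

Lemma rk_within_add p Y v : good p -> v \notin Y ->
  rk p (within (v |: Y)) = (rk p (within Y) + minn #|Y| 3)%N.
Proof.
move=> gp vY; have g := good_genpos gp.
have nv z : z \in Y -> v != z by move=> zY; apply: contraNneq vY => ->.
have av : avoids (within Y) v.
  by move=> e eY; apply: (@within_avoids _ setT Y v vY e); rewrite inE inE eY.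
have [Y3|Y3] := leqP #|Y| 2; last first.
  have [a [b [c [aY bY cY u]]]] := set3P Y3.
  rewrite within_add // (minn_idPr _) //.
  rewrite -(@star3 _ _ p _ v a b c av); last 4 first.
  - have va := nv a aY; have vb := nv b bY; have vc := nv c cY; ucut u; uniqs.
  - have va := nv a aY; have vb := nv b bY; have vc := nv c cY; ucut u; apply: g; uniqs.
  - have va := nv a aY; have vb := nv b bY; have vc := nv c cY; ucut u; apply: g; uniqs.
  - have va := nv a aY; have vb := nv b bY; have vc := nv c cY; ucut u; apply: g; uniqs.
  apply/eqP; rewrite eqn_leq; apply/andP; split.
    apply: rk_clos_le => e; rewrite inE => /orP[h|]; first by apply: clos_in; rewrite inE h.
    exact: star_clos3.
  by apply: rkS; apply: setUS; apply: starS => z; rewrite mem_enum !inE => /or3P[] /eqP->.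
rewrite within_add // (minn_idPl _); last exact: leqW.
rewrite cardE in Y3 *; have := enum_uniq Y; have := mem_enum Y.
case: (enum Y) Y3 => [|a [|b []]] //= _ mem u.
- rewrite addn0 [star _ _](_ : _ = set0) ?setU0 //; by apply/setP=> e; rewrite !inE.
- have aY : a \in Y by rewrite -mem inE.
  rewrite star1_indep //; first exact: nv.
  exact: good_neq (nv a aY).
have aY : a \in Y by rewrite -mem !inE eqxx.
have bY : b \in Y by rewrite -mem !inE eqxx orbT.
have va := nv a aY; have vb := nv b bY.
have ab : a != b by move: u; rewrite inE andbT.
rewrite star2 //; first by uniqs.
by apply: g; uniqs.
Qed.

Lemma rk_within p X : good p -> (2 < #|X|)%N -> (rk p (within X) + 6 = 3 * #|X|)%N.
Proof.
move=> g X3.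
(* The predecessor covers the ranks 0, 0, 1 for at most two vertices; from three on, every new
   vertex adds exactly three. *)
have key (m : nat) (Y : {set 'I_n}) : #|Y| = m ->
    rk p (within Y) = (if (m <= 2)%N then m.-1 else 3 * m - 6)%N.
  elim: m Y => [|m IH] Y Ym.
    rewrite (cards0_eq Ym) (_ : within set0 = set0) ?rk_set0 //.
    by apply/setP=> e; rewrite !inE.
  have [v vY] : exists v, v \in Y by apply/card_gt0P; rewrite Ym.
  have := Ym; rewrite (cardsD1 v) vY add1n => -[Ym'].
  rewrite -(setD1K vY) rk_within_add ?(setD11, g) // Ym' (IH _ Ym').
  by case: m {IH Ym Ym'} => [|[|[|m]]]; rewrite /minn /=; lia.
rewrite (key _ _ erefl); move: #|X| X3 => c c3; case: ifP; lia.
Qed.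

(* Special position: [v] on the line through the nonadjacent pair [i], [j]. *)
Lemma one_ext p F v i j k l q0 : good p -> avoids F v -> uniq [:: v; i; j; k; l] ->
  motion p F q0 -> stretch p i j q0 != 0 ->
  rk p (F :|: star v [:: i; j; k; l]) = (rk p F + 4)%N.
Proof.
move=> gp av u m0 s0; have g := good_genpos gp.
have [e he] : exists e, joins e i j by apply: joins_ex; ucut u.
(* The bracket with [k] and [l] is affine in the parameter and nonzero at 0, so it cannot vanish at
   both [1/2] and [2]. *)
have [t [t0 t1 tb]] : exists t : R, [/\ t != 0, t != 1 & br (mid (p i) (p j) t) (p k) (p l) != 0].
  have h2 : 2^-1 != 0 :> R by rewrite invr_eq0 pnatr_eq0.
  have h2' : 2^-1 != 1 :> R by apply/eqP => h; lra.
  case: (eqVneq (br (mid (p i) (p j) 2^-1) (p k) (p l)) 0) => [E|]; last by exists 2^-1.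
  exists 2; split; rewrite ?pnatr_eq0 //; first by apply/eqP => h; lra.
  have : B p i k l != 0 by apply: g; ucut u; uniqs.
  apply: contraNneq => E'; move: E E'; rewrite !br_mid -!/(B p _ _ _) => E E'; lra.
pose p' := moved p v (mid (p i) (p j) t).
apply/eqP; rewrite eqn_leq; apply/andP; split.
  by apply: leq_trans (rkU _ _ _) _; rewrite card_star //; ucut u; uniqs.
have iv : i != v by ucut u; rewrite eq_sym.
have jv : j != v by ucut u; rewrite eq_sym.
have kv : k != v by ucut u; rewrite eq_sym.
have lv : l != v by ucut u; rewrite eq_sym.
have av' : avoids (e |: F) v.
  move=> e'; rewrite !inE => /orP[/eqP->|/av//]; by rewrite (inc_joins _ he) negb_or ![v == _]eq_sym iv jv.
apply: leq_trans (gp (F :|: star v [:: i; j; k; l]) p').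
(* On the line, the star has [e] in its closure. So [e], which is independent of [F], and three star
   edges already account for rank four. *)
have <- : rk p' ((e |: F) :|: star v [:: i; k; l]) = (rk p F + 4)%N.
  rewrite star3 //.
  - rewrite rk_moved // rk_nclos ?addSnnS //; apply/negP=> /closP/(_ _ m0)/eqP.
    by rewrite (stretch_joins _ _ he) (negbTE s0).
  - by ucut u; uniqs.
  - rewrite /B /p' moved_eq !moved_neq // br_mid.
    rewrite (_ : br (p i) (p i) (p k) = 0) ?subr0 ?add0r ?mulf_neq0 //; last by rewrite /br; ring.
    by apply: g; ucut u; uniqs.
  - rewrite /B /p' moved_eq !moved_neq // br_mid.
    rewrite (_ : br (p i) (p i) (p l) = 0) ?subr0 ?add0r ?mulf_neq0 //; last by rewrite /br; ring.
    by apply: g; ucut u; uniqs.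
  - by rewrite /B /p' moved_eq !moved_neq.
apply: rk_clos_le => e'; rewrite !inE => /orP[/orP[/eqP->|h]|h]; last 2 first.
- by apply: clos_in; rewrite inE h.
- apply: clos_in; rewrite !inE /= in h *.
  by case/or3P: h => [h|h|]; rewrite ?orbF ?h ?orbT // => ->; rewrite !orbT.
apply/closP=> q /motionU[mF ms]; apply/eqP; rewrite (stretch_joins _ _ he); apply/eqP.
have sv x : x \in [:: i; j; k; l] -> stretch p' v x q = 0.
  move=> xs; have /joins_ex[e'' h''] : v != x.
    by apply: contraTneq xs => <-; ucut u; uniqs.
  have /ms/eqP : e'' \in star v [:: i; j; k; l] by apply: joins_star h''.
  by rewrite (stretch_joins _ _ h'') => /eqP.
apply: (@collinear_stretch _ _ p' v i j t) => //; last 2 first.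
- by apply: sv; rewrite inE eqxx.
- by apply: sv; rewrite !inE eqxx orbT.
by rewrite /p' moved_eq !moved_neq.
Qed.

End Flats.

(** * Consequences of a star of rank four on five neighbours *)

Section LineRel.
Variables (R : realFieldType) (n : nat).
Implicit Types (e : edge n) (F G H A : {set edge n}) (i j k l m v a b c y : 'I_n)
  (p : 'I_n -> R * R) (q : 'M[R]_(n, 3)) (s : seq 'I_n) (U X Y : {set 'I_n}).

Lemma motion_star p v s x q : v \notin s -> motion p (star v s) q -> x \in s -> stretch p v x q = 0.
Proof.
move=> vs ms xs; have /joins_ex[e h] : v != x by apply: contraNneq vs => ->.
by have /ms/eqP := joins_star xs h; rewrite (stretch_joins _ _ h) => /eqP.
Qed.

Lemma line_clos p F v i j e t s : v \notin s -> joins e i j -> i \in s -> j \in s ->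
  p v = mid (p i) (p j) t -> t != 0 -> t != 1 -> clos p (F :|: star v s) e.
Proof.
move=> vs he si sj E t0 t1; apply/closP=> q /motionU[mF ms]; apply/eqP.
rewrite (stretch_joins _ _ he); apply/eqP; apply: (@collinear_stretch _ _ p v i j t q E) => //.
  exact: motion_star ms si.
exact: motion_star ms sj.
Qed.

Lemma term_sym p q i j k l m : term p q j i k l m = term p q i j k l m.
Proof.
rewrite /term stretchC (B12 p i j k) (B12 p i j l) (B12 p i j m).
by rewrite mulrNN mulrN invrN mulrNN.
Qed.

Lemma term0 p q i j k l m : stretch p i j q = 0 -> term p q i j k l m = 0.
Proof. by rewrite /term => ->; rewrite mul0r. Qed.

Lemma term_eq0 p q i j k l m : genpos p -> uniq [:: i; j; k; l; m] ->
  (term p q i j k l m == 0) = (stretch p i j q == 0).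
Proof.
move=> g u; rewrite /term mulf_eq0 invr_eq0 !mulf_eq0.
have [/negbTE-> /negbTE-> /negbTE->] : [/\ B p i j k != 0, B p i j l != 0 & B p i j m != 0].
  by ucut u; split; apply: g; uniqs.
by rewrite !orbF.
Qed.

(** With [v] on the line [i j], the other four star edges become dependent over [e |: F], and
    [star4_rel] gives a relation among the edges on [i], [k], [l], [m]. Cleared of denominators it
    is polynomial along the line. Its value at parameter 0 is the relation at [i]; what remains is a
    combination of products of two lines, and [three_lines] kills its three coefficients, the
    stretches on [k], [l], [m]. *)
Lemma line_rel p F v i j k l m q0 : good p -> avoids F v -> uniq [:: v; i; j; k; l; m] ->
  motion p F q0 -> stretch p i j q0 != 0 ->
  (rk p (F :|: star v [:: i; j; k; l; m]) <= rk p F + 4)%N ->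
  forall q, motion p F q -> stretch p i j q = 0 ->
  [/\ stretch p k l q = 0, stretch p k m q = 0, stretch p l m q = 0 &
    term p q i k j l m + term p q i l j k m + term p q i m j k l = 0].
Proof.
move=> gp av u m0 s0 dep q mq sq; have g := good_genpos gp.
have [e he] : exists e, joins e i j by apply: joins_ex; ucut u.
have uj : uniq [:: i; j; k; l; m] by move: u => /= /andP[].
have vN : v \notin [:: i; j; k; l; m] by move: u => /= /andP[].
have nv x : x \in [:: i; j; k; l; m] -> x != v by move=> xN; apply: contraNneq vN => <-.
have nvs : [/\ i != v, j != v, k != v, l != v & m != v].
  by split; apply: nv; rewrite !inE eqxx ?orbT.
case: nvs => iv jv kv lv mv.
have av' : avoids (e |: F) v.
  move=> e'; rewrite !inE => /orP[/eqP->|/av//].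
  by rewrite (inc_joins _ he) negb_or ![v == _]eq_sym iv jv.
have re : rk p (e |: F) = (rk p F).+1.
  apply: rk_nclos; apply/negP=> /closP/(_ _ m0)/eqP.
  by rewrite (stretch_joins _ _ he) (negbTE s0).
have mq' : motion p (e |: F) q.
  by apply/motionU; split=> // e'; rewrite inE => /eqP->; apply/eqP; rewrite (stretch_joins _ _ he) sq.
pose L x y t := B p i x y + t * (B p j x y - B p i x y).
have LE x y t : L x y t = br (mid (p i) (p j) t) (p x) (p y) by rewrite br_mid.
pose K x y w := stretch p x y q / (B p x y i * B p x y w).
pose C := term p q i k j l m + term p q i l j k m + term p q i m j k l.
pose f t := C * (L k l t * L k m t * L l m t)
  + t * (K k l m * (L k m t * L l m t) + K k m l * (L k l t * L l m t) + K l m k * (L k l t * L k m t)).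
have f0 t : t != 0 -> t != 1 -> L k l t != 0 -> L k m t != 0 -> L l m t != 0 -> f t = 0.
  move=> t0 t1 l1 l2 l3.
  pose p' := moved p v (mid (p i) (p j) t).
  have st x y : x != v -> y != v -> stretch p' x y q = stretch p x y q by move=> *; apply: stretch_moved.
  have Bx x y z : x != v -> y != v -> z != v -> B p' x y z = B p x y z.
    by move=> *; rewrite /B /p' !moved_neq.
  have Bv x y : x != v -> y != v -> B p' v x y = L x y t.
    by move=> *; rewrite LE /B /p' moved_eq !moved_neq.
  have Lix x : L i x t = t * B p j i x.
    by rewrite /L (_ : B p i i x = 0) ?subr0 ?add0r //; rewrite /B /br; ring.
  (* The edge [e] uses up one of the at most four dimensions that the star adds to [F], leaving at
     most three over [e |: F]. *)
  have dep' : (rk p' ((e |: F) :|: star v [:: i; k; l; m]) < rk p' (e |: F) + 4)%N.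
    have -> : rk p' (e |: F) = (rk p F).+1 by rewrite rk_moved.
    rewrite addSn ltnS; apply: leq_trans dep; apply: leq_trans (gp _ p').
    apply: rk_clos_le => e'; rewrite !in_setU in_set1 => /orP[/orP[/eqP->|h]|h].
    - by apply: (line_clos (t := t) F vN he); rewrite ?inE ?eqxx ?orbT //; rewrite /p' moved_eq !moved_neq.
    - by apply: clos_in; rewrite inE h.
    apply: clos_in; rewrite inE; apply/orP; right; move: h; apply/subsetP; apply: starS.
    by move=> x; rewrite !inE => /or4P[] ->; rewrite ?orbT.
  have rot x y z : B p' x y z = B p' z x y by rewrite /B /br; ring.
  have tg x : uniq [:: j; i; x] -> t * B p j i x != 0 by move=> ux; rewrite mulf_neq0 // g.
  have X := @star4_rel _ _ p' (e |: F) v i k l m q av'.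
  have {}X := X ltac:(ucut u; uniqs).
  have {}X := X ltac:(by rewrite Bv // Lix; apply: tg; ucut uj; uniqs).
  have {}X := X ltac:(by rewrite Bv // Lix; apply: tg; ucut uj; uniqs).
  have {}X := X ltac:(by rewrite Bv // Lix; apply: tg; ucut uj; uniqs).
  have {}X := X ltac:(by rewrite Bv).
  have {}X := X ltac:(by rewrite Bv).
  have {}X := X ltac:(by rewrite Bv).
  do 4! (have {}X := X ltac:(by rewrite Bx //; apply: g; ucut uj; uniqs)).
  have {}X := X dep' ltac:(by apply/motion_moved).
  (* The bracket of [i], [x] and the moved [v] is [t] times a fixed one: edges at [i] acquire the
     factor [1 / t], the others [1 / L x y t]. *)
  have T1 x y z : x != v -> y != v -> z != v -> term p' q i x v y z = term p q i x j y z / t.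
    move=> xv yv zv; rewrite /term st // rot Bv // !Bx // Lix (_ : B p i x j = B p j i x).
      by rewrite -!mulrA -!invfM; congr (_ * _^-1); ring.
    by rewrite /B /br; ring.
  have T2 x y w : x != v -> y != v -> w != v -> term p' q x y v i w = K x y w / L x y t.
    move=> xv yv wv; rewrite /term st // rot Bv // !Bx // /K.
    by rewrite -!mulrA -!invfM; congr (_ * _^-1); ring.
  rewrite !T1 // !T2 // in X.
  rewrite /f /C -[RHS](mulr0 (t * (L k l t * L k m t * L l m t))) -X.
  by field; rewrite t0 l1 l2 l3.
have pL x y : polyfun (L x y) by rewrite /L; polyfun_tac.
have pf : polyfun f.
  rewrite /f; do !(first [exact: pL | exact: polyfun_id | exact: polyfun_const | apply: polyfunD | apply: polyfunM]).
have pLP x y : exists2 P : {poly R}, (forall t, P.[t] = L x y t) & P.[0] = B p i x y.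
  by have [P hP] := pL x y; exists P; rewrite ?hP // /L mul0r addr0.
have [P1 hP1 z1] := pLP k l; have [P2 hP2 z2] := pLP k m; have [P3 hP3 z3] := pLP l m.
have nz (P : {poly R}) : P.[0] != 0 -> P != 0 by apply: contraNneq => ->; rewrite horner0.
have gnz : 'X * ('X - 1%:P) * (P1 * P2 * P3) != 0.
  rewrite !mulf_neq0 ?polyX_eq0 ?polyXsubC_eq0 //; apply: nz; rewrite ?z1 ?z2 ?z3; apply: g; ucut uj; uniqs.
have fz : forall t, f t = 0.
  apply: (polyfun_cofinite pf gnz) => t; rewrite !(hornerM, hornerXsubC, hornerX) hP1 hP2 hP3.
  rewrite !mulf_eq0 !negb_or subr_eq0.
  by move=> /andP[/andP[t0 t1] /andP[/andP[l1 l2] l3]]; apply: f0.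
have C0 : C = 0.
  have := fz 0; rewrite /f /L !mul0r !addr0 => /eqP; rewrite mulf_eq0 => /orP[/eqP//|].
  rewrite !mulf_eq0 => /orP[/orP[]|] /eqP h; exfalso.
  - by have : B p i k l != 0 by [apply: g; ucut uj; uniqs]; rewrite h eqxx.
  - by have : B p i k m != 0 by [apply: g; ucut uj; uniqs]; rewrite h eqxx.
  - by have : B p i l m != 0 by [apply: g; ucut uj; uniqs]; rewrite h eqxx.
pose h t := K k l m * (L k m t * L l m t) + K k m l * (L k l t * L l m t)
    + K l m k * (L k l t * L k m t).
have hz : forall t, h t = 0.
  apply: (@polyfun_cofinite _ h 'X); rewrite ?polyX_eq0 //.
    by rewrite /h; do !(first [exact: pL | exact: polyfun_const | apply: polyfunD | apply: polyfunM]).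
  move=> t; rewrite hornerX => t0; have := fz t; rewrite /f C0 mul0r add0r => /eqP.
  by rewrite mulf_eq0 (negbTE t0) => /eqP.
(* The lines [x y] and [x z] meet the line [i j] in different points, by the Plücker relation and
   general position. *)
have pl x y z : uniq [:: i; j; x] -> uniq [:: x; y; z] ->
   B p i x z * (B p j x y - B p i x y) - (B p j x z - B p i x z) * B p i x y != 0.
  move=> ux uu; rewrite (_ : _ - _ = - (B p i j x * B p x y z)).
    by rewrite oppr_eq0 mulf_neq0 // g.
  by rewrite /B -plucker; ring.
have pl' x y z : uniq [:: i; j; z] -> uniq [:: x; y; z] ->
   B p i y z * (B p j x z - B p i x z) - (B p j y z - B p i y z) * B p i x z != 0.
  move=> ux uu; have := @pl z x y ux ltac:(ucut uu; uniqs).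
  by rewrite !(B23 p _ x z) !(B23 p _ y z); congr (_ != 0); ring.
have [k1 k2 k3] : [/\ K k l m = 0, K k m l = 0 & K l m k = 0].
  apply: (three_lines hz).
  - by apply: pl; ucut uj; uniqs.
  - rewrite (_ : _ - _ = B p i j l * B p l k m); last by rewrite /B /br; ring.
    by apply: mulf_neq0; apply: g; ucut uj; uniqs.
  - by apply: pl'; ucut uj; uniqs.
have K0 x y w : uniq [:: i; x; y] -> uniq [:: x; y; w] -> K x y w = 0 -> stretch p x y q = 0.
  move=> u1 u2 /eqP; rewrite /K mulf_eq0 invr_eq0 mulf_eq0 => /or3P[/eqP//|h1|h1].
    by have := g x y i ltac:(ucut u1; uniqs); rewrite h1.
  by have := g x y w ltac:(ucut u2; uniqs); rewrite h1.
split=> //; [apply: K0 k1|apply: K0 k2|apply: K0 k3]; ucut uj; uniqs.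
Qed.

End LineRel.

(** * Combinatorics of five neighbours; [z q a b] stands for an edge left unstretched by [q] *)

Section Classification.
Variables (V : eqType) (N : seq V) (ad : rel V) (M : Type) (z : M -> V -> V -> bool).

Definition five a b c d e := uniq [:: a; b; c; d; e] && all (mem N) [:: a; b; c; d; e].

(** In the application [par] and [rel3] are the two halves of [line_rel], [nontriv] is
    [star_nontriv], and [K4e] holds because such a quadruple together with the vertex would be
    completed to a five-clique by flatness. *)
Hypothesis adC : forall a b, ad a b = ad b a.
Hypothesis zC : forall q a b, z q a b = z q b a.
Hypothesis ad_z : forall q a b, ad a b -> z q a b.
Hypothesis par : forall a b c d e, five a b c d e -> ~~ ad a b -> forall q, z q a b -> z q c d.
Hypothesis rel3 : forall a b c d e, five a b c d e -> ~~ ad a b ->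
  forall q, z q a b -> z q a c -> z q a d -> z q a e.
Hypothesis nontriv : forall a b c d e, five a b c d e -> ~~ ad a b ->
  exists2 q, z q a b & ~~ [&& z q a c, z q a d, z q a e, z q b c, z q b d & z q b e].
Hypothesis K4e : forall a b c d e, five a b c d e ->
  ad a b -> ad a c -> ad a d -> ad b c -> ad b d -> False.

Lemma fiveP a b c d e : five a b c d e ->
  [/\ uniq [:: a; b; c; d; e], a \in N, b \in N, c \in N & d \in N /\ e \in N].
Proof. by case/andP=> -> /= /and5P[-> -> -> -> /andP[-> _]]. Qed.

Ltac f5 := rewrite /five; apply/andP; split; [uniqs | by rewrite /=; repeat (apply/andP; split)].

Ltac prep H := let u := fresh "u" in case/fiveP: (H) => u ? ? ? [? ?]; ucut u.

Definition special_at := exists a b d e c, five a b d e c /\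
  [/\ ad a c, ad b c, ad d c & ad e c] /\ ~~ ad a b /\ ~~ ad d e.

(** A motion leaving [a c] unstretched would propagate through [par] to every pair meeting [a] or
    [c], against [nontriv]. *)
Lemma no_triple_a a b c d e q : five a b c d e -> ~~ ad a b -> z q a b ->
  ~~ z q a c -> ~~ z q a d -> ~~ z q a e -> ~~ ad b c -> ~~ ad b d -> False.
Proof.
move=> H nab zab zac zad zae nbc nbd; prep H.
have nac : ~~ ad a c by apply: contra zac; apply: ad_z.
have nae : ~~ ad a e by apply: contra zae; apply: ad_z.
have [|q' z1] := @nontriv a c b d e _ nac; first by f5.
have z2 : z q' b d by apply: (@par a c b d e) => //; f5.
have z3 : z q' b e by apply: (@par a c b e d) => //; f5.
have z4 : z q' d e by apply: (@par a c d e b) => //; f5.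
have z5 : z q' a e by apply: (@par b d a e c) => //; f5.
have z6 : z q' c e by rewrite zC; apply: (@par b d e c a) => //; f5.
have z7 : z q' b c by apply: (@par a e b c d) => //; f5.
have z8 : z q' c d by apply: (@par a e c d b) => //; f5.
have z9 : z q' a d by apply: (@par b c a d e) => //; f5.
have z10 : z q' a b by apply: (@rel3 a c d e b) => //; f5.
by rewrite z10 z9 z5 (zC q' c b) z7 z8 z6.
Qed.

(** The vertices [c], [d], [e] must form a triangle, for otherwise [par] would unstretch a pair at
    [a]. If [b] is adjacent to two of them, [K4e] applies; if not, [no_triple_a] does. *)
Lemma no_triple_b a b c d e q : five a b c d e -> ~~ ad a b -> z q a b ->
  ~~ z q a c -> ~~ z q a d -> ~~ z q a e -> False.
Proof.
move=> H nab zab zac zad zae; prep H.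
have zcd : z q c d by apply: (@par a b c d e) => //; f5.
have zce : z q c e by apply: (@par a b c e d) => //; f5.
have zde : z q d e by apply: (@par a b d e c) => //; f5.
have acd : ad c d.
  by apply: contraT => h; case/negP: zae; apply: (@par c d a e b) => //; f5.
have ace : ad c e.
  by apply: contraT => h; case/negP: zad; apply: (@par c e a d b) => //; f5.
have ade : ad d e.
  by apply: contraT => h; case/negP: zac; apply: (@par d e a c b) => //; f5.
case: (boolP (ad b c)) => [bc|nbc].
  case: (boolP (ad b d)) => [bd|nbd].
    by apply: (@K4e c d e b a) => //; rewrite 1?adC //; f5.
  case: (boolP (ad b e)) => [be|nbe].
    by apply: (@K4e c e d b a) => //; rewrite 1?adC //; f5.
  by apply: (@no_triple_a a b d e c q) => //; f5.
case: (boolP (ad b d)) => [bd|nbd]; last by apply: (@no_triple_a a b c d e q) => //; f5.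
case: (boolP (ad b e)) => [be|nbe]; last by apply: (@no_triple_a a b c e d q) => //; f5.
by apply: (@K4e d e c b a) => //; rewrite 1?adC //; f5.
Qed.

(** By [no_triple_b] the pair [a e] is unstretched, and [e] turns out to be adjacent to all the
    others. The two nonadjacent pairs are [a b] and [c d], or [a c] and [b d] if [c d] is an
    edge. *)
Lemma core_c a b c d e q : five a b c d e -> ~~ ad a b -> z q a b ->
  ~~ z q a c -> ~~ z q a d -> special_at.
Proof.
move=> H nab zab zac zad; prep H.
case: (boolP (z q a e)) => zae; last by case: (no_triple_b H nab zab zac zad zae).
have nac : ~~ ad a c by apply: contra zac; apply: ad_z.
have nad : ~~ ad a d by apply: contra zad; apply: ad_z.
have zcd : z q c d by apply: (@par a b c d e) => //; f5.
have zce : z q c e by apply: (@par a b c e d) => //; f5.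
have zde : z q d e by apply: (@par a b d e c) => //; f5.
have ace : ad c e.
  by apply: contraT => h; case/negP: zad; apply: (@par c e a d b) => //; f5.
have ade : ad d e.
  by apply: contraT => h; case/negP: zac; apply: (@par d e a c b) => //; f5.
have aae : ad a e.
  apply: contraT => nae; exfalso.
  have zbc : z q b c by apply: (@par a e b c d) => //; f5.
  have zbd : z q b d by apply: (@par a e b d c) => //; f5.
  have bc : ad b c.
    by apply: contraT => h; case/negP: zad; apply: (@par b c a d e) => //; f5.
  have bd : ad b d.
    by apply: contraT => h; case/negP: zac; apply: (@par b d a c e) => //; f5.
  case: (boolP (ad b e)) => be.
    by apply: (@K4e b e c d a) => //; rewrite 1?adC //; f5.
  case: (boolP (ad c d)) => cd.
    by apply: (@K4e c d b e a) => //; rewrite 1?adC //; f5.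
  have zbe : z q b e by apply: (@par c d b e a) => //; f5.
  by case/negP: zac; apply: (@par b e a c d) => //; f5.
have abe : ad b e.
  apply: contraT => nbe; exfalso.
  have zbe : ~~ z q b e.
    by apply: contra zac => h; apply: (@par b e a c d) => //; f5.
  have cd : ad c d.
    by apply: contraT => h; case/negP: zbe; apply: (@par c d b e a) => //; f5.
  have [|q' z1] := @nontriv a c b d e _ nac; first by f5.
  have z2 : z q' b d by apply: (@par a c b d e) => //; f5.
  have z3 : z q' b e by apply: (@par a c b e d) => //; f5.
  have z4 : z q' a d by apply: (@par b e a d c) => //; f5.
  have z5 : z q' c d by apply: ad_z.
  have z6 : z q' c e by apply: ad_z.
  have z7 : z q' a e by apply: ad_z.
  have z8 : z q' b c by apply: (@par a d b c e) => //; f5.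
  have z9 : z q' a b by apply: (@rel3 a c d e b) => //; f5.
  by rewrite z9 z4 z7 (zC q' c b) z8 z5 z6.
case: (boolP (ad c d)) => cd; last by exists a, b, c, d, e; split; [f5 | split].
have nbc : ~~ ad b c.
  by apply/negP=> bc; apply: (@K4e c e b d a) => //; rewrite 1?adC //; f5.
have nbd : ~~ ad b d.
  by apply/negP=> bd; apply: (@K4e d e b c a) => //; rewrite 1?adC //; f5.
by exists a, c, b, d, e; split; [f5 | split].
Qed.

(** A nonadjacent pair exists by [K4e]. By [rel3] a vertex cannot have exactly one stretched pair to
    the remaining three, so one end of the pair has at least two, as [core_c] requires. *)
Lemma classify a b c d e : five a b c d e -> special_at.
Proof.
move=> H; prep H.
suff key a' b' c' d' e' : five a' b' c' d' e' -> ~~ ad a' b' -> special_at.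
  case: (boolP (ad a b)) => [ab|]; last exact: key H.
  case: (boolP (ad a c)) => [ac|]; last by apply: (@key a c b d e); f5.
  case: (boolP (ad a d)) => [ad'|]; last by apply: (@key a d b c e); f5.
  case: (boolP (ad b c)) => [bc|]; last by apply: (@key b c a d e); f5.
  case: (boolP (ad b d)) => [bd|]; last by apply: (@key b d a c e); f5.
  by case: (K4e H ab ac ad' bc bd).
move=> H' nab; have [q zab nz] := nontriv H' nab; prep H'.
suff one x y s v w : five x y s v w -> ~~ ad x y -> z q x y ->
    ~~ [&& z q x s, z q x v & z q x w] -> special_at.
  case: (boolP [&& z q a' c', z q a' d' & z q a' e']) => [/and3P[h1 h2 h3]|h]; last exact: one H' nab zab h.
  apply: (@one b' a' c' d' e'); [by f5 | by rewrite adC | by rewrite zC |].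
  by move: nz; rewrite h1 h2 h3.
move=> G nxy zxy h; prep G.
have r1 := rel3 G nxy zxy.
have r2 : z q x s -> z q x w -> z q x v by apply: (@rel3 x y s w v) => //; f5.
have r3 : z q x v -> z q x w -> z q x s by apply: (@rel3 x y v w s) => //; f5.
move: h r1 r2 r3; case hu: (z q x s); case hv: (z q x v); case hw: (z q x w) => //= _ r1 r2 r3.
- by have := r1 isT isT.
- by have := r2 isT isT.
- by apply: (@core_c x y v w s q); rewrite ?hv ?hw //; f5.
- by have := r3 isT isT.
- by apply: (@core_c x y s w v q); rewrite ?hu ?hw //; f5.
- by apply: (@core_c x y s v w q); rewrite ?hu ?hv //; f5.
- by apply: (@core_c x y s v w q); rewrite ?hu ?hv //; f5.
Qed.

End Classification.

(** * Dependent stars of five edges in a flat *)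

Section FiveStar.
Variables (R : realFieldType) (n : nat).
Implicit Types (e : edge n) (F G H A : {set edge n}) (i j k l m v a b c d y : 'I_n)
  (p : 'I_n -> R * R) (q : 'M[R]_(n, 3)) (s : seq 'I_n) (U X Y : {set 'I_n}).

Definition ins A U := A :&: within U.

Lemma ins_sub A U : ins A U \subset A. Proof. exact: subsetIl. Qed.

Lemma ins_adj A U i j : adj (ins A U) i j = [&& adj A i j, i \in U & j \in U].
Proof.
case: (eqVneq i j) => [->|ij].
  by apply/idP/idP=> [/adj_neq|/and3P[/adj_neq]]; rewrite eqxx.
have [e he] := joins_ex ij.
by rewrite !(adjE _ he) inE (within_joins _ he).
Qed.

Lemma ins_avoids A U v : v \notin U -> avoids (ins A U) v.
Proof. exact: within_avoids. Qed.

Lemma insS A U X : U \subset X -> ins A U \subset ins A X.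
Proof.
by move=> /subsetP s; apply: setIS; apply/subsetP=> e; rewrite !inE => /andP[/s-> /s->].
Qed.

Lemma ins_witness p A U i j : flat p A -> i != j -> ~~ adj A i j ->
  exists2 q, motion p (ins A U) q & stretch p i j q != 0.
Proof.
move=> f ij na; have [q m h] := flat_witness f ij na.
by exists q => //; apply: motionS m; apply: ins_sub.
Qed.

Lemma star_sub A v s : v \notin s -> (forall x, x \in s -> adj A v x) -> star v s \subset A.
Proof.
by move=> vs h; apply/subsetP=> e /star_joins[j /h a he]; rewrite -(adjE _ he).
Qed.

(** Otherwise [i j] alone would span, with [ins A U], the complete graph on the five neighbours.
    Adding [v] with all its edges to that graph costs at most [12 - 9 = 3] more by submodularity, so
    the total increase is four. The star on [i], [j], [k], [l] already achieves four by [one_ext],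
    hence [i j] would lie in the closure of [A]. *)
Lemma star_nontriv p A U v i j k l m : good p -> flat p A -> v \notin U ->
  uniq [:: i; j; k; l; m] -> {subset [:: i; j; k; l; m] <= U} ->
  (forall x, x \in [:: i; j; k; l; m] -> adj A v x) -> ~~ adj A i j ->
  exists q, [/\ motion p (ins A U) q, stretch p i j q = 0 &
    exists x y, [/\ x \in [:: i; j; k; l; m], y \in [:: i; j; k; l; m], x != y &
      stretch p x y q != 0]].
Proof.
move=> gp f vU u sU va nij; set N := [:: i; j; k; l; m] in u sU va *.
have g := good_genpos gp.
have vN : v \notin N by apply: contra vU; apply: sU.
pose S := [set x in N].
have S5 : #|S| = 5%N by rewrite cardsE (card_uniqP u).
have ij : i != j by rewrite /N in u; ucut u.
have [e he] := joins_ex ij.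
have eS : e \in within S by rewrite (within_joins _ he) !inE !eqxx ?orbT.
have vS : v \notin S by rewrite inE.
case: (boolP [forall (e' | e' \in within S), clos p (e |: ins A U) e']); last first.
  rewrite negb_forall_in => /exists_inP[e' e'S /not_clos[q mq sq]].
  exists q; split; first by apply: motionS mq; apply: subsetUr.
    by apply/eqP; rewrite -(stretch_joins _ _ he) mq // setU11.
  move: e'S; rewrite inE => /andP[h1 h2].
  by exists (e1 e'), (e2 e'); split; rewrite ?e12_neq //; [move: h1|move: h2]; rewrite inE.
move=> /forall_inP cl; exfalso.
have r9 : rk p (within S) = 9%N by have := rk_within gp (X := S); rewrite S5; lia.
have r12 : rk p (within (v |: S)) = 12%N.
  by have := rk_within gp (X := v |: S); rewrite cardsU1 vS S5; lia.
have h1 : (rk p (ins A U :|: within S) <= rk p (ins A U) + 1)%N.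
  rewrite -(cards1 e); apply: leq_trans (rkU _ _ _); rewrite (setUC _ [set e]).
  apply: rk_clos_le => e'; rewrite in_setU => /orP[h|]; last exact: cl.
  by apply: clos_in; rewrite inE h orbT.
have h2 := rk_submod p (ins A U :|: within S) (within (v |: S)).
have h3 : (rk p (within S) <= rk p ((ins A U :|: within S) :&: within (v |: S)))%N.
  apply: rkS; rewrite subsetI subsetUr; apply/subsetP=> e'; rewrite !inE.
  by move=> /andP[-> ->]; rewrite !orbT.
have [q0 m0 s0] := ins_witness U f ij nij.
have h4 := one_ext (v := v) (k := k) (l := l) gp (ins_avoids vU) _ m0 s0.
have {}h4 := h4 ltac:(rewrite /N in u vN; ucut u; ucut vN; uniqs).
have s4 : star v [:: i; j; k; l] \subset within (v |: S).
  apply: star_within; first by rewrite setU11.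
  by move=> x; rewrite !inE => /or4P[] ->; rewrite ?orbT.
have : e \in A.
  apply: (flat_clos f); apply: (@closS _ _ p (ins A U :|: star v [:: i; j; k; l])).
    rewrite subUset ins_sub star_sub //; first by apply: contra vN; rewrite /N !inE => /or4P[] ->; rewrite ?orbT.
    by move=> x xs; apply: va; move: xs; rewrite /N !inE => /or4P[] ->; rewrite ?orbT.
  apply: (@clos_rkU _ _ p _ ((ins A U :|: within S) :|: within (v |: S))); last by rewrite !in_setU eS orbT.
  rewrite h4 (setUidPr _); first by lia.
  by rewrite subUset -setUA subsetUl /= (subset_trans s4) // setUA subsetUr.
by rewrite -(adjE A he) (negbTE nij).
Qed.

Lemma star_dep_perm p F v s t : uniq s -> uniq t -> size s = size t -> {subset t <= s} ->
  rk p (F :|: star v t) = rk p (F :|: star v s).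
Proof.
move=> us ut st ts; have [_ E] := uniq_min_size ut ts ltac:(by rewrite st).
by rewrite (eq_star v E).
Qed.

Lemma five_star p A U v i j k l m : good p -> flat p A -> v \notin U ->
  uniq [:: i; j; k; l; m] -> {subset [:: i; j; k; l; m] <= U} ->
  (forall x, x \in [:: i; j; k; l; m] -> adj A v x) ->
  (rk p (ins A U :|: star v [:: i; j; k; l; m]) <= rk p (ins A U) + 4)%N ->
  (forall a b c d, uniq [:: a; b; c; d] -> {subset [:: a; b; c; d] <= [:: i; j; k; l; m]} ->
     [&& adj A a b, adj A a c, adj A a d, adj A b c & adj A b d] -> ~~ adj A c d) ->
  special_at [:: i; j; k; l; m] (adj A).
Proof.
move=> gp f vU u sU va dep nK; set N := [:: i; j; k; l; m] in u sU va dep nK *.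
have g := good_genpos gp.
have vN : v \notin N by apply: contra vU; apply: sU.
pose M := {q | motion p (ins A U) q}.
pose z (q : M) x y := stretch p x y (sval q) == 0.
have nvx x : x \in N -> v != x by move=> xN; apply: contraNneq vN => ->.
have fN a b c d y : five N a b c d y ->
   [/\ uniq [:: a; b; c; d; y], {subset [:: a; b; c; d; y] <= N} & uniq [:: v; a; b; c; d; y]].
  case/andP=> uf /allP sf; split=> //=; move: uf => /= ->; rewrite andbT.
  by apply: contra vN => /sf.
have LR a b c d y : five N a b c d y -> ~~ adj A a b -> forall q, motion p (ins A U) q ->
   stretch p a b q = 0 -> [/\ stretch p c d q = 0, stretch p c y q = 0, stretch p d y q = 0 &
    term p q a c b d y + term p q a d b c y + term p q a y b c d = 0].
  case/fN=> uf sf uv nab; have ab : a != b by ucut uf.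
  have [q0 m0 s0] := ins_witness U f ab nab.
  apply: (line_rel gp (ins_avoids vU) uv m0 s0).
  by rewrite -(star_dep_perm p (ins A U) v (s := N) (t := [:: a; b; c; d; y])) in dep.
pose ad x y := adj (ins A U) x y.
have adN x y : x \in N -> y \in N -> ad x y = adj A x y.
  by move=> /sU xU /sU yU; rewrite /ad ins_adj xU yU !andbT.
have adF a b c d y : five N a b c d y -> ~~ ad a b -> ~~ adj A a b.
  by case/fN=> _ sf _; rewrite adN //; apply: sf; rewrite !inE eqxx ?orbT.
have adA x y : ad x y -> adj A x y by apply: adjS; apply: ins_sub.
suff [a [b [c [d [y [H [[h1 h2 h3 h4] [h5 h6]]]]]]]] : special_at N ad.
  exists a, b, c, d, y; split=> //; split; first by split; apply: adA.
  case/fN: H => _ sf _.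
  have [[aN bN] [cN dN]] : (a \in N /\ b \in N) /\ (c \in N /\ d \in N).
    by do !split; apply: sf; rewrite !inE eqxx ?orbT.
  by rewrite -(adN a b) // -(adN c d).
apply: (@classify _ N ad M z _ _ _ _ _ _ _ i j k l m).
- by move=> a b; rewrite /ad adjC.
- by move=> q a b; rewrite /z stretchC oppr_eq0.
- by move=> [q mq] a b ab; apply/eqP; apply: motion_adj mq ab.
- move=> a b c d y H /(adF _ _ _ _ _ H) nab [q mq]; rewrite /z /= => /eqP s0.
  by have [-> _ _ _] := LR _ _ _ _ _ H nab q mq s0.
- move=> a b c d y H /(adF _ _ _ _ _ H) nab [q mq]; rewrite /z /= => /eqP s0 /eqP s1 /eqP s2.
  have [_ _ _] := LR _ _ _ _ _ H nab q mq s0; rewrite !(term0 _ _ _ s1) !(term0 _ _ _ s2) !add0r => /eqP.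
  by rewrite term_eq0 //; have [uf _ _] := fN _ _ _ _ _ H; ucut uf; uniqs.
- move=> a b c d y H /(adF _ _ _ _ _ H) nab; have [uf sf uv] := fN _ _ _ _ _ H.
  have [||q [mq s0 [x [w [xs ws xw sxw]]]]] := star_nontriv (U := U) gp f vU uf _ _ nab.
  + by move=> t /sf/sU.
  + by move=> t /sf/va.
  exists (exist _ q mq); first by rewrite /z /= s0.
  have [z1 z2 z3 _] := LR _ _ _ _ _ H nab q mq s0.
  apply: contra sxw; rewrite /z /= => /and5P[/eqP h1 /eqP h2 /eqP h3 /eqP h4 /andP[/eqP h5 /eqP h6]].
  have C a1 b1 : stretch p a1 b1 q = 0 -> stretch p b1 a1 q = 0 by move=> h; rewrite stretchC h oppr0.
  move: xs ws xw; rewrite !inE => /or4P[||| /orP[]] /eqP-> /or4P[||| /orP[]] /eqP->; rewrite ?eqxx // => _;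
    apply/eqP; solve [done | by apply: C].
- move=> a b c d y H /adA ab /adA ac /adA ad' /adA bc /adA bd; have [uf sf uv] := fN _ _ _ _ _ H.
  have [[av bv] [cv dv]] : (adj A v a /\ adj A v b) /\ (adj A v c /\ adj A v d).
    by do !split; apply: va; apply: sf; rewrite !inE eqxx ?orbT.
  have cd : adj A c d.
    apply: (@flat_K5 _ _ p A v a b c d) => //; by ucut uv; uniqs.
  have : ~~ adj A c d.
    apply: (nK a b c d); first by ucut uf; uniqs.
      by move=> t tS; apply: sf; move: tS; rewrite !inE => /or4P[] ->; rewrite ?orbT.
    by rewrite ab ac ad' bc bd.
  by rewrite cd.
by rewrite /five u; apply/allP.
Qed.

End FiveStar.

(** * Balanced stretches on a quadruple of neighbours *)

Section Special.
Variables (R : realFieldType) (n : nat).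
Implicit Types (e : edge n) (F G H A : {set edge n}) (i j k l m v a b c d y : 'I_n)
  (p : 'I_n -> R * R) (q : 'M[R]_(n, 3)) (s : seq 'I_n) (U X Y : {set 'I_n}).

Lemma term_perm1 p q i j k l m : term p q i j l k m = term p q i j k l m.
Proof. by rewrite /term (mulrC (B p i j l)). Qed.
Lemma termD p q q' t i j k l m :
  term p (q + t *: q') i j k l m = term p q i j k l m + t * term p q' i j k l m.
Proof. by rewrite /term stretchD stretchZ mulrDl mulrA. Qed.

(** [line_rel] yields one relation at each of [i], [j], [k], [l]. With [i j], [k l] and the edges at
    [c] unstretched, each compares two consecutive edges of the remaining 4-cycle. *)
Lemma special_line p F v i j k l c q0 q1 : good p -> avoids F v -> uniq [:: v; i; j; k; l; c] ->
  motion p F q0 -> stretch p i j q0 != 0 -> motion p F q1 -> stretch p k l q1 != 0 ->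
  (rk p (F :|: star v [:: i; j; k; l; c]) <= rk p F + 4)%N ->
  forall q, motion p F q -> stretch p i c q = 0 -> stretch p j c q = 0 ->
  stretch p k c q = 0 -> stretch p l c q = 0 -> stretch p i j q = 0 ->
  [/\ term p q k l i j c = 0, term p q i l j k c = - term p q i k j l c,
   term p q j k i l c = - term p q i k j l c & term p q j l i k c = term p q i k j l c].
Proof.
move=> gp av u m0 s0 m1 s1 dep q mq ic jc kc lc sij.
have perm s : uniq s -> size s = 5%N -> {subset s <= [:: i; j; k; l; c]} ->
   (rk p (F :|: star v s) <= rk p F + 4)%N.
  move=> us s5 ss; rewrite (@star_dep_perm _ _ p F v [:: i; j; k; l; c] s) //.
  by move: u => /= /andP[].
have s0' : stretch p j i q0 != 0 by rewrite stretchC oppr_eq0.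
have s1' : stretch p l k q1 != 0 by rewrite stretchC oppr_eq0.
have [skl _ _] := line_rel gp av u m0 s0 dep mq sij.
rewrite (term0 _ _ _ ic) addr0 => E1.
have sji : stretch p j i q = 0 by rewrite stretchC sij oppr0.
have slk : stretch p l k q = 0 by rewrite stretchC skl oppr0.
have LR a b x y qq : uniq [:: v; a; b; x; y; c] -> {subset [:: a; b; x; y; c] <= [:: i; j; k; l; c]} ->
   motion p F qq -> stretch p a b qq != 0 -> stretch p a b q = 0 -> stretch p a c q = 0 ->
   term p q a x b y c + term p q a y b x c = 0.
  move=> uv ss mqq sqq sab sac.
  have [_ _ _] := line_rel gp av uv mqq sqq (perm [:: a; b; x; y; c] ltac:(by move: uv => /= /andP[]) erefl ss) mq sab.
  by rewrite (term0 _ _ _ sac) addr0.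
have E2 : term p q j k i l c + term p q j l i k c = 0.
  apply: (LR _ _ _ _ q0) => //; first by ucut u; uniqs.
  by move=> x; rewrite !inE => /or4P[||| /orP[]] ->; rewrite ?orbT.
have E3 : term p q k i l j c + term p q k j l i c = 0.
  apply: (LR _ _ _ _ q1) => //; first by ucut u; uniqs.
  by move=> x; rewrite !inE => /or4P[||| /orP[]] ->; rewrite ?orbT.
have E4 : term p q l i k j c + term p q l j k i c = 0.
  apply: (LR _ _ _ _ q1) => //; first by ucut u; uniqs.
  by move=> x; rewrite !inE => /or4P[||| /orP[]] ->; rewrite ?orbT.
rewrite (term_sym p q i k) (term_sym p q j k) (term_perm1 p q i k) (term_perm1 p q j k) in E3.
rewrite (term_sym p q i l) (term_sym p q j l) (term_perm1 p q i l) (term_perm1 p q j l) in E4.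
by split; [apply: term0 | lra | lra | lra].
Qed.

(** List the normalised stretches on the three perfect matchings. Motions with [i j] unstretched
    have the pattern [(0, b, -b)], those with [i k] unstretched the pattern [(b, 0, -b)], and
    [star_nontriv] makes both occur with nonzero [b]. Subtracting a multiple of [q3] reduces any
    motion to the first pattern. The nonzero entries also show that the remaining pairs are
    nonadjacent. *)
Lemma special_rel p A U v i j k l c : good p -> flat p A -> v \notin U ->
  uniq [:: i; j; k; l; c] -> {subset [:: i; j; k; l; c] <= U} ->
  (forall x, x \in [:: i; j; k; l; c] -> adj A v x) ->
  adj A i c -> adj A j c -> adj A k c -> adj A l c -> ~~ adj A i j -> ~~ adj A k l ->
  (rk p (ins A U :|: star v [:: i; j; k; l; c]) <= rk p (ins A U) + 4)%N ->
  [/\ [/\ ~~ adj A i k, ~~ adj A j l, ~~ adj A i l & ~~ adj A j k],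
    (exists q, [/\ motion p (ins A U) q, stretch p i j q = 0 & stretch p i k q != 0]) &
    forall q, motion p (ins A U) q ->
    [/\ term p q k l i j c = term p q i j k l c, term p q j l i k c = term p q i k j l c,
        term p q j k i l c = term p q i l j k c &
        term p q i j k l c + term p q i k j l c + term p q i l j k c = 0]].
Proof.
move=> gp f vU u sU va ic jc kc lc nij nkl dep.
have g := good_genpos gp.
have vN : v \notin [:: i; j; k; l; c] by apply: contra vU; apply: sU.
have uv : uniq [:: v; i; j; k; l; c] by rewrite /= vN.
have [iU jU kU lU cU] : [/\ i \in U, j \in U, k \in U, l \in U & c \in U].
  by split; apply: sU; rewrite !inE eqxx ?orbT.
have av := ins_avoids (A := A) vU.
have zc x q : x \in U -> adj A x c -> motion p (ins A U) q -> stretch p x c q = 0.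
  by move=> xU xc mq; apply: (motion_adj mq); rewrite ins_adj xc xU.
have wit x y : x != y -> ~~ adj A x y -> exists2 q, motion p (ins A U) q & stretch p x y q != 0.
  by move=> xy; apply: ins_witness.
have [q0 m0 s0] := wit i j ltac:(ucut u; uniqs) nij.
have [q1 m1 s1] := wit k l ltac:(ucut u; uniqs) nkl.
have SL := special_line gp av uv m0 s0 m1 s1 dep.
have T0 x y a b d q : uniq [:: x; y; a; b; d] -> term p q x y a b d = 0 -> stretch p x y q = 0.
  by move=> ux /eqP; rewrite term_eq0 // => /eqP.
have [q2 [m2 sij2 [x [y [xN yN xy sxy]]]]] := star_nontriv gp f vU u sU va nij.
have [h1 h2 h3 h4] := SL _ m2 (zc _ _ iU ic m2) (zc _ _ jU jc m2) (zc _ _ kU kc m2) (zc _ _ lU lc m2) sij2.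
have key q : motion p (ins A U) q -> stretch p i j q = 0 -> stretch p k l q = 0 -> stretch p i k q = 0 ->
   stretch p i l q = 0 -> stretch p j k q = 0 -> stretch p j l q = 0 ->
   forall x y, x \in [:: i; j; k; l; c] -> y \in [:: i; j; k; l; c] -> x != y -> stretch p x y q = 0.
  move=> mq e1 e2 e3 e4 e5 e6 x' y' xs ys.
  have C a1 b1 : stretch p a1 b1 q = 0 -> stretch p b1 a1 q = 0 by move=> h; rewrite stretchC h oppr0.
  have zic := zc _ _ iU ic mq; have zjc := zc _ _ jU jc mq.
  have zkc := zc _ _ kU kc mq; have zlc := zc _ _ lU lc mq.
  by move: xs ys; rewrite !inE => /or4P[||| /orP[]] /eqP-> /or4P[||| /orP[]] /eqP->; rewrite ?eqxx // => _;
    solve [done | by apply: C].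
have b13 : term p q2 i k j l c != 0.
  apply: contraNneq sxy => b0; move: h2 h3 h4; rewrite b0 oppr0 => h2 h3 h4.
  apply/eqP; apply: (key q2 m2 sij2) => //.
  - by apply: T0 h1; ucut u; uniqs.
  - by apply: T0 b0; ucut u; uniqs.
  - by apply: T0 h2; ucut u; uniqs.
  - by apply: T0 h3; ucut u; uniqs.
  - by apply: T0 h4; ucut u; uniqs.
have na a b d a' b' : a \in U -> b \in U -> term p q2 a b d a' b' != 0 -> ~~ adj A a b.
  move=> aU bU; apply: contra => ab; apply/eqP; apply: term0.
  by apply: (motion_adj m2); rewrite ins_adj ab aU.
have nik : ~~ adj A i k by apply: na b13.
have njl : ~~ adj A j l by apply: (na j l i k c) => //; rewrite h4.
have nil : ~~ adj A i l by apply: (na i l j k c) => //; rewrite h2 oppr_eq0.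
have njk : ~~ adj A j k by apply: (na j k i l c) => //; rewrite h3 oppr_eq0.
have sik2 : stretch p i k q2 != 0.
  by apply: contraNneq b13 => /term0 h; rewrite h.
have uS : uniq [:: i; k; j; l; c] by ucut u; uniqs.
have sS : {subset [:: i; k; j; l; c] <= [:: i; j; k; l; c]}.
  by move=> z; rewrite !inE => /or4P[||| /orP[]] ->; rewrite ?orbT.
have [q3 [m3 sik3 [x' [y' [xN' yN' xy' sxy']]]]] := star_nontriv gp f vU uS
   (fun z h => sU _ (sS z h)) (fun z h => va _ (sS z h)) nik.
have [q4 m4 s4] := wit j l ltac:(ucut u; uniqs) njl.
have SL' := @special_line p _ v i k j l c q2 q4 gp av ltac:(by ucut uv; uniqs) m2 sik2 m4 s4.
have {}SL' := SL' ltac:(by rewrite (@star_dep_perm _ _ p _ v [:: i; j; k; l; c] [:: i; k; j; l; c])).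
have [g1 g2 g3 g4] := SL' _ m3 (zc _ _ iU ic m3) (zc _ _ kU kc m3) (zc _ _ jU jc m3) (zc _ _ lU lc m3) sik3.
move: g2 g3 g4; rewrite (term_perm1 p q3 i l j k c) (term_sym p q3 j k i l c) => g2 g3 g4.
have b12 : term p q3 i j k l c != 0.
  apply: contraNneq sxy' => b0; move: g2 g3 g4; rewrite b0 oppr0 => g2 g3 g4.
  apply/eqP; apply: (key q3 m3) => //; last 2 first.
  - by apply: sS.
  - by apply: sS.
  - by apply: T0 b0; ucut u; uniqs.
  - by apply: T0 g4; ucut u; uniqs.
  - by apply: T0 g2; ucut u; uniqs.
  - by apply: T0 g3; ucut u; uniqs.
  - by apply: T0 g1; ucut u; uniqs.
have sij3 : stretch p i j q3 != 0.
  by apply: contraNneq b12 => /term0 h; rewrite h.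
split=> //; first by exists q2.
move=> q mq; pose t := stretch p i j q / stretch p i j q3.
pose h := q + (- t) *: q3.
have mh : motion p (ins A U) h by apply: motionD => //; apply: motionZ.
have shij : stretch p i j h = 0 by rewrite /h stretchD stretchZ /t mulNr divfK // subrr.
have [] := SL _ mh (zc _ _ iU ic mh) (zc _ _ jU jc mh) (zc _ _ kU kc mh) (zc _ _ lU lc mh) shij.
have : term p h i j k l c = 0 by apply: term0.
have E0 : term p q3 i k j l c = 0 by apply: term0.
rewrite /h !termD g1 g2 g3 g4 E0 => f1 f2 f3 f4 f5; split; lra.
Qed.

End Special.

(** * Shellability of the maximal cliques *)

Section Averaging.
Variable T : finType.
Implicit Types (U X : {set T}) (v w : T).

(* Averaging over all orders in which the points of [U] can be inserted: a set
   [S] avoiding [v] precedes [v] in a fraction [1 / (#|S| + 1)] of the orders. *)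
Lemma averaging (f : {set T} -> nat) (L : T -> seq (rat * {set T})) U :
  (forall v c, c \in L v -> v \notin c.2) ->
  (forall X v, X \subset U -> v \in X ->
     (f (X :\ v))%:R + \sum_(c <- L v | c.2 \subset X :\ v) c.1 <= (f X)%:R :> rat) ->
  \sum_(v in U) \sum_(c <- L v | c.2 \subset U) c.1 / (#|c.2|.+1)%:R <= (f U)%:R.
Proof.
move=> hL; have [m] := ubnP #|U|; elim: m U => // m IH U; rewrite ltnS => Um step.
case: (set_0Vmem U) => [->|[v0 v0U]]; first by rewrite big_set0 ler0n.
have U0 : (0 < #|U|)%N by apply/card_gt0P; exists v0.
have U0r : 0 < #|U|%:R :> rat by rewrite ltr0n.
rewrite -(ler_pM2l U0r) mulrC.
have -> : #|U|%:R * (f U)%:R = \sum_(v in U) (f U)%:R :> rat by rewrite sumr_const mulr_natl.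
pose g (c : rat * {set T}) : rat := c.1 / (#|c.2|.+1)%:R.
have IHv v : v \in U -> \sum_(w in U :\ v) \sum_(c <- L w | c.2 \subset U :\ v) g c <= (f (U :\ v))%:R.
  move=> vU; apply: IH; first by move: Um; rewrite (cardsD1 v) vU; lia.
  by move=> X w XU wX; apply: step => //; apply: subset_trans XU (subsetDl _ _).
(* The order is conditioned on its last vertex [v]: the induction hypothesis covers the earlier
   ones, the step hypothesis the insertion of [v]. *)
apply: (@le_trans _ _ (\sum_(v in U) (\sum_(w in U :\ v) \sum_(c <- L w | c.2 \subset U :\ v) g c
   + \sum_(c <- L v | c.2 \subset U :\ v) c.1))); last first.
  apply: ler_sum => v vU; apply: le_trans (step U v (subxx _) vU).
  by rewrite lerD2r IHv.
rewrite big_split /= (exchange_big_dep (mem U)) /=; last by move=> v w vU; rewrite inE => /andP[].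
rewrite mulr_suml -big_split /= le_eqVlt; apply/orP; left; apply/eqP.
apply: eq_bigr => w wU.
rewrite (exchange_big_dep (fun c : rat * {set T} => c.2 \subset U)) /=; last first.
  by move=> v c _ h; apply: subset_trans h (subsetDl _ _).
have -> : \sum_(c <- L w | c.2 \subset U :\ w) c.1 = \sum_(c <- L w | c.2 \subset U) c.1.
  rewrite big_seq_cond [RHS]big_seq_cond; apply: eq_bigl => c.
  case: (boolP (c \in L w)) => //= /hL wc; apply/idP/idP=> [h|h].
    exact: subset_trans h (subsetDl _ _).
  by rewrite subsetD1 h.
rewrite -big_split /= mulr_suml big_seq_cond [RHS]big_seq_cond; apply: eq_bigr => c /andP[cL cU].
rewrite sumr_const; have wc := hL _ _ cL.
have -> : #|[pred v | (v \in U) && (w \in U :\ v) && (c.2 \subset U :\ v)]| = (#|U| - #|c.2|.+1)%N.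
  have -> : #|c.2|.+1 = #|w |: c.2| by rewrite cardsU1 wc.
  have sU : w |: c.2 \subset U by rewrite subUset sub1set wU.
  rewrite -cardsDS //; apply: eq_card => v; rewrite !inE subsetD1 cU /= negb_or wU andbT (eq_sym w).
  by case: (v \in U); rewrite ?andbF ?andbT.
have cm : (#|c.2|.+1 <= #|U|)%N.
  have -> : #|c.2|.+1 = #|w |: c.2| by rewrite cardsU1 wc.
  by apply: subset_leq_card; rewrite subUset sub1set wU.
(* With [u = #|U|] and [s = #|c.2|] the identity is [(u - s - 1) / (s + 1) + 1 = u / (s + 1)]. *)
rewrite /g -[X in X + _]mulr_natr natrB //; have h0 : (#|c.2|.+1)%:R != 0 :> rat by rewrite pnatr_eq0.
by field; rewrite addrC natr1.
Qed.

End Averaging.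

(** * Maximal cliques, and stars contained in two of them *)

Section MaxCliques.
Variables (R : realFieldType) (n : nat).
Implicit Types (e : edge n) (F G H A : {set edge n}) (i j k l m v a b c d y : 'I_n)
  (p : 'I_n -> R * R) (q : 'M[R]_(n, 3)) (s : seq 'I_n) (U W X Y : {set 'I_n}).

Definition cliqb A X := [forall i in X, forall j in X, (i != j) ==> adj A i j].

Lemma cliqP A X : reflect (cliq A X) (cliqb A X).
Proof.
apply: (iffP forall_inP) => [h i j iX jX ij|h i iX].
  by have /forall_inP/(_ j jX)/implyP/(_ ij) := h i iX.
by apply/forall_inP=> j jX; apply/implyP; apply: h.
Qed.

Definition maxcliques A : {set {set 'I_n}} := [set X | maxset (cliqb A) X && (5 <= #|X|)%N].

Lemma maxcliquesP A X : X \in maxcliques A -> cliq A X /\ (5 <= #|X|)%N.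
Proof. by rewrite inE => /andP[/maxsetp/cliqP h ->]. Qed.

Lemma maxcliques_max A X Y : X \in maxcliques A -> cliq A Y -> X \subset Y -> Y = X.
Proof. by rewrite inE => /andP[/maxsetP[_ h] _] /cliqP; apply: h. Qed.

Lemma maxcliques_ex A Y : cliq A Y -> (5 <= #|Y|)%N -> exists2 X, X \in maxcliques A & Y \subset X.
Proof.
move=> /cliqP h Y5; have [X mX s] := maxset_exists h.
by exists X => //; rewrite inE mX (leq_trans Y5) // subset_leq_card.
Qed.

Lemma maxcliques_thin p A X Y : genpos p -> flat p A -> X \in maxcliques A -> Y \in maxcliques A ->
  X != Y -> (#|X :&: Y| <= 2)%N.
Proof.
move=> g f hX hY; apply: contra_neqT; rewrite -ltnNge => h.
have [cX _] := maxcliquesP hX; have [cY _] := maxcliquesP hY.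
have cU := cliq_merge g f cX cY h.
rewrite -(maxcliques_max hX cU) ?subsetUl // -[RHS](maxcliques_max hY cU) //; exact: subsetUr.
Qed.

Lemma maxcliques_attach p A X y a b c : genpos p -> flat p A -> X \in maxcliques A ->
  a \in X -> b \in X -> c \in X -> uniq [:: a; b; c] ->
  adj A y a -> adj A y b -> adj A y c -> y \in X.
Proof.
move=> g f hX aX bX cX u ya yb yc; apply: contraT => yX.
have [cl _] := maxcliquesP hX.
have := maxcliques_max hX (cliq_attach g f cl yX aX bX cX u ya yb yc) (subsetUr _ _).
by move=> E; rewrite -E setU11 in yX.
Qed.

Lemma star_small p F v s : good p -> avoids F v -> uniq (v :: s) -> (size s <= 3)%N ->
  rk p (F :|: star v s) = (rk p F + size s)%N.
Proof.
move=> gp av; have g := good_genpos gp.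
case: s => [|a [|b [|c []]]] //= u _.
- by rewrite addn0 (_ : star v [::] = set0) ?setU0 //; apply/setP=> e; rewrite !inE.
- by rewrite star1_indep //; ucut u; rewrite ?good_neq.
- by rewrite star2 //; apply: g; ucut u; uniqs.
- by rewrite star3 //; apply: g; ucut u; uniqs.
Qed.

Lemma cliq4 A a b c d : adj A a b -> adj A a c -> adj A a d -> adj A b c -> adj A b d ->
  adj A c d -> cliq A [set a; b; c; d].
Proof.
move=> h1 h2 h3 h4 h5 h6 x y; rewrite !inE -!orbA.
by move=> /or4P[] /eqP-> /or4P[] /eqP->; rewrite ?eqxx // => _; rewrite // adjC.
Qed.

Lemma maxclique_four p A v Z s t : genpos p -> flat p A -> Z \in maxcliques A -> v \in Z -> v \notin s ->
  (forall x, x \in s -> adj A v x) -> uniq t -> size t = 4%N -> {subset t <= s} ->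
  (forall x y, x \in t -> y \in t -> x != y -> adj A x y) ->
  (count (mem Z) s <= 3)%N -> (1 < count (mem Z) t)%N -> False.
Proof.
move=> g f hZ vZ vs va u t4 ss clt c3 c2.
have : has (predC (mem Z)) t.
  rewrite has_predC; apply/negP=> al; have : (4 <= count (mem Z) s)%N.
    rewrite -t4 -size_filter; apply: uniq_leq_size => // x xt.
    by rewrite mem_filter ss // andbT; apply: (allP al).
  by rewrite leqNgt ltnS c3.
case/hasP=> y yt /= yZ.
have : (1 < size (filter (mem Z) t))%N by rewrite size_filter.
have := filter_uniq (mem Z) u; have mf x := mem_filter (mem Z) x t.
case: (filter _ _) mf => [|x1 [|x2 r]] // mf /= /andP[x12 _] _.
have /andP[x1Z x1t] : (x1 \in Z) && (x1 \in t) by rewrite -mf inE eqxx.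
have /andP[x2Z x2t] : (x2 \in Z) && (x2 \in t) by rewrite -mf !inE eqxx orbT.
apply: (negP yZ); apply: (maxcliques_attach g f hZ vZ x1Z x2Z).
- have nv z : z \in t -> v != z by move=> /ss zs; apply: contraNneq vs => ->.
  by have := nv _ x1t; have := nv _ x2t; move: x12; rewrite inE negb_or => /andP[? _] ? ?; uniqs.
- by rewrite adjC va // ss.
- by apply: clt => //; apply: contraNneq yZ => ->.
- by apply: clt => //; apply: contraNneq yZ => ->.
Qed.

Lemma star4_nonclique p A W v s x y : good p -> flat p A -> v \notin W -> uniq (v :: s) -> size s = 4%N ->
  x \in s -> y \in s -> x != y -> ~~ adj A x y ->
  rk p (ins A W :|: star v s) = (rk p (ins A W) + 4)%N.
Proof.
move=> gp f vW us s4 xs ys xy nxy.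
have p1 := perm_to_rem xs; have ysx : y \in rem x s.
  by move: ys; rewrite (perm_mem p1) inE eq_sym (negbTE xy).
have {p1} p1 : perm_eq s (x :: y :: rem y (rem x s)).
  by apply: perm_trans p1 _; rewrite perm_cons perm_to_rem.
have sz := perm_size p1; rewrite s4 in sz.
case: (rem y _) p1 sz => [|z [|w []]] // p1 _.
rewrite (eq_star v (perm_mem p1)).
have [q0 m0 s0] := ins_witness W f xy nxy.
apply: (one_ext gp (ins_avoids vW) _ m0 s0).
by move: us; rewrite !cons_uniq (perm_uniq p1) (perm_mem p1).
Qed.

(** No four members of [s] form a clique, by [maxclique_four], so four edges are independent by
    [one_ext]. A dependent five would contain three pairwise nonadjacent vertices in [X :|: Y], two
    of them in the same clique. *)
Lemma two_cliques_star p A U v X Y s : good p -> flat p A -> X \in maxcliques A ->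
  Y \in maxcliques A -> v \in X -> v \in Y -> v \notin U -> uniq s ->
  {subset s <= U} -> {subset s <= X :|: Y} ->
  (count (mem X) s <= 3)%N -> (count (mem Y) s <= 3)%N -> (size s <= 5)%N ->
  rk p (ins A U :|: star v s) = (rk p (ins A U) + size s)%N.
Proof.
move=> gp f hX hY vX vY vU us sU sXY cX cY s5; have g := good_genpos gp.
have vs : v \notin s by apply: contra vU; apply: sU.
have [clX _] := maxcliquesP hX; have [clY _] := maxcliquesP hY.
have va x : x \in s -> adj A v x.
  move=> xs; have vx : v != x by apply: contraNneq vs => ->.
  by have := sXY x xs; rewrite inE => /orP[] h; [apply: clX|apply: clY].
have NC a b c d : uniq [:: a; b; c; d] -> {subset [:: a; b; c; d] <= s} ->
    cliq A [set a; b; c; d] -> False.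
  move=> u ss cl; set t := [:: a; b; c; d] in u ss.
  have clt x y : x \in t -> y \in t -> x != y -> adj A x y.
    by move=> xt yt; apply: cl; rewrite !inE -!orbA; [move: xt|move: yt]; rewrite !inE.
  have half Z : Z \in maxcliques A -> v \in Z -> (count (mem Z) s <= 3)%N -> (count (mem Z) t >= 2)%N -> False.
    by move=> hZ vZ c3 c2; apply: (maxclique_four g f hZ vZ vs va u _ ss clt c3 c2).
  have ct : (4 <= count (mem X) t + count (mem Y) t)%N.
    have tXY : all (fun x => (x \in X) || (x \in Y)) t by apply/allP=> x /ss/sXY; rewrite inE.
    rewrite -count_predUI; apply: leq_trans (leq_addr _ _).
    suff /eqP -> : count (predU (mem X) (mem Y)) t == size t by [].
    by rewrite -all_count; apply: tXY.
  case: (leqP 2 (count (mem X) t)) => h; first exact: (half X).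
  by apply: (half Y) => //; lia.
have [s3|s4] := leqP (size s) 3.
  by apply: star_small => //=; rewrite ?vs //; apply: ins_avoids.
have four a b c d : uniq [:: a; b; c; d] -> {subset [:: a; b; c; d] <= s} ->
    rk p (ins A U :|: star v [:: a; b; c; d]) = (rk p (ins A U) + 4)%N.
  move=> u ss; case: (boolP (cliqb A [set a; b; c; d])) => [/cliqP/(NC _ _ _ _ u ss)//|].
  rewrite negb_forall_in => /exists_inP[x xS]; rewrite negb_forall_in => /exists_inP[y yS].
  rewrite negb_imply => /andP[xy nxy].
  apply: (star4_nonclique gp f vU _ _ _ _ xy nxy) => //; last 2 first.
  - by move: xS; rewrite !inE -!orbA.
  - by move: yS; rewrite !inE -!orbA.
  by rewrite cons_uniq u andbT; apply: contra vs; apply: ss.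
move: us s4 s5 (sU) (va) (four) (NC) (sXY) (vs).
case: s {sU sXY cX cY vs va four NC} => [|a [|b [|c [|d [|e' [|]]]]]] //= us _ _ sU va four NC sXY vs.
  by apply: four.
have [h|h] := ltnP (rk p (ins A U) + 4) (rk p (ins A U :|: star v [:: a; b; c; d; e'])).
  apply/eqP; rewrite eqn_leq; apply/andP; split; last by rewrite addnS.
  by apply: leq_trans (rkU _ _ _) _; rewrite leq_add2l card_star.
exfalso.
have [|x [y [z [w [t [H [[h1 h2 h3 h4] [h5 h6]]]]]]]] := five_star gp f vU us sU va h.
  move=> x y z w u ss /and5P[a1 a2 a3 a4 a5]; apply/negP=> a6.
  by apply: (NC x y z w u ss); apply: cliq4.
have ss : {subset [:: x; y; z; w; t] <= [:: a; b; c; d; e']} by case/andP: H => _ /allP; apply.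
have u5 : uniq [:: x; y; z; w; t] by case/andP: H.
have [[n1 _ _ n2] _ _] := special_rel gp f vU u5 (fun _ h => sU _ (ss _ h)) (fun _ h => va _ (ss _ h))
  h1 h2 h3 h4 h5 h6 ltac:(by rewrite (@star_dep_perm _ _ p _ v [:: a; b; c; d; e'])).
have [xs ys zs] : [/\ x \in X :|: Y, y \in X :|: Y & z \in X :|: Y].
  by split; apply: sXY; apply: ss; rewrite !inE eqxx ?orbT.
have [xy xz yz] : [/\ x != y, x != z & y != z] by ucut u5; split.
move: xs ys zs; rewrite !inE => /orP[] xs /orP[] ys /orP[] zs.
all: first [ by case/negP: h5; first [exact: clX | exact: clY]
  | by case/negP: n1; first [exact: clX | exact: clY]
  | by case/negP: n2; first [exact: clX | exact: clY] ].
Qed.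

End MaxCliques.

(** * Inclusion-exclusion weights for a vertex in two cliques *)

Section Profiles.
Implicit Types (t h : bitseq) (pr : seq (int * bitseq)).

Fixpoint masks n : seq bitseq :=
  if n is n'.+1 then map (cons true) (masks n') ++ map (cons false) (masks n') else [:: [::]].

Lemma mem_masks t : t \in masks (size t).
Proof.
elim: t => [|b t IH] //=; rewrite mem_cat.
by case: b; apply/orP; [left|right]; apply: map_f.
Qed.

Definition weight pr t : int := foldr (fun c z => (if all2 implb c.2 t then c.1 else 0) + z) 0 pr.

(* For the seven neighbours of a vertex in two cliques, of incidence vectors
   [hx] and [hy], any available set [t] of them contains a star [t'] that is
   independent by [two_cliques_star] and has at least [weight pr t] edges. *)
Definition profile hx hy pr :=
  all (fun t => has (fun t' => [&& size t' == 7, all2 implb t' t,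
     (count id (mask t' hx) <= 3)%N, (count id (mask t' hy) <= 3)%N,
     (count id t' <= 5)%N & weight pr t <= (count id t')%:Z]) (masks 7)) (masks 7)
  && all (fun c => size c.2 == 7) pr.

Definition onehot (i : nat) := nseq i false ++ true :: nseq (6 - i) false.

(** The coordinates are the second common vertex, three vertices of [X], three of [Y]. One edge is
    lost when all four of [X] are present, one when all four of [Y] are, one when the six without
    the common vertex exceed the cap of five; with all seven present these overlap, and 1 restores
    the total to five. *)
Definition hinge_profile : seq (int * bitseq) :=
  [seq (1, onehot i) | i <- iota 0 7] ++
  [:: (-1, [:: true; true; true; true; false; false; false]);
      (-1, [:: true; false; false; false; true; true; true]);
      (-1, [:: false; true; true; true; true; true; true]);
      (1, nseq 7 true)].

(** The coordinates are four vertices of [X] and three of [Y]. The corrections are for a full [X]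
    and for each six-set with three in either clique; with all seven present they leave
    [7 - 1 - 4 = 2], and the weight 3 brings this back to five. *)
Definition disjoint_profile : seq (int * bitseq) :=
  [seq (1, onehot i) | i <- iota 0 7] ++
  [:: (-1, [:: true; true; true; true; false; false; false]);
      (-1, [:: false; true; true; true; true; true; true]);
      (-1, [:: true; false; true; true; true; true; true]);
      (-1, [:: true; true; false; true; true; true; true]);
      (-1, [:: true; true; true; false; true; true; true]);
      (3, nseq 7 true)].

Lemma hinge_profileP : profile [:: true; true; true; true; false; false; false]
  [:: true; false; false; false; true; true; true] hinge_profile.
Proof. by vm_compute. Qed.

Lemma disjoint_profileP : profile [:: true; true; true; true; false; false; false]
  [:: false; false; false; false; true; true; true] disjoint_profile.
Proof. by vm_compute. Qed.

Definition mean pr : rat := \sum_(c <- pr) c.1%:~R / (count id c.2).+1%:R.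

(** The value is [7/2 - 2/5 - 1/7 + 1/8]. *)
Lemma hinge_mean : 3 < mean hinge_profile.
Proof. by rewrite /mean /hinge_profile /= !big_cons big_nil; vm_compute. Qed.

(** The value is [7/2 - 1/5 - 4/7 + 3/8]. *)
Lemma disjoint_mean : 3 < mean disjoint_profile.
Proof. by rewrite /mean /disjoint_profile /= !big_cons big_nil; vm_compute. Qed.

End Profiles.

Section Shell.
Variables (R : realFieldType) (n : nat).
Implicit Types (e : edge n) (F G H A : {set edge n}) (i j k l m v w a b d y : 'I_n)
  (p : 'I_n -> R * R) (q : 'M[R]_(n, 3)) (s Q : seq 'I_n) (U X Y Z : {set 'I_n})
  (CC : {set {set 'I_n}}) (pr : seq (int * bitseq)).

Lemma all_mask_impl (T : Type) (P : pred T) (t : bitseq) (Q : seq T) : size t = size Q ->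
  all P (mask t Q) = all2 implb t (map P Q).
Proof. by elim: t Q => [|b t IH] [|x Q] //= [/IH <-]; case: b. Qed.

Lemma maxcliques_profile p A U v X Y Q hx hy pr : good p -> flat p A ->
  X \in maxcliques A -> Y \in maxcliques A -> v \in X -> v \in Y -> size Q = 7 -> uniq (v :: Q) ->
  {subset Q <= U} -> {subset Q <= X :|: Y} -> map (mem X) Q = hx -> map (mem Y) Q = hy ->
  profile hx hy pr -> 
  exists L : seq (rat * {set 'I_n}),
  [/\ forall c, c \in L -> v \notin c.2 /\ c.2 \subset U,
      (forall Z, Z \subset U -> v \in Z -> (rk p (ins A (Z :\ v)))%:R
         + \sum_(c <- L | c.2 \subset Z :\ v) c.1 <= (rk p (ins A Z))%:R :> rat) &
      \sum_(c <- L) c.1 / (#|c.2|.+1)%:R = mean pr].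
Proof.
move=> gp f hX hY vX vY Q7 /= /andP[vQ uQ] QU QXY EX EY /andP[/allP H /allP S7].
pose D (c : int * bitseq) : rat * {set 'I_n} := (c.1%:~R, [set x in mask c.2 Q]).
exists (map D pr); split.
- move=> _ /mapP[c cpr ->] /=; split; first by rewrite inE; apply: contra vQ; apply: mem_mask.
  by apply/subsetP=> x; rewrite inE => /mem_mask/QU.
- move=> Z ZU vZ; pose t := map (mem (Z :\ v)) Q.
  have st : size t = 7 by rewrite size_map.
  have tm : t \in masks 7 by have := mem_masks t; rewrite st.
  have /hasP[t' _ /and5P[/eqP s7 it cx cy /andP[c5 wt]]] := H t tm.
  pose s := mask t' Q.
  have sZ : {subset s <= Z :\ v}.
    have : all (mem (Z :\ v)) s by rewrite all_mask_impl // s7 Q7.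
    by move=> /allP h x /h.
  have szs : size s = count id t' by rewrite size_mask // s7 Q7.
  have cnt (W : {set 'I_n}) h : map (mem W) Q = h -> count (mem W) s = count id (mask t' h).
    by move=> <-; rewrite -map_mask count_map.
  have two := @two_cliques_star _ _ p A (Z :\ v) v X Y s gp f hX hY vX vY _ (mask_uniq uQ t') sZ.
  have {}two : rk p (ins A (Z :\ v) :|: star v s) = (rk p (ins A (Z :\ v)) + size s)%N.
    apply: two; rewrite ?setD11 ?(cnt _ _ EX) ?(cnt _ _ EY) ?szs //.
    by move=> x /mem_mask/QXY.
  apply: (@le_trans _ _ (rk p (ins A (Z :\ v) :|: star v s))%:R); last first.
    rewrite ler_nat; apply: rkS; rewrite subUset; apply/andP; split.
      by apply: insS; apply: subsetDl.
    have sQ x : x \in s -> x \in Q by apply: mem_mask.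
    rewrite /ins subsetI; apply/andP; split; last first.
      by apply: star_within => // x /sZ; rewrite inE => /andP[].
    apply: star_sub => [|x /sQ xQ]; first by apply: contra vQ => /sQ.
    have vx : v != x by apply: contraNneq vQ => ->.
    have [clX _] := maxcliquesP hX; have [clY _] := maxcliquesP hY.
    by have := QXY x xQ; rewrite inE => /orP[] h; [apply: clX|apply: clY].
  rewrite two natrD lerD2l szs -(@mulrz_nat _ (count id t')) big_map.
  apply: (@le_trans _ _ (weight pr t)%:~R); last by rewrite ler_int natz.
  rewrite le_eqVlt; apply/orP; left; apply/eqP.
  have : forall c, c \in pr -> size c.2 = 7 by move=> c /S7/eqP.
  elim: pr {H S7 wt} => [|c pr IH] h; first by rewrite big_nil.
  rewrite big_cons IH /=; last by move=> x xp; apply: h; rewrite inE xp orbT.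
  have -> : ([set x in mask c.2 Q] \subset Z :\ v) = all2 implb c.2 t.
    rewrite -all_mask_impl; last by rewrite (h c) ?Q7 // inE eqxx.
    apply/subsetP/allP => h' x; first by move=> xm; apply: h'; rewrite inE.
    by rewrite inE; apply: h'.
  by case: ifP => _; rewrite rmorphD //= ?rmorph0 ?add0r.
- rewrite (big_map D predT) /mean big_seq [RHS]big_seq; apply: eq_bigr => c cp /=.
  rewrite -(size_mask (s := Q)); last by rewrite (eqP (S7 _ cp)) Q7.
  by rewrite cardsE (card_uniqP _) // mask_uniq.
Qed.

Lemma pick_seq (S : {set 'I_n}) (k : nat) : (k <= #|S|)%N ->
  exists s, [/\ uniq s, size s = k & {subset s <= S}].
Proof.
move=> kS; exists (take k (enum S)); split; first by rewrite take_uniq // enum_uniq.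
  by rewrite size_takel // -cardE.
by move=> x /mem_take; rewrite mem_enum.
Qed.

(** If the cliques meet only in [v], each keeps [5 - 1] vertices of [U], and four and three of them
    are used. If they meet in a hinge, each keeps [5 - 2], and the second vertex of the hinge is the
    seventh neighbour. *)
Lemma vertex_profile p A U v X Y : good p -> flat p A ->
  X \in maxcliques A -> Y \in maxcliques A -> X != Y -> v \in X -> v \in Y -> X :&: Y \subset U ->
  (5 <= #|X :&: U|)%N -> (5 <= #|Y :&: U|)%N ->
  exists L : seq (rat * {set 'I_n}),
  [/\ forall c, c \in L -> v \notin c.2 /\ c.2 \subset U,
      (forall Z, Z \subset U -> v \in Z -> (rk p (ins A (Z :\ v)))%:R
         + \sum_(c <- L | c.2 \subset Z :\ v) c.1 <= (rk p (ins A Z))%:R :> rat) &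
      3 < \sum_(c <- L) c.1 / (#|c.2|.+1)%:R].
Proof.
move=> gp f hX hY XY vX vY IU X5 Y5; have g := good_genpos gp.
pose I := X :&: Y; have I2 : (#|I| <= 2)%N := maxcliques_thin g f hX hY XY.
have vI : v \in I by rewrite inE vX.
have inX x : x \in X -> x \notin I -> x \notin Y by rewrite inE => ->.
have inY x : x \in Y -> x \notin I -> x \notin X by rewrite inE => ->; rewrite andbT.
have diff (W : {set 'I_n}) : (#|W :&: U| - #|I| <= #|(W :&: U) :\: I|)%N.
  by rewrite cardsD leq_sub2l // subset_leq_card // subsetIr.
have prop (W : {set 'I_n}) s : {subset s <= (W :&: U) :\: I} ->
    forall x, x \in s -> [/\ x \in W, x \in U & x \notin I].
  by move=> h x /h; rewrite !inE => /and3P[-> -> ->].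
case: (set_0Vmem (I :\ v)) => [I0|[w]].
- have I1 : #|I| = 1%N by rewrite (cardsD1 v) vI I0 cards0.
  have [sa [ua za /prop pa]] := pick_seq (leq_trans (leq_sub X5 (eq_leq I1)) (diff X)).
  have [sb [ub zb /prop pb]] := pick_seq (leq_trans (leq_sub (ltnW Y5) (eq_leq I1)) (diff Y)).
  case: sa ua za pa => [|a1 [|a2 [|a3 [|a4 []]]]] // ua _ pa.
  case: sb ub zb pb => [|b1 [|b2 [|b3 []]]] // ub _ pb.
  pose Q := [:: a1; a2; a3; a4] ++ [:: b1; b2; b3].
  have ma : map (mem X) [:: a1; a2; a3; a4] = nseq 4 true /\ map (mem Y) [:: a1; a2; a3; a4] = nseq 4 false.
    have h x : x \in [:: a1; a2; a3; a4] -> (x \in X = true) * (x \in Y = false).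
      by case/pa => xX _ xI; rewrite xX (negbTE (inX _ xX xI)).
    by rewrite /= !h ?inE ?eqxx ?orbT.
  have mb : map (mem X) [:: b1; b2; b3] = nseq 3 false /\ map (mem Y) [:: b1; b2; b3] = nseq 3 true.
    have h x : x \in [:: b1; b2; b3] -> (x \in X = false) * (x \in Y = true).
      by case/pb => xX _ xI; rewrite xX (negbTE (inY _ xX xI)).
    by rewrite /= !h ?inE ?eqxx ?orbT.
  have [||||||L [h1 h2 h3]] := @maxcliques_profile p A U v X Y Q _ _ _ gp f hX hY vX vY _ _ _ _ _ _ disjoint_profileP.
  - by [].
  - rewrite cons_uniq cat_uniq ua ub andbT andTb mem_cat negb_or -andbA; apply/and3P; split.
    + by apply/negP=> /pa[_ _]; rewrite vI.
    + by apply/negP=> /pb[_ _]; rewrite vI.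
    + apply/hasPn=> x /pb[xY _ xI]; apply/negP=> /pa[xX _ _]; apply: (negP xI).
      by rewrite inE xX.
  - by move=> x; rewrite mem_cat => /orP[/pa[]|/pb[]].
  - by move=> x; rewrite mem_cat in_setU => /orP[/pa[-> _ _]|/pb[-> _ _]]; rewrite ?orbT.
  - by rewrite map_cat ma.1 mb.1.
  - by rewrite map_cat ma.2 mb.2.
  by exists L; rewrite h3; split=> //; apply: disjoint_mean.
rewrite !inE => /andP[wv /andP[wX wY]].
have [sa [ua za /prop pa]] := pick_seq (leq_trans (leq_sub X5 I2) (diff X)).
have [sb [ub zb /prop pb]] := pick_seq (leq_trans (leq_sub Y5 I2) (diff Y)).
case: sa ua za pa => [|a1 [|a2 [|a3 []]]] // ua _ pa.
case: sb ub zb pb => [|b1 [|b2 [|b3 []]]] // ub _ pb.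
pose Q := w :: [:: a1; a2; a3] ++ [:: b1; b2; b3].
have ma : map (mem X) [:: a1; a2; a3] = nseq 3 true /\ map (mem Y) [:: a1; a2; a3] = nseq 3 false.
  have h x : x \in [:: a1; a2; a3] -> (x \in X = true) * (x \in Y = false).
    by case/pa => xX _ xI; rewrite xX (negbTE (inX _ xX xI)).
  by rewrite /= !h ?inE ?eqxx ?orbT.
have mb : map (mem X) [:: b1; b2; b3] = nseq 3 false /\ map (mem Y) [:: b1; b2; b3] = nseq 3 true.
  have h x : x \in [:: b1; b2; b3] -> (x \in X = false) * (x \in Y = true).
    by case/pb => xX _ xI; rewrite xX (negbTE (inY _ xX xI)).
  by rewrite /= !h ?inE ?eqxx ?orbT.
have wI : w \in I by rewrite inE wX.
have [||||||L [h1 h2 h3]] := @maxcliques_profile p A U v X Y Q _ _ _ gp f hX hY vX vY _ _ _ _ _ _ hinge_profileP.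
- by [].
- have nI x z : x \in Q -> z \in I -> z != w -> x != z.
    move=> xQ zI zw; apply: contraNneq zw => E; rewrite {}E in xQ.
    by move: xQ; rewrite in_cons mem_cat => /or3P[//|/pa[_ _]|/pb[_ _]]; rewrite zI.
  have wQ : w \notin [:: a1; a2; a3] ++ [:: b1; b2; b3].
    by apply/negP; rewrite mem_cat => /orP[/pa[_ _]|/pb[_ _]]; rewrite wI.
  rewrite cons_uniq /Q cons_uniq wQ cat_uniq ua ub andbT andTb; apply/andP; split.
    by apply/negP=> vQ; have := nI v v vQ vI; rewrite eqxx eq_sym wv => /(_ isT).
  apply/hasPn=> x /pb[xY _ xI]; apply/negP=> /pa[xX _ _]; apply: (negP xI).
  by rewrite inE xX.
- move=> x; rewrite in_cons mem_cat => /or3P[/eqP->|/pa[]|/pb[]] //.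
  exact: (subsetP IU).
- by move=> x; rewrite in_cons mem_cat in_setU => /or3P[/eqP->|/pa[-> _ _]|/pb[-> _ _]]; rewrite ?wX ?orbT.
- by rewrite /Q map_cons map_cat ma.1 mb.1 /= wX.
- by rewrite /Q map_cons map_cat ma.2 mb.2 /= wY.
by exists L; rewrite h3; split=> //; apply: hinge_mean.
Qed.

(** Take for [U] the vertices lying in at least two members. If every member met the union of the
    others in five vertices, it would meet [U] in five, and averaging the profiles would give rank
    at least [3 * #|U|], whereas even the complete graph on [U] has rank [3 * #|U| - 6]. *)
Lemma no_core p A CC : good p -> flat p A -> CC \subset maxcliques A -> CC != set0 ->
  exists2 X, X \in CC & (#|X :&: \bigcup_(Y in CC :\ X) Y| <= 4)%N.
Proof.
move=> gp f /subsetP CCm /set0Pn[X0 X0C].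
case: (boolP [exists X in CC, #|X :&: \bigcup_(Y in CC :\ X) Y| <= 4]%N) => [/exists_inP[X ? ?]|]; first by exists X.
rewrite negb_exists_in => /forall_inP core.
pose U := [set v | [exists X in CC, exists Y in CC, [&& X != Y, v \in X & v \in Y]]].
have UP v : v \in U -> exists X Y, [/\ X \in CC, Y \in CC, X != Y, v \in X & v \in Y].
  by rewrite inE => /exists_inP[X XC /exists_inP[Y YC /and3P[? ? ?]]]; exists X, Y.
have UI v X Y : X \in CC -> Y \in CC -> X != Y -> v \in X -> v \in Y -> v \in U.
  move=> XC YC XY vX vY; rewrite inE; apply/exists_inP; exists X => //.
  by apply/exists_inP; exists Y => //; rewrite XY vX.
have U5 X : X \in CC -> (5 <= #|X :&: U|)%N.
  move=> XC; have := core X XC; rewrite -ltnNge => h; apply: leq_trans h _.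
  apply: subset_leq_card; apply/subsetP=> v; rewrite !inE => /andP[vX /bigcupP[Y]].
  rewrite !inE => /andP[YX YC] vY; rewrite vX /=.
  by have := UI v X Y XC YC; rewrite inE => -> //; rewrite eq_sym.
pose P v (L : seq (rat * {set 'I_n})) := v \in U ->
  [/\ forall c, c \in L -> v \notin c.2 /\ c.2 \subset U,
      (forall Z, Z \subset U -> v \in Z -> (rk p (ins A (Z :\ v)))%:R
         + \sum_(c <- L | c.2 \subset Z :\ v) c.1 <= (rk p (ins A Z))%:R :> rat) &
      3 < \sum_(c <- L) c.1 / (#|c.2|.+1)%:R].
have /fin_all_exists[L0 hL0] : forall v, exists L, P v L.
  move=> v; case: (boolP (v \in U)) => [vU|/negbTE vU]; last by exists [::] => /idP; rewrite vU.
  have [X [Y [XC YC XY vX vY]]] := UP v vU.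
  have [|L hL] := vertex_profile gp f (CCm _ XC) (CCm _ YC) XY vX vY _ (U5 _ XC) (U5 _ YC).
    by apply/subsetP=> x; rewrite [x \in _ :&: _]inE => /andP[]; apply: UI XC YC XY.
  by exists L.
pose L v := if v \in U then L0 v else [::].
have LU v : v \in U -> L v = L0 v by rewrite /L => ->.
have /(_ (fun Z => rk p (ins A Z)) L U) av := @averaging 'I_n.
have : \sum_(v in U) (3 : rat) <= \sum_(v in U) \sum_(c <- L v | c.2 \subset U) c.1 / (#|c.2|.+1)%:R.
  apply: ler_sum => v vU; have [h1 _ h3] := hL0 v vU; rewrite LU //; apply: ltW; apply: lt_le_trans h3 _.
  rewrite le_eqVlt; apply/orP; left; apply/eqP; rewrite big_seq [RHS]big_seq_cond.
  by apply: eq_bigl => c; case: (boolP (c \in L0 v)) => //= /h1[_ ->].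
move=> lo; have {}av := le_trans lo (av _ _).
have : (3 * #|U| <= rk p (ins A U))%N.
  rewrite -(ler_nat rat) natrM; apply: le_trans (av _ _); first by rewrite sumr_const mulr_natr.
    move=> v c; rewrite /L; case: ifP => // vU; have [h1 _ _] := hL0 v vU.
    by case/h1.
  move=> Z v ZU vZ; have vU := subsetP ZU _ vZ; rewrite LU //.
  by have [_ h2 _] := hL0 v vU; apply: h2.
have : (5 <= #|U|)%N by apply: leq_trans (U5 _ X0C) _; apply: subset_leq_card; apply: subsetIr.
move=> u5; have := rk_within gp (X := U) ltac:(lia).
have : (rk p (ins A U) <= rk p (within U))%N by apply: rkS; apply: subsetIr.
lia.
Qed.

Lemma maxcliques_shellable p A : good p -> flat p A -> four_shellable (maxcliques A).
Proof.
move=> gp f; have [k] := ubnP #|maxcliques A|.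
have : maxcliques A \subset maxcliques A by [].
move: {1 3 4}(maxcliques A) => CC; elim: k CC => // k IH CC CA; rewrite ltnS => Ck.
case: (eqVneq CC set0) => [->|/(no_core gp f CA)[X XC X4]].
  by exists [::]; split=> // [X|i]; rewrite ?inE //; case: i.
have [||s [us ms hs]] := IH (CC :\ X).
- by apply: subset_trans CA; apply: subsetDl.
- by move: Ck; rewrite (cardsD1 X) XC; lia.
exists (rcons s X); split.
- by rewrite rcons_uniq us ms !inE eqxx.
- by move=> Y; rewrite mem_rcons inE ms !inE; case: eqP => // ->.
move=> i; rewrite size_rcons ltnS => /andP[i0 ile].
have E : \bigcup_(j < i) nth set0 (rcons s X) j = \bigcup_(j < i) nth set0 s j.
  by apply: eq_bigr => j _; rewrite nth_rcons (leq_trans (ltn_ord j) ile).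
rewrite E nth_rcons; case: ltnP => [lti|gei]; first by apply: hs; rewrite i0.
have -> : i = size s by apply/eqP; rewrite eqn_leq ile.
rewrite eqxx; apply: leq_trans X4; apply: subset_leq_card; apply: setIS.
apply/bigcupsP=> j _; apply: bigcup_sup; rewrite -ms; apply: mem_nth; exact: ltn_ord.
Qed.

End Shell.

(** * Special vertices *)

Section SpecialVertex.
Variables (R : realFieldType) (n : nat).
Implicit Types (e : edge n) (F G H A : {set edge n}) (i j k l m v a b c d y : 'I_n)
  (p : 'I_n -> R * R) (q : 'M[R]_(n, 3)) (s : seq 'I_n) (U X Y : {set 'I_n}).

Definition nbrs A U v := [set x in U | adj A v x].

Lemma ins_star A U v s : v \in U -> s =i nbrs A U v -> ins A U = ins A (U :\ v) :|: star v s.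
Proof.
move=> vU hs; apply/setP=> e; rewrite in_setU; have he := joins_e e.
have E : (e \in star v s) = (inc v e && (e \in ins A U)).
  apply/idP/andP=> [/star_joins[x]|[]].
    rewrite hs inE => /andP[xU vx] h; rewrite (inc_joins _ h) eqxx -(adjE _ h) ins_adj.
    by rewrite vx vU xU.
  rewrite -(adjE _ he) ins_adj => /orP[/eqP E|/eqP E] /and3P[aA u1 u2].
    by apply: (joins_star (j := e2 e)); rewrite ?hs ?inE ?u2 E.
  by apply: (joins_star (j := e1 e)); rewrite ?hs ?inE ?u1 E // 1?joinsC // adjC.
rewrite E -!(adjE _ he) !ins_adj !inE /inc.
case: (adj A _ _) => //=; last by rewrite andbF.
by case: (e1 e \in U); case: (e2 e \in U); rewrite ?andbF ?andbT //= -negb_or ![_ == v]eq_sym orNb.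
Qed.

(* The configuration of [special_rel], with centre [c]. *)
Definition special p A U v c X :=
  [/\ v \in U, c \notin X, nbrs A U v = c |: X & #|X| = 4%N] /\
  [/\ forall x, x \in X -> adj A x c, forall x y, x \in X -> y \in X -> ~~ adj A x y &
      rk p (ins A U) = (rk p (ins A (U :\ v)) + 4)%N].

Lemma special_good p p' A U v c X : good p -> good p' -> special p A U v c X -> special p' A U v c X.
Proof. by move=> g g' [h [h1 h2 h3]]; split=> //; split=> //; rewrite -!(good_rk _ g g'). Qed.

Lemma special_nbr p A U v c X x : special p A U v c X -> x \in c |: X -> x \in U /\ adj A v x.
Proof. by case=> [[vU cX E X4] _]; rewrite -E inE => /andP. Qed.

Lemma special_uniq p A U v c X s : special p A U v c X -> uniq s -> {subset s <= X} ->
  uniq [:: v, c & s].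
Proof.
move=> sp us sX; have nb := special_nbr sp; case: sp => [[vU cX E X4] _].
rewrite !cons_uniq us andbT in_cons negb_or -andbA; apply/and3P; split.
- by have [_ /adj_neq] := nb c (setU11 _ _).
- by apply/negP=> /sX vX; have [_ /adj_neq] := nb v (setU1r _ vX); rewrite eqxx.
- by apply: contra cX; apply: sX.
Qed.

Lemma special_star p A U v c X i j k l : special p A U v c X -> uniq [:: i; j; k; l] ->
  {subset [:: i; j; k; l] <= X} -> ins A U = ins A (U :\ v) :|: star v [:: i; j; k; l; c].
Proof.
move=> sp us sX; case: sp => [[vU cX E X4] _]; apply: ins_star => // x.
have [_ Es] := uniq_min_size us (s2 := enum X) ltac:(by move=> z /sX; rewrite mem_enum)
  ltac:(by rewrite -cardE X4).
rewrite E in_setU1 -(mem_enum X) -Es -[[:: i; j; k; l; c]]/([:: i; j; k; l] ++ [:: c]) mem_cat orbC.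
by rewrite mem_seq1.
Qed.

Lemma special_use p A U v c X i j k l : good p -> flat p A -> special p A U v c X ->
  uniq [:: i; j; k; l] -> {subset [:: i; j; k; l] <= X} ->
  (exists q, [/\ motion p (ins A (U :\ v)) q, stretch p i j q = 0 & stretch p i k q != 0]) /\
  forall q, motion p (ins A (U :\ v)) q ->
    [/\ term p q k l i j c = term p q i j k l c, term p q j l i k c = term p q i k j l c,
        term p q j k i l c = term p q i l j k c &
        term p q i j k l c + term p q i k j l c + term p q i l j k c = 0].
Proof.
move=> gp f sp us sX; have Es := special_star sp us sX.
have uv := special_uniq sp us sX; have nb := special_nbr sp.
have sb x : x \in [:: i; j; k; l; c] -> x \in c |: X.
  by rewrite -[[:: i; j; k; l; c]]/([:: i; j; k; l] ++ [:: c]) mem_cat in_setU1 mem_seq1 => /orP[/sX->|->//]; rewrite orbT.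
case: sp => [[vU cX E X4] [ac nX rkU]].
have [iX jX kX lX] : [/\ i \in X, j \in X, k \in X & l \in X].
  by split; apply: sX; rewrite !inE eqxx ?orbT.
have [|||||_ h1 h2] := @special_rel _ _ p A (U :\ v) v i j k l c gp f _ _ _ _
   (ac _ iX) (ac _ jX) (ac _ kX) (ac _ lX) (nX _ _ iX jX) (nX _ _ kX lX) _.
- by rewrite setD11.
- by ucut uv; uniqs.
- move=> x /sb xX; have [xU /adj_neq vx] := nb x xX.
  by rewrite in_setD1 xU eq_sym vx.
- by move=> x /sb/nb[].
- by rewrite -Es rkU.
by [].

Qed.

End SpecialVertex.

Section BracketLines.
Variable R : realFieldType.
Implicit Types (a b c d : R * R).

Lemma br_mid3 a b c d (t : R) : br c d (mid a b t) = br c d a + t * (br c d b - br c d a).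
Proof. by rewrite /br /mid /=; ring. Qed.

Lemma polyfun_br a b c d : polyfun (fun t => br c d (mid a b t)).
Proof.
have [P hP] : polyfun (fun t => br c d a + t * (br c d b - br c d a)) by polyfun_tac.
by exists P => t; rewrite hP br_mid3.
Qed.

Lemma br_mid_neq0 a b c d : br c d a != 0 -> exists2 P : {poly R}, P != 0 &
  forall t, P.[t] = br c d (mid a b t).
Proof.
move=> h; have [P hP] := polyfun_br a b c d; exists P => //.
by apply: contraNneq h => P0; rewrite -(mid0 a b) -hP P0 horner0.
Qed.

End BracketLines.

Ltac polyfun_br_tac := repeat first [ apply: polyfun_br | apply: polyfun_const | apply: polyfun_id
  | apply: polyfunD | apply: polyfunN | apply: polyfunM ].

(** * Special vertices with a common centre are nonadjacent *)

Section Exclusion.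
Variables (R : realFieldType) (n : nat).
Implicit Types (e : edge n) (F G H A : {set edge n}) (i j k l m v a b c d y : 'I_n)
  (p : 'I_n -> R * R) (q : 'M[R]_(n, 3)) (s : seq 'I_n) (U X Y : {set 'I_n}).

Lemma linform_term p i j k l m : linform (fun q => term p q i j k l m).
Proof. by move=> t q q'; rewrite termD. Qed.

Lemma linform_add (L L' : 'M[R]_(n, 3) -> R) : linform L -> linform L' -> linform (fun q => L q + L' q).
Proof. by move=> h h' t q q'; rewrite h h'; ring. Qed.

(** Balance at [v1] makes the left side vanish on the motions that respect the star of [v2]. It is
    therefore a combination of the stretches of that star, necessarily the Lagrange one, and
    [star4_coef] moves it to the triangle [y1], [y2], [y3], as the edges at [c] are unstretched. *)
Lemma special_adjacent_functional p A U v1 v2 c X1 X2 x1 x2 x3 y1 y2 y3 : good p -> flat p A ->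
  special p A U v1 c X1 -> special p A U v2 c X2 ->
  uniq [:: v2; x1; x2; x3] -> {subset [:: v2; x1; x2; x3] <= X1} ->
  uniq [:: v1; y1; y2; y3] -> {subset [:: v1; y1; y2; y3] <= X2} ->
  exists t, forall q, motion p (ins A (U :\ v1 :\ v2)) q ->
    term p q x2 x3 v2 x1 c + term p q x1 x3 v2 x2 c + term p q x1 x2 v2 x3 c
    = t * (term p q y1 y2 v2 y3 c + term p q y1 y3 v2 y2 c + term p q y2 y3 v2 y1 c).
Proof.
move=> gp f sp1 sp2 u1 s1 u2 s2; have g := good_genpos gp.
have [_ rel] := special_use gp f sp1 u1 s1.
have uv1 := special_uniq sp1 u1 s1; have uv2 := special_uniq sp2 u2 s2.
pose L q := term p q x2 x3 v2 x1 c + term p q x1 x3 v2 x2 c + term p q x1 x2 v2 x3 c.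
have lL : linform L.
  apply: linform_add (linform_term _ _ _ _ _ _); apply: linform_add; exact: linform_term.
have E : ins A (U :\ v1) = ins A (U :\ v1 :\ v2) :|: star v2 [:: y1; y2; y3; c].
  have [_ E4] := uniq_min_size u2 (s2 := enum X2) ltac:(by move=> z /s2; rewrite mem_enum)
    ltac:(by rewrite -cardE; case: sp2 => [[_ _ _ ->]]).
  have {}E4 z : (z \in X2) = (z \in [:: v1; y1; y2; y3]) by rewrite E4 mem_enum.
  have [[v2U _ N2 _] _] := sp2.
  apply: ins_star; first by rewrite in_setD1 v2U andbT; ucut uv1; rewrite eq_sym.
  move=> z; have : (z \in nbrs A U v2) = (z \in c |: X2) by rewrite N2.
  rewrite [z \in c |: X2]inE E4 !inE => EE.
  have [Ez|/negbTE nz] := boolP (z == v1).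
    by rewrite (eqP Ez); ucut uv2; apply/negbTE; rewrite !negb_or; uniqs.
  move: EE; rewrite nz /= => ->; by case: (z == c); case: (z == y1); case: (z == y2); case: (z == y3).
have [|||t ht] := @functional_star _ _ p (ins A (U :\ v1 :\ v2)) v2 [:: y1; y2; y3; c] L lL.
- by ucut uv2; uniqs.
- by ucut uv2; uniqs.
- move=> q; rewrite -E => /rel[]; rewrite /L => r1 r2 r3; lra.
(* Motions of the complete graph on all vertices but [v2] annihilate [L], so on them the multipliers
   form a relation among the star edges alone. *)
have F0 : ins A (U :\ v1 :\ v2) \subset within [set~ v2].
  apply: subset_trans (subsetIr _ _) _; apply/subsetP=> e; rewrite !inE.
  by move=> /andP[/and3P[-> _ _] /and3P[-> _ _]].
have av : avoids (within [set~ v2]) v2.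
  by rewrite -[within _]setTI; apply: within_avoids; rewrite !inE eqxx.
have vs : v2 \notin [:: y1; y2; y3; c] by ucut uv2; uniqs.
have fm := @star_forms2 _ _ p (within [set~ v2]) v2 [:: y1; y2; y3; c] t av vs.
have z0 q a b : motion p (within [set~ v2]) q -> a != v2 -> b != v2 -> a != b -> stretch p a b q = 0.
  move=> mq av2 bv2 /joins_ex[e he]; apply/eqP; rewrite -(stretch_joins _ _ he); apply/eqP; apply: mq.
  by rewrite (within_joins _ he) !inE av2.
have [n1 n2 n3] : [/\ x1 != v2, x2 != v2 & x3 != v2] by ucut uv1; split; rewrite // eq_sym.
have [d1 d2 d3] : [/\ x1 != x2, x1 != x3 & x2 != x3] by ucut uv1; split.
have {}fm : forall a b, \sum_(j <- [:: y1; y2; y3; c]) t j * (B p v2 j a * B p v2 j b) = 0.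
  apply: fm => q mq; rewrite -(ht q (motionS F0 mq)) /L.
  rewrite (term0 _ _ _ (z0 q _ _ mq n2 n3 d3)) (term0 _ _ _ (z0 q _ _ mq n1 n3 d2)).
  by rewrite (term0 _ _ _ (z0 q _ _ mq n1 n2 d1)) !addr0.
have [] := @star4_coef _ _ p v2 y1 y2 y3 c t; try by apply: g; ucut uv2; uniqs.
  by [].
move=> w [_ hw]; exists w => q mq; rewrite -/(L q) (ht q mq) hw.
have zc a : a \in [:: y1; y2; y3] -> stretch p a c q = 0.
  move=> aX; have aX2 : a \in X2 by apply: s2; rewrite inE aX orbT.
  have [_ [ac _ _]] := sp2; have [aU _] := special_nbr sp2 (setU1r c aX2).
  have [cU _] := special_nbr sp2 (setU11 c X2).
  apply: (motion_adj mq); rewrite ins_adj ac // !inE aU cU !andbT /=.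
  apply/andP; split; last by ucut uv2; ucut uv1; apply/andP; split; rewrite // eq_sym.
  by move: aX; rewrite !inE => /or3P[] /eqP->; ucut uv2; apply/andP; split; rewrite // eq_sym.
rewrite (term0 _ _ _ (zc y1 _)) ?(term0 _ _ _ (zc y2 _)) ?(term0 _ _ _ (zc y3 _)) ?inE ?eqxx ?orbT //.
by rewrite !addr0.
Qed.

(* Moving [v2] onto the line [y1 y2] singles out the edge [y1 y2]. *)
Lemma special_adjacent_line p A U v1 v2 c X1 X2 x1 x2 x3 y1 y2 y3 q q' : good p -> flat p A ->
  special p A U v1 c X1 -> special p A U v2 c X2 ->
  uniq [:: v2; x1; x2; x3] -> {subset [:: v2; x1; x2; x3] <= X1} ->
  uniq [:: v1; y1; y2; y3] -> {subset [:: v1; y1; y2; y3] <= X2} ->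
  uniq [:: x1; x2; x3; y1; y2] ->
  motion p (ins A (U :\ v1 :\ v2)) q -> motion p (ins A (U :\ v1 :\ v2)) q' ->
  stretch p y1 y2 q' != 0 -> stretch p y1 y2 q = 0 ->
  [/\ stretch p x2 x3 q = 0, stretch p x1 x3 q = 0 & stretch p x1 x2 q = 0].
Proof.
move=> gp f sp1 sp2 u1 s1 u2 s2 uxy mq mq' sq' sq; have g := good_genpos gp.
have uv1 := special_uniq sp1 u1 s1; have uv2 := special_uniq sp2 u2 s2.
pose K a b d q := stretch p a b q / (B p a b d * B p a b c).
pose Ch w q := K x2 x3 x1 q * (br (p x1) (p x3) w * br (p x1) (p x2) w)
  + K x1 x3 x2 q * (br (p x2) (p x3) w * br (p x1) (p x2) w)
  + K x1 x2 x3 q * (br (p x2) (p x3) w * br (p x1) (p x3) w).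
pose Ps w q := K y1 y2 y3 q * (br (p y1) (p y3) w * br (p y2) (p y3) w)
  + K y1 y3 y2 q * (br (p y1) (p y2) w * br (p y2) (p y3) w)
  + K y2 y3 y1 q * (br (p y1) (p y2) w * br (p y1) (p y3) w).
have [cv x1v x2v x3v] : [/\ c != v2, x1 != v2, x2 != v2 & x3 != v2].
  by ucut uv1; split; rewrite // eq_sym.
have [y1v y2v y3v] : [/\ y1 != v2, y2 != v2 & y3 != v2] by ucut uv2; split; rewrite // eq_sym.
have av : avoids (ins A (U :\ v1 :\ v2)) v2 by apply: ins_avoids; rewrite !inE eqxx.
(* The factor depends on the position of [v2] but not on the motion; comparing [q] with [q']
   eliminates it and leaves a polynomial identity, valid at every point [w]. *)
have id_w w : Ch w q * Ps w q' = Ch w q' * Ps w q.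
  pose ft t := Ch (mid (p v2) w t) q * Ps (mid (p v2) w t) q' - Ch (mid (p v2) w t) q' * Ps (mid (p v2) w t) q.
  have [gg gg0 hg] := good_move v2 w gp.
  suff ft0 : forall t, ft t = 0 by have /eqP := ft0 1; rewrite /ft mid1 subr_eq0 => /eqP.
  apply: (polyfun_cofinite _ gg0); first by rewrite /ft /Ch /Ps; polyfun_br_tac.
  move=> t /hg; set z := mid (p v2) w t; rewrite /ft -/z => gp'.
  set p' := moved p v2 z in gp'; have g' := good_genpos gp'.
  have [r hr] := special_adjacent_functional gp' (flat_good gp gp' f) (special_good gp gp' sp1)
    (special_good gp gp' sp2) u1 s1 u2 s2.
  have E0 w' mw := hr w' (iffRL (@motion_moved _ _ p v2 z _ w' av) mw).
  have Tm a b d qq : a != v2 -> b != v2 -> d != v2 -> B p' a b v2 != 0 ->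
      term p' qq a b v2 d c = K a b d qq / br (p a) (p b) z /\ br (p a) (p b) z != 0.
    move=> av2 bv2 dv2; rewrite /term /K /B /p' stretch_moved // moved_eq !moved_neq // => h; split=> //.
    by rewrite -!mulrA -!invfM; congr (_ * _^-1); ring.
  have [T1 l1] := Tm x2 x3 x1 q x2v x3v x1v ltac:(by apply: g'; ucut uv1; uniqs).
  have [T2 l2] := Tm x1 x3 x2 q x1v x3v x2v ltac:(by apply: g'; ucut uv1; uniqs).
  have [T3 l3] := Tm x1 x2 x3 q x1v x2v x3v ltac:(by apply: g'; ucut uv1; uniqs).
  have [T4 l4] := Tm y1 y2 y3 q y1v y2v y3v ltac:(by apply: g'; ucut uv2; uniqs).
  have [T5 l5] := Tm y1 y3 y2 q y1v y3v y2v ltac:(by apply: g'; ucut uv2; uniqs).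
  have [T6 l6] := Tm y2 y3 y1 q y2v y3v y1v ltac:(by apply: g'; ucut uv2; uniqs).
  have [S1 _] := Tm x2 x3 x1 q' x2v x3v x1v ltac:(by apply: g'; ucut uv1; uniqs).
  have [S2 _] := Tm x1 x3 x2 q' x1v x3v x2v ltac:(by apply: g'; ucut uv1; uniqs).
  have [S3 _] := Tm x1 x2 x3 q' x1v x2v x3v ltac:(by apply: g'; ucut uv1; uniqs).
  have [S4 _] := Tm y1 y2 y3 q' y1v y2v y3v ltac:(by apply: g'; ucut uv2; uniqs).
  have [S5 _] := Tm y1 y3 y2 q' y1v y3v y2v ltac:(by apply: g'; ucut uv2; uniqs).
  have [S6 _] := Tm y2 y3 y1 q' y2v y3v y1v ltac:(by apply: g'; ucut uv2; uniqs).
  have C1 : Ch z q = r * Ps z q / (br (p y1) (p y2) z * br (p y1) (p y3) z * br (p y2) (p y3) z)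
      * (br (p x2) (p x3) z * br (p x1) (p x3) z * br (p x1) (p x2) z).
    have := E0 q mq; rewrite T1 T2 T3 T4 T5 T6 => E1.
    rewrite (_ : Ch z q = (K x2 x3 x1 q / br (p x2) (p x3) z + K x1 x3 x2 q / br (p x1) (p x3) z
      + K x1 x2 x3 q / br (p x1) (p x2) z) * (br (p x2) (p x3) z * br (p x1) (p x3) z * br (p x1) (p x2) z)).
      by rewrite E1 /Ps; field; rewrite l4 l5 l6.
    by rewrite /Ch; field; rewrite l1 l2 l3.
  have C2 : Ch z q' = r * Ps z q' / (br (p y1) (p y2) z * br (p y1) (p y3) z * br (p y2) (p y3) z)
      * (br (p x2) (p x3) z * br (p x1) (p x3) z * br (p x1) (p x2) z).
    have := E0 q' mq'; rewrite S1 S2 S3 S4 S5 S6 => E1.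
    rewrite (_ : Ch z q' = (K x2 x3 x1 q' / br (p x2) (p x3) z + K x1 x3 x2 q' / br (p x1) (p x3) z
      + K x1 x2 x3 q' / br (p x1) (p x2) z) * (br (p x2) (p x3) z * br (p x1) (p x3) z * br (p x1) (p x2) z)).
      by rewrite E1 /Ps; field; rewrite l4 l5 l6.
    by rewrite /Ch; field; rewrite l1 l2 l3.
  by rewrite C1 C2; apply/eqP; rewrite subr_eq0; apply/eqP; ring.
(* On the line [y1 y2] only the summand of the edge [y1 y2] survives in [Ps]; it is zero for [q] and
   generically nonzero for [q']. *)
pose w := mid (p y1) (p y2).
have Kq : K y1 y2 y3 q = 0 by rewrite /K sq mul0r.
have y12 t : br (p y1) (p y2) (w t) = 0 by rewrite /w /br /mid /=; ring.
have [P1 P1n hP1] := @br_mid_neq0 _ (p y1) (p y2) (p y2) (p y3) ltac:(by apply: g; ucut uv2; uniqs).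
have Bz13 t : br (p y1) (p y3) (w t) = t * B p y1 y3 y2 by rewrite /w /B /br /mid /=; ring.
have Ch0 : forall t, Ch (w t) q = 0.
  apply: (@polyfun_cofinite _ _ ('X * P1)).
  - by rewrite /Ch /w; polyfun_br_tac.
  - by rewrite mulf_neq0 ?polyX_eq0.
  move=> t; rewrite hornerM hornerX hP1 mulf_eq0 negb_or => /andP[t0 b0].
  have := id_w (w t); rewrite /Ps Kq y12 !(mul0r, mulr0, addr0) => /eqP.
  rewrite mulf_eq0 => /orP[/eqP//|]; rewrite /K Bz13 !mulf_eq0 invr_eq0 !mulf_eq0 (negbTE sq') (negbTE t0).
  rewrite [_ (w t) == 0](negbTE b0) /=.
  have [/negbTE-> /negbTE-> /negbTE->] // : [/\ B p y1 y2 y3 != 0, B p y1 y2 c != 0 & B p y1 y3 y2 != 0].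
  by split; apply: g; ucut uv2; uniqs.
have pl x y z : uniq [:: x; y; z] -> uniq [:: y1; y2; x] ->
   br (p x) (p z) (p y1) * (br (p x) (p y) (p y2) - br (p x) (p y) (p y1))
   - (br (p x) (p z) (p y2) - br (p x) (p z) (p y1)) * br (p x) (p y) (p y1) != 0.
  move=> ux uu; rewrite (_ : _ - _ = - (B p y1 y2 x * B p x y z)); last by rewrite /B /br; ring.
  by rewrite oppr_eq0 mulf_neq0 // g.
have [||||k1 k2 k3] := @three_lines R (K x2 x3 x1 q) (K x1 x3 x2 q) (K x1 x2 x3 q)
  (br (p x2) (p x3) (p y1)) (br (p x2) (p x3) (p y2) - br (p x2) (p x3) (p y1))
  (br (p x1) (p x3) (p y1)) (br (p x1) (p x3) (p y2) - br (p x1) (p x3) (p y1))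
  (br (p x1) (p x2) (p y1)) (br (p x1) (p x2) (p y2) - br (p x1) (p x2) (p y1)).
- by move=> t; rewrite -(Ch0 t) /Ch /w !br_mid3.
- have := pl x3 x2 x1 ltac:(ucut uxy; uniqs) ltac:(ucut uxy; ucut uv2; uniqs).
  by congr (_ != 0); rewrite /br; ring.
- have := pl x2 x3 x1 ltac:(ucut uxy; uniqs) ltac:(ucut uxy; ucut uv2; uniqs); rewrite -oppr_eq0.
  by congr (_ != 0); rewrite /br; ring.
- have := pl x1 x3 x2 ltac:(ucut uxy; uniqs) ltac:(ucut uxy; ucut uv2; uniqs).
  by congr (_ != 0); rewrite /br; ring.
have K0 a b d : uniq [:: a; b; d] -> uniq [:: a; b; c] -> K a b d q = 0 -> stretch p a b q = 0.
  move=> ua ub /eqP; rewrite /K mulf_eq0 invr_eq0 mulf_eq0.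
  by rewrite (negbTE (g _ _ _ ua)) (negbTE (g _ _ _ ub)) !orbF => /eqP.
by split; [apply: K0 k1|apply: K0 k2|apply: K0 k3]; ucut uv1; uniqs.
Qed.

(** By [special_adjacent_line] the stretches of [x1 x2] and [x1 x3] vanish together with that of
    [y1 y2], hence both are multiples of one linear form. But [q3] stretches [x1 x3] and not
    [x1 x2], while [q2] stretches [x1 x2]. *)
Lemma special_not_adjacent p A U v1 v2 c X1 X2 : good p -> flat p A ->
  special p A U v1 c X1 -> special p A U v2 c X2 -> v1 != v2 -> ~~ adj A v1 v2.
Proof.
move=> gp f sp1 sp2 v12; apply/negP=> ad.
have mem v w X Y : special p A U v c X -> special p A U w c Y -> adj A v w -> w \in X.
  move=> h h'; have := special_uniq h' (s := [::]) erefl ltac:(by move=> z).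
  case: (h) => [[_ _ E _] _] u vw; case: h' => [[wU _ _ _] _].
  have : w \in nbrs A U v by rewrite inE wU.
  by rewrite E in_setU1 => /orP[/eqP wc|//]; move: u; rewrite wc /= inE eqxx.
have v2X := mem _ _ _ _ sp1 sp2 ad.
have v1X := mem _ _ _ _ sp2 sp1 ltac:(by rewrite adjC).
have trip (X : {set 'I_n}) v : v \in X -> #|X| = 4%N -> exists a b d, uniq [:: v; a; b; d] /\ {subset [:: v; a; b; d] <= X}.
  move=> vX X4; have := pick_seq (S := X :\ v) (k := 3).
  move: (cardsD1 v X); rewrite vX X4 add1n => -[<-] /(_ isT)[s [us]].
  case: s us => [|a [|b [|d []]]] // us _ h; exists a, b, d; split.
    by rewrite cons_uniq us andbT; apply/negP=> /h; rewrite !inE eqxx.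
  by move=> z; rewrite in_cons => /orP[/eqP->|/h] //; rewrite inE => /andP[].
have [x1 [x2 [x3 [u1 s1]]]] := trip X1 v2 v2X ltac:(by case: sp1 => [[]]).
have [y1 [y2 [y3 [u2 s2]]]] := trip X2 v1 v1X ltac:(by case: sp2 => [[]]).
have uv1 := special_uniq sp1 u1 s1; have uv2 := special_uniq sp2 u2 s2.
have xy x y : x \in [:: x1; x2; x3] -> y \in [:: y1; y2; y3] -> x != y.
  move=> hx hy; have xX : x \in X1 by apply: s1; rewrite inE hx orbT.
  have [_ [_ nX _]] := sp1; apply: contraNneq (nX _ _ v2X xX) => ->.
  by have [_ ->] := special_nbr sp2 (setU1r c (s2 y ltac:(by rewrite inE hy orbT))).
have uxy : uniq [:: x1; x2; x3; y1; y2].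
  have := xy; ucut u1; ucut u2 => h; rewrite /= !inE !negb_or.
  by do ![apply/andP; split] => //; apply: h; rewrite !inE eqxx ?orbT.
have [_ [_ nX1 _]] := sp1; have [_ [_ nX2 _]] := sp2.
have wit x y : x != y -> ~~ adj A x y -> exists2 q, motion p (ins A (U :\ v1 :\ v2)) q & stretch p x y q != 0.
  by move=> *; apply: ins_witness.
have [q1 m1 h1] := wit y1 y2 ltac:(ucut u2; uniqs) (nX2 _ _ (s2 y1 ltac:(by rewrite !inE eqxx ?orbT))
  (s2 y2 ltac:(by rewrite !inE eqxx ?orbT))).
have [q2 m2 h2] := wit x1 x2 ltac:(ucut u1; uniqs) (nX1 _ _ (s1 x1 ltac:(by rewrite !inE eqxx ?orbT))
  (s1 x2 ltac:(by rewrite !inE eqxx ?orbT))).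
have [[q3 [m3 z3 h3]] _] := @special_use _ _ p A U v1 c X1 x1 x2 x3 v2 gp f sp1
  ltac:(ucut u1; uniqs) ltac:(by move=> z hz; apply: s1; move: hz; rewrite !inE => /or4P[] ->; rewrite ?orbT).
have {}m3 : motion p (ins A (U :\ v1 :\ v2)) q3 by apply: motionS m3; apply: insS; apply: subsetDl.
have L q : motion p (ins A (U :\ v1 :\ v2)) q -> stretch p y1 y2 q = 0 ->
    stretch p x1 x3 q = 0 /\ stretch p x1 x2 q = 0.
  by move=> mq zq; have [_ -> ->] := special_adjacent_line gp f sp1 sp2 u1 s1 u2 s2 uxy mq m1 h1 zq.
have y3n : stretch p y1 y2 q3 != 0 by apply: contraNneq h3 => /(L _ m3)[-> _].
pose r := stretch p y1 y2 q2 / stretch p y1 y2 q3.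
have mr : motion p (ins A (U :\ v1 :\ v2)) (q2 + (- r) *: q3) by apply: motionD => //; apply: motionZ.
have [] := L _ mr; first by rewrite stretchD stretchZ mulNr /r divfK // subrr.
by move=> _; rewrite stretchD stretchZ z3 mulr0 addr0 => /eqP; rewrite (negbTE h2).
Qed.

End Exclusion.

(** * Dimension counts for spaces of motions *)

Section Subspaces.
Variables (R : fieldType) (N : nat).
Implicit Types (u w : 'rV[R]_N) (S : {set 'I_N}).

Definition subspace (Q : 'rV[R]_N -> Prop) := Q 0 /\ forall t u w, Q u -> Q w -> Q (u + t *: w).

Lemma subspace_sub (Q : 'rV[R]_N -> Prop) (m : nat) (M : 'M_(m, N)) u :
  subspace Q -> (forall i, Q (row i M)) -> (u <= M)%MS -> Q u.
Proof.
move=> [Q0 Ql] h /submxP[w ->]; rewrite mulmx_sum_row.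
by elim/big_rec: _ => [//|i x _ Qx]; rewrite addrC; apply: Ql.
Qed.

(** Motion spaces come as predicates, while dimensions are ranks of matrices. The matrix grows by a
    missing vector until nothing is missing; the rank bound [N] stops the process. *)
Lemma subspace_mx (Q : 'rV[R]_N -> Prop) : subspace Q ->
  exists M : 'M_N, forall u, (u <= M)%MS <-> Q u.
Proof.
move=> sQ; have [Q0 _] := sQ.
suff [M [QM h]] : exists M : 'M_N, (forall u, (u <= M)%MS -> Q u) /\ forall u, Q u -> (u <= M)%MS.
  by exists M => u; split; [apply: QM|apply: h].
have [k hk] : exists k, exists M : 'M_N, (forall u, (u <= M)%MS -> Q u) /\ (N - \rank M < k)%N.
  exists N.+1, 0; split; last by rewrite ltnS leq_subr.
  by move=> u; rewrite submx0 => /eqP->.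
elim: k hk => [[? []]//|k IH] [M [QM]].
rewrite ltnS => rM; have [[u [Qu /negP uM]]|no] := EM (exists u, Q u /\ ~ (u <= M)%MS).
  apply: IH; exists (M + u)%MS; split.
    move=> w /sub_addsmxP[[x y] ->]; rewrite -[X in _ + X]scale1r.
    apply: sQ.2; first by apply: QM; apply: submxMl.
    apply: (subspace_sub sQ _ (submxMl y u)) => i; by rewrite row_id.
  have lt : (\rank M < \rank (M + u))%N.
    have : (M < M + u)%MS by rewrite ltmxE addsmxSl addsmx_sub submx_refl.
    by rewrite ltmxErank => /andP[].
  have := rank_leq_col (M + u)%MS; lia.
exists M; split=> // u Qu; apply: contraT => uM; case: no; exists u; split=> //; exact/negP.
Qed.

Definition coord_mx S : 'M[R]_N := (\sum_(i in S) <<delta_mx (0 : 'I_1) i>>)%MS.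

Lemma coord_mxP S u : reflect (forall i, i \notin S -> u 0 i = 0) (u <= coord_mx S)%MS.
Proof.
apply: (iffP idP) => [/sub_sumsmxP[w ->] i iS|h].
  rewrite summxE big1 // => j jS.
  have /sub_rVP[a ->] : (w j *m <<delta_mx (0 : 'I_1) j>> <= (delta_mx 0 j : 'rV[R]_N))%MS.
    by apply: submx_trans (submxMl _ _) _; rewrite genmxE.
  by rewrite !mxE eqxx /=; case: (eqVneq i j) => [E|_]; [rewrite E jS in iS|rewrite mulr0].
rewrite (row_sum_delta u); apply: summx_sub => i _.
case: (boolP (i \in S)) => iS; last by rewrite h // scale0r sub0mx.
by apply: scalemx_sub; apply: (sumsmx_sup i) => //; rewrite genmxE.
Qed.

Lemma rank_coord_mx S : \rank (coord_mx S) = #|S|.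
Proof.
have ub S' : (\rank (coord_mx S') <= #|S'|)%N.
  apply: leq_trans (mxrank_sum_leqif _).1 _ => /=.
  by rewrite -sum1_card leq_sum // => e _; rewrite genmxE rank_leq_row.
apply/eqP; rewrite eqn_leq ub /=.
have full : (1%:M <= coord_mx S + coord_mx (~: S))%MS.
  apply/row_subP=> i; rewrite rowE mulmx1; case: (boolP (i \in S)) => iS.
    by apply: submx_trans (addsmxSl _ _); apply: (sumsmx_sup i) => //; rewrite genmxE.
  by apply: submx_trans (addsmxSr _ _); apply: (sumsmx_sup i); rewrite ?inE // genmxE.
have := mxrankS full; rewrite mxrank1 => h.
rewrite -(leq_add2r #|~: S|) cardsC card_ord; apply: leq_trans h _.
apply: leq_trans (leq_add (leqnn _) (ub (~: S))).
by rewrite -mxrank_sum_cap leq_addr.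
Qed.

End Subspaces.

Section Dual.
Variables (R : fieldType) (N : nat).

(** Rank-nullity for [phi] on [V]: the kernel contains [D], and the image contains the coordinate
    vectors indexed by [P]. *)
Lemma rank_dual (m : nat) (D V : 'M[R]_N) (phi : 'M[R]_(N, m)) (P : {set 'I_m}) :
  (D <= V)%MS -> D *m phi = 0 ->
  (forall i, i \in P -> exists2 u, (u <= V)%MS & exists2 t, t != 0 & u *m phi = t *: delta_mx (0 : 'I_1) i) ->
  (\rank D + #|P| <= \rank V)%N.
Proof.
move=> DV D0 h; rewrite -(mxrank_mul_ker V phi) addnC leq_add //; last first.
  by apply: mxrankS; rewrite sub_capmx DV; apply/sub_kermxP.
rewrite -(rank_coord_mx R P); apply: mxrankS; apply/sumsmx_subP=> i /h[u uV [t t0 E]].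
rewrite genmxE (_ : delta_mx 0 i = t^-1 *: (u *m phi)); last by rewrite E scalerA mulVf // scale1r.
by apply: scalemx_sub; apply: submxMr.
Qed.

Lemma rank_three (K V1 V2 V3 H : 'M[R]_N) :
  (V1 <= H)%MS -> (V2 <= H)%MS -> (V3 <= H)%MS ->
  (V1 :&: V2 <= K)%MS -> ((V1 + V2) :&: V3 <= K)%MS ->
  (\rank V1 + \rank V2 + \rank V3 <= \rank H + 2 * \rank K)%N.
Proof.
move=> h1 h2 h3 c12 c3.
have := mxrank_sum_cap V1 V2; have := mxrank_sum_cap (V1 + V2)%MS V3.
have := mxrankS c12; have := mxrankS c3.
have : (\rank (V1 + V2 + V3)%MS <= \rank H)%N by apply: mxrankS; rewrite !addsmx_sub h1 h2.
lia.
Qed.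

End Dual.

(** * Projective geometry of three positions of the centre *)

Section ThreePositions.
Variable R : realFieldType.
Implicit Types (a c : R * R).

(* [br a c] as a linear form in homogeneous coordinates [(s, x, y)]. *)
Definition hbr a c (s x y : R) : R := (c.1 - a.1) * (y - s * a.2) - (c.2 - a.2) * (x - s * a.1).

Lemma hbr_sum a c (z1 z2 z3 : R * R) (b1 b2 b3 : R) :
  b1 * br a c z1 + b2 * br a c z2 + b3 * br a c z3
  = hbr a c (b1 + b2 + b3) (b1 * z1.1 + b2 * z2.1 + b3 * z3.1) (b1 * z1.2 + b2 * z2.2 + b3 * z3.2).
Proof. by rewrite /hbr /br; ring. Qed.

(* The three diagonal points of a quadrangle are not collinear. *)
Lemma diagonal_points (p1 p2 p3 p4 : R * R) (s1 x1 y1 s2 x2 y2 s3 x3 y3 : R) :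
  br p1 p2 p3 != 0 -> br p1 p2 p4 != 0 -> br p1 p3 p4 != 0 -> br p2 p3 p4 != 0 ->
  hbr p1 p2 s1 x1 y1 = 0 -> hbr p3 p4 s1 x1 y1 = 0 ->
  hbr p1 p3 s2 x2 y2 = 0 -> hbr p2 p4 s2 x2 y2 = 0 ->
  hbr p1 p4 s3 x3 y3 = 0 -> hbr p2 p3 s3 x3 y3 = 0 ->
  s1 + s2 + s3 = 0 -> x1 + x2 + x3 = 0 -> y1 + y2 + y3 = 0 ->
  [/\ s1 = 0, x1 = 0 & y1 = 0] /\ [/\ s2 = 0, x2 = 0 & y2 = 0].
Proof.
move=> n1 n2 n3 n4 h1 h2 h3 h4 h5 h6 hs hx hy.
have E1 : hbr p1 p3 s1 x1 y1 * br p2 p3 p4 = hbr p2 p3 s1 x1 y1 * br p1 p3 p4.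
  have : br p1 p2 p3 * hbr p3 p4 s1 x1 y1 = hbr p2 p3 s1 x1 y1 * br p1 p3 p4 - hbr p1 p3 s1 x1 y1 * br p2 p3 p4.
    by rewrite /hbr /br; ring.
  by rewrite h2 mulr0 => /esym/eqP; rewrite subr_eq0 => /eqP.
have E2 : hbr p1 p2 s2 x2 y2 * br p2 p3 p4 = hbr p2 p3 s2 x2 y2 * br p1 p2 p4.
  have : br p1 p2 p3 * hbr p2 p4 s2 x2 y2 = hbr p2 p3 s2 x2 y2 * br p1 p2 p4 - hbr p1 p2 s2 x2 y2 * br p2 p3 p4.
    by rewrite /hbr /br; ring.
  by rewrite h4 mulr0 => /esym/eqP; rewrite subr_eq0 => /eqP.
have E3 : hbr p1 p2 s3 x3 y3 * br p1 p3 p4 = hbr p1 p3 s3 x3 y3 * br p1 p2 p4.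
  have : br p1 p2 p3 * hbr p1 p4 s3 x3 y3 = hbr p1 p3 s3 x3 y3 * br p1 p2 p4 - hbr p1 p2 s3 x3 y3 * br p1 p3 p4.
    by rewrite /hbr /br; ring.
  by rewrite h5 mulr0 => /esym/eqP; rewrite subr_eq0 => /eqP.
have S a c : hbr a c s1 x1 y1 + hbr a c s2 x2 y2 + hbr a c s3 x3 y3 = 0.
  have -> : hbr a c s1 x1 y1 + hbr a c s2 x2 y2 + hbr a c s3 x3 y3
    = hbr a c (s1 + s2 + s3) (x1 + x2 + x3) (y1 + y2 + y3) by rewrite /hbr; ring.
  by rewrite hs hx hy /hbr; ring.
have S12 := S p1 p2; have S13 := S p1 p3; have S23 := S p2 p3.
rewrite h1 add0r in S12; rewrite h3 addr0 in S13; rewrite h6 addr0 in S23.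
have Z s x y : hbr p1 p2 s x y = 0 -> hbr p1 p3 s x y = 0 -> hbr p2 p3 s x y = 0 -> [/\ s = 0, x = 0 & y = 0].
  move=> a b d.
  have s0 : s = 0.
    have : s * br p1 p2 p3 = hbr p1 p2 s x y + hbr p2 p3 s x y - hbr p1 p3 s x y by rewrite /hbr /br; ring.
    by rewrite a b d !addr0 subr0 => /eqP; rewrite mulf_eq0 (negbTE n1) orbF => /eqP.
  have x0 : x * br p1 p2 p3 = hbr p1 p2 0 x y * (p3.1 - p1.1) - hbr p1 p3 0 x y * (p2.1 - p1.1) by rewrite /hbr /br; ring.
  have y0 : y * br p1 p2 p3 = hbr p1 p2 0 x y * (p3.2 - p1.2) - hbr p1 p3 0 x y * (p2.2 - p1.2) by rewrite /hbr /br; ring.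
  move: x0 y0; rewrite -s0 a b !mul0r subr0 => /eqP + /eqP; rewrite !mulf_eq0 (negbTE n1) !orbF.
  by move=> /eqP-> /eqP->.

move: E1 E2 E3 (S12) (S13) (S23).
set u := hbr p1 p3 s1 x1 y1; set w := hbr p2 p3 s1 x1 y1; set g := hbr p1 p2 s2 x2 y2.
set k := hbr p2 p3 s2 x2 y2; set r := hbr p1 p2 s3 x3 y3; set t := hbr p1 p3 s3 x3 y3.
move=> E1 E2 E3 /eqP; rewrite addrC addr_eq0 => /eqP Er /eqP; rewrite addrC addr_eq0 => /eqP Et.
rewrite addrC => /eqP; rewrite addr_eq0 => /eqP Ek.
(* The proportionalities [E1], [E2], [E3], chained through the vanishing sums, bring [u] back to
   itself with the opposite sign; hence the factor 2. *)
have u0 : u = 0.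
  have : 2 * (u * (br p1 p2 p4 * br p2 p3 p4)) = br p2 p3 p4 * (r * br p1 p3 p4 - t * br p1 p2 p4)
    + br p1 p3 p4 * (g * br p2 p3 p4 - k * br p1 p2 p4) + br p1 p2 p4 * (u * br p2 p3 p4 - w * br p1 p3 p4).
    by rewrite Er Et Ek; ring.
  rewrite E1 E2 E3 !subrr !mulr0 !addr0 => /eqP; rewrite !mulf_eq0 pnatr_eq0 (negbTE n2) (negbTE n4) !orbF.
  by move=> /eqP.
have w0 : w = 0 by move: E1; rewrite u0 mul0r => /esym/eqP; rewrite mulf_eq0 (negbTE n3) orbF => /eqP.
have k0 : k = 0 by rewrite Ek w0 oppr0.
have g0 : g = 0 by move: E2; rewrite k0 mul0r => /eqP; rewrite mulf_eq0 (negbTE n4) orbF => /eqP.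
by split; apply: Z.
Qed.

(** The triple [b] is read as the homogeneous vector that combines [z1], [z2], [z3] with these
    weights. The hypotheses put it on the lines [p1 p2] and [p3 p4], so it represents a multiple of
    a diagonal point; likewise for [c] and [d]. As the three vectors add up to zero and diagonal
    points are not collinear, they vanish, and so do their coefficients because [z1], [z2], [z3] are
    not collinear. *)
Lemma three_positions (p1 p2 p3 p4 z1 z2 z3 : R * R) (b1 b2 b3 c1 c2 c3 d1 d2 d3 : R) :
  br p1 p2 p3 != 0 -> br p1 p2 p4 != 0 -> br p1 p3 p4 != 0 -> br p2 p3 p4 != 0 -> br z1 z2 z3 != 0 ->
  b1 + c1 + d1 = 0 -> b2 + c2 + d2 = 0 -> b3 + c3 + d3 = 0 ->
  b1 * br p1 p2 z1 + b2 * br p1 p2 z2 + b3 * br p1 p2 z3 = 0 ->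
  b1 * br p3 p4 z1 + b2 * br p3 p4 z2 + b3 * br p3 p4 z3 = 0 ->
  c1 * br p1 p3 z1 + c2 * br p1 p3 z2 + c3 * br p1 p3 z3 = 0 ->
  c1 * br p2 p4 z1 + c2 * br p2 p4 z2 + c3 * br p2 p4 z3 = 0 ->
  d1 * br p1 p4 z1 + d2 * br p1 p4 z2 + d3 * br p1 p4 z3 = 0 ->
  d1 * br p2 p3 z1 + d2 * br p2 p3 z2 + d3 * br p2 p3 z3 = 0 ->
  [/\ b1 = 0, b2 = 0 & b3 = 0] /\ [/\ c1 = 0, c2 = 0 & c3 = 0].
Proof.
move=> n1 n2 n3 n4 nz e1 e2 e3.
have O (x y z : R) : x + y + z = 0 -> z = - (x + y) by move=> /eqP; rewrite addrC addr_eq0 => /eqP.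
rewrite (O _ _ _ e1) (O _ _ _ e2) (O _ _ _ e3) !hbr_sum => h1 h2 h3 h4 h5 h6.
have [] := diagonal_points n1 n2 n3 n4 h1 h2 h3 h4 h5 h6; do ?ring.
have Z (s1 s2 s3 : R) : s1 + s2 + s3 = 0 -> s1 * z1.1 + s2 * z2.1 + s3 * z3.1 = 0 ->
    s1 * z1.2 + s2 * z2.2 + s3 * z3.2 = 0 -> [/\ s1 = 0, s2 = 0 & s3 = 0].
  move=> a b c.
  have E0 (s : R) : s * br z1 z2 z3 = 0 -> s = 0 by move=> /eqP; rewrite mulf_eq0 (negbTE nz) orbF => /eqP.
  split; apply: E0.
  + rewrite (_ : _ * _ = (s1 + s2 + s3) * (z2.1 * z3.2 - z3.1 * z2.2)
      + (s1 * z1.1 + s2 * z2.1 + s3 * z3.1) * (z2.2 - z3.2) + (s1 * z1.2 + s2 * z2.2 + s3 * z3.2) * (z3.1 - z2.1)).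
      by rewrite a b c !mul0r !addr0.
    by rewrite /br; ring.
  + rewrite (_ : _ * _ = (s1 + s2 + s3) * (z3.1 * z1.2 - z1.1 * z3.2)
      + (s1 * z1.1 + s2 * z2.1 + s3 * z3.1) * (z3.2 - z1.2) + (s1 * z1.2 + s2 * z2.2 + s3 * z3.2) * (z1.1 - z3.1)).
      by rewrite a b c !mul0r !addr0.
    by rewrite /br; ring.
  rewrite (_ : _ * _ = (s1 + s2 + s3) * (z1.1 * z2.2 - z2.1 * z1.2)
      + (s1 * z1.1 + s2 * z2.1 + s3 * z3.1) * (z1.2 - z2.2) + (s1 * z1.2 + s2 * z2.2 + s3 * z3.2) * (z2.1 - z1.1)).
    by rewrite a b c !mul0r !addr0.
  by rewrite /br; ring.
by move=> [? ? ?] [? ? ?]; split; apply: Z.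
Qed.

End ThreePositions.

(** * Balanced motions and the conic condition *)

Section BalancedQuadruples.
Variables (R : realFieldType) (n : nat).
Implicit Types (e : edge n) (F G H A : {set edge n}) (i j k l m v a b c d y : 'I_n)
  (p : 'I_n -> R * R) (q : 'M[R]_(n, 3)) (s : seq 'I_n) (U X Y : {set 'I_n}) (z w : R * R).

(** The conclusion of [special_rel] as a predicate: opposite edges carry the same normalised stretch
    and the three matchings add up to zero, which leaves two parameters. *)
Definition balanced p i j k l c q :=
  [/\ term p q k l i j c = term p q i j k l c, term p q j l i k c = term p q i k j l c,
      term p q j k i l c = term p q i l j k c &
      term p q i j k l c + term p q i k j l c + term p q i l j k c = 0].

Definition quad_zero p i j k l q :=
  [/\ stretch p i j q = 0, stretch p i k q = 0 & stretch p i l q = 0] /\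
  [/\ stretch p j k q = 0, stretch p j l q = 0 & stretch p k l q = 0].

(* The obstruction to extending [q], unstretched on the edges at [c], to the
   edges from [v] to [i], [j], [k], [c]. *)
Definition phi p i j k c v q := term p q i j k c v + term p q i k j c v + term p q j k i c v.

Lemma linform_phi p i j k c v : linform (phi p i j k c v).
Proof.
apply: linform_add (linform_term _ _ _ _ _ _); apply: linform_add; exact: linform_term.
Qed.

Lemma term_zero p i j k l m : term p 0 i j k l m = 0.
Proof. by rewrite term0 ?stretch0. Qed.

Lemma balanced0 p i j k l c : balanced p i j k l c 0.
Proof. by split; rewrite !term_zero ?addr0. Qed.

Lemma balanced_lin p i j k l c t q q' : balanced p i j k l c q -> balanced p i j k l c q' ->
  balanced p i j k l c (q + t *: q').
Proof.
move=> [a1 a2 a3 a4] [b1 b2 b3 b4]; split; rewrite !termD ?a1 ?a2 ?a3 ?b1 ?b2 ?b3 //.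
have -> (x y x' y' x'' y'' : R) : x + t * y + (x' + t * y') + (x'' + t * y'') = (x + x' + x'') + t * (y + y' + y'') by ring.
by rewrite a4 b4 mulr0 addr0.
Qed.

Lemma quad_zero_lin p i j k l t q q' : quad_zero p i j k l q -> quad_zero p i j k l q' ->
  quad_zero p i j k l (q + t *: q').
Proof.
move=> [[a1 a2 a3] [a4 a5 a6]] [[b1 b2 b3] [b4 b5 b6]].
by split; split; rewrite stretchD stretchZ ?a1 ?a2 ?a3 ?a4 ?a5 ?a6 ?b1 ?b2 ?b3 ?b4 ?b5 ?b6 mulr0 addr0.
Qed.

Lemma quad_zero_balanced p p' i j k l c q : quad_zero p i j k l q ->
  (forall a b, a \in [:: i; j; k; l] -> b \in [:: i; j; k; l] -> stretch p' a b q = stretch p a b q) ->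
  balanced p' i j k l c q.
Proof.
move=> [[a1 a2 a3] [a4 a5 a6]] E.
by split; rewrite ?(term0 (p := p')) ?addr0 // E ?inE ?eqxx ?orbT.
Qed.

Lemma term_moved p v z q i j k l m : uniq [:: v; i; j; k; l; m] ->
  term (moved p v z) q i j k l m = term p q i j k l m.
Proof.
move=> u; have [a1 a2 a3 [a4 a5]] : [/\ i != v, j != v, k != v & l != v /\ m != v].
  by ucut u; split; last split; rewrite // eq_sym.
by rewrite /term /B stretch_moved // !moved_neq.
Qed.

Lemma balanced_moved p v z i j k l c q : uniq [:: v; i; j; k; l; c] ->
  balanced (moved p v z) i j k l c q <-> balanced p i j k l c q.
Proof.
by move=> u; rewrite /balanced !term_moved //; ucut u; uniqs.
Qed.

Lemma phi_moved p v z i j k c u q : uniq [:: v; i; j; k; c; u] ->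
  phi (moved p v z) i j k c u q = phi p i j k c u q.
Proof. by move=> h; rewrite /phi !term_moved //; ucut h; uniqs. Qed.

Lemma phi_quad_zero p i j k l c v q : quad_zero p i j k l q -> phi p i j k c v q = 0.
Proof. by move=> [[a1 a2 _] [a4 _ _]]; rewrite /phi !term0 ?addr0. Qed.

Lemma phi_motion p i j k c v q : genpos p -> uniq [:: i; j; k; c; v] ->
  (forall x, x \in [:: i; j; k; v] -> stretch p x c q = 0) ->
  (forall x, x \in [:: i; j; k] -> stretch p x v q = 0) -> phi p i j k c v q = 0.
Proof.
move=> g u hc hv; have K := @K5_rel _ _ p q i j k c v.
do 10! (specialize (K ltac:(apply: g; ucut u; uniqs))).
have z x y : stretch p y x q = 0 -> stretch p x y q = 0 by move=> h; rewrite stretchC h oppr0.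
move: K; rewrite (@term0 _ _ p q i c) ?(@term0 _ _ p q i v) ?(@term0 _ _ p q j c) ?(@term0 _ _ p q j v).
  rewrite ?(@term0 _ _ p q k c) ?(@term0 _ _ p q k v) ?(@term0 _ _ p q c v) ?addr0 ?addrA //.
  - by rewrite z // hc // !inE eqxx ?orbT.
  - by rewrite hv // !inE eqxx ?orbT.
  - by rewrite hc // !inE eqxx ?orbT.
all: by rewrite ?hc ?hv // !inE eqxx ?orbT.
Qed.

(** For a balanced motion [phi = 0] fixes the ratio of its two parameters by means of
    [B p i j v * B p k l v] and [B p i k v * B p j l v]. The quotient of these products is constant
    along each conic of the pencil through [i], [j], [k], [l]. *)
Lemma phi_conic p i j k l c v q : genpos p -> uniq [:: i; j; k; l; c; v] ->
  balanced p i j k l c q -> phi p i j k c v q = 0 ->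
  term p q i j k l c * (B p i k v * B p j l v) = - (term p q i k j l c * (B p i j v * B p k l v)).
Proof.
move=> g u [b1 b2 b3 b4]; rewrite /phi.
have G x y t : uniq [:: x; y; t] -> B p x y t != 0 by apply: g.
have T x y t t' : B p x y t' != 0 -> B p x y c != 0 -> B p x y v != 0 -> B p x y t != 0 -> 
    term p q x y t c v = term p q x y t t' c * B p x y t' / B p x y v.
  by move=> n1 n2 n3 n4; rewrite /term; field; rewrite n1 n2 n3 n4.
rewrite (T i j k l) ?(T i k j l) ?(T j k i l); try by apply: G; ucut u; uniqs.
rewrite b3; have -> : term p q i l j k c = - (term p q i j k l c + term p q i k j l c).
  by apply/eqP; rewrite -addr_eq0 addrC b4.
set x := term p q i j k l c; set y := term p q i k j l c.
have [n1 n2 n3] : [/\ B p i j v != 0, B p i k v != 0 & B p j k v != 0] by split; apply: G; ucut u; uniqs.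
have n4 : B p i j k != 0 by apply: G; ucut u; uniqs.
move=> E; have {E} : x * B p i j l * B p i k v * B p j k v + y * B p i k l * B p i j v * B p j k v
   - (x + y) * B p j k l * B p i j v * B p i k v = 0.
  rewrite -[RHS](mul0r (B p i j v * B p i k v * B p j k v)) -E; field; by rewrite n1 n2 n3.
have -> : x * B p i j l * B p i k v * B p j k v + y * B p i k l * B p i j v * B p j k v
   - (x + y) * B p j k l * B p i j v * B p i k v
   = B p i j k * (x * (B p i k v * B p j l v) - - (y * (B p i j v * B p k l v))).
  by rewrite /B /br; ring.
by move=> /eqP; rewrite mulf_eq0 (negbTE n4) subr_eq0 => /eqP.
Qed.

(** The stretch of an edge [x y] of the quadruple is independent of [c]; it equals the normalised
    stretch times the bracket of [x], [y] and the position of [c], up to fixed factors. So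
    [q1 + q2 + q3 = 0] becomes the system of [three_positions]. *)
Lemma balanced_three p i j k l c z1 z2 z3 q1 q2 q3 : uniq [:: i; j; k; l; c] ->
  br z1 z2 z3 != 0 -> genpos (moved p c z1) -> genpos (moved p c z2) -> genpos (moved p c z3) ->
  balanced (moved p c z1) i j k l c q1 -> balanced (moved p c z2) i j k l c q2 ->
  balanced (moved p c z3) i j k l c q3 -> q1 + q2 + q3 = 0 ->
  [/\ quad_zero p i j k l q1, quad_zero p i j k l q2 & quad_zero p i j k l q3].
Proof.
move=> u nz g1 g2 g3 B1 B2 B3 q0.
have [ic jc kc lc] : [/\ i != c, j != c, k != c & l != c] by ucut u; split.
have Bg x y t : uniq [:: x; y; t] -> x != c -> y != c -> t != c -> B p x y t != 0.
  by move=> ux xc yc tc; have := g1 x y t ux; rewrite /B !moved_neq.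
pose D z x y t t' := B p x y t * B p x y t' * br (p x) (p y) z.
have S z q x y t t' : genpos (moved p c z) -> uniq [:: x; y; t; t'; c] ->
    stretch p x y q = term (moved p c z) q x y t t' c * D z x y t t'.
  move=> g ux; have [xc yc tc tc'] : [/\ x != c, y != c, t != c & t' != c] by ucut ux; split.
  have := g x y c ltac:(ucut ux; uniqs); rewrite /term /D /B moved_eq !moved_neq // stretch_moved // => nzz.
  rewrite divfK // !mulf_neq0 //; [apply: (Bg x y t)|apply: (Bg x y t')] => //; ucut ux; uniqs.
have Z x y t t' : uniq [:: x; y; t; t'; c] ->
    term (moved p c z1) q1 x y t t' c * br (p x) (p y) z1 + term (moved p c z2) q2 x y t t' c * br (p x) (p y) z2
    + term (moved p c z3) q3 x y t t' c * br (p x) (p y) z3 = 0.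
  move=> ux; have [xc yc tc tc'] : [/\ x != c, y != c, t != c & t' != c] by ucut ux; split.
  have n1 : B p x y t != 0 by apply: Bg => //; ucut ux; uniqs.
  have n2 : B p x y t' != 0 by apply: Bg => //; ucut ux; uniqs.
  have := stretch0 p x y; rewrite -q0 !stretchD (S z1 q1 x y t t') // (S z2 q2 x y t t') // (S z3 q3 x y t t') //.
  rewrite /D => E; apply/eqP; rewrite -(mulIr_eq0 _ (mulIf (mulf_neq0 n1 n2))); apply/eqP.
  by rewrite -[RHS]E; ring.
have Zs x y t t' (a1 a2 a3 : R) : uniq [:: x; y; t; t'; c] -> term (moved p c z1) q1 x y t t' c = a1 ->
    term (moved p c z2) q2 x y t t' c = a2 -> term (moved p c z3) q3 x y t t' c = a3 ->
    a1 * br (p x) (p y) z1 + a2 * br (p x) (p y) z2 + a3 * br (p x) (p y) z3 = 0.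
  by move=> ux <- <- <-; apply: Z.
have [a1 a2 a3 a4] := B1; have [b1 b2 b3 b4] := B2; have [c1 c2 c3 c4] := B3.
have [] := three_positions _ _ _ _ nz a4 b4 c4 (Z i j k l _) (Zs k l i j _ _ _ _ a1 b1 c1)
   (Z i k j l _) (Zs j l i k _ _ _ _ a2 b2 c2) (Z i l j k _) (Zs j k i l _ _ _ _ a3 b3 c3);
   try by [apply: Bg => //; ucut u; uniqs | ucut u; uniqs].
move=> [x1 x2 x3] [y1 y2 y3].
have fin z q : genpos (moved p c z) -> balanced (moved p c z) i j k l c q ->
    term (moved p c z) q i j k l c = 0 -> term (moved p c z) q i k j l c = 0 -> quad_zero p i j k l q.
  move=> g [d1 d2 d3 d4] e1 e2; move: d4; rewrite e1 e2 !add0r => e3.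
  rewrite e1 in d1; rewrite e2 in d2; rewrite e3 in d3.
  have W x y t t' : uniq [:: x; y; t; t'; c] -> term (moved p c z) q x y t t' c = 0 -> stretch p x y q = 0.
    by move=> ux e; rewrite (S z q x y t t') // e mul0r.
  by split; split; [apply: W e1|apply: W e2|apply: W e3|apply: W d3|apply: W d2|apply: W d1]; ucut u; uniqs.
by split; [apply: fin B1 x1 y1|apply: fin B2 x2 y2|apply: fin B3 x3 y3].
Qed.

(* The inequality says that [w] is off the conic through [i], [j], [k], [l], [v]. *)
Lemma off_conic p v i j k l : good p -> uniq [:: v; i; j; k; l] ->
  exists w, good (moved p v w) /\
    br (p i) (p k) w * br (p j) (p l) w * (B p i j v * B p k l v)
    - B p i k v * B p j l v * (br (p i) (p j) w * br (p k) (p l) w) != 0.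
Proof.
move=> gp u; have g := good_genpos gp.
(* The line [i j] meets the conic only in [i] and [j], so the midpoint is off it; this persists at a
   generic point of the line from [v] to the midpoint. *)
pose w0 := mid (p i) (p j) 2^-1.
pose C w := br (p i) (p k) w * br (p j) (p l) w * (B p i j v * B p k l v)
    - B p i k v * B p j l v * (br (p i) (p j) w * br (p k) (p l) w).
have [P hP] : polyfun (fun t => C (mid (p v) w0 t)) by rewrite /C; polyfun_br_tac.
have C0 : C w0 != 0.
  have -> : C w0 = - (B p i j k * B p i j l * (B p i j v * B p k l v)) / 4.
    by rewrite /C /w0 /B /br /mid /=; field.
  rewrite mulNr oppr_eq0 mulf_neq0 ?invr_eq0 ?pnatr_eq0 //.
  by rewrite !mulf_neq0 //; apply: g; ucut u; uniqs.
have Pn : P != 0.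
  apply: contraNneq C0 => P0; have := hP 1; rewrite P0 horner0 mid1 => <-; exact: eqxx.
have [gg gn hg] := good_move v w0 gp.
have [t] := poly_pick (mulf_neq0 gn Pn); rewrite hornerM mulf_eq0 negb_or => /andP[/hg h1 h2] _.
by exists (mid (p v) w0 t); split=> //; rewrite -/(C _) -hP.
Qed.

End BalancedQuadruples.

Section MotionSpaces.
Variables (R : realFieldType) (n : nat).
Implicit Types (e : edge n) (F G H A : {set edge n}) (i j k l m v a b c d y : 'I_n)
  (p : 'I_n -> R * R) (q : 'M[R]_(n, 3)) (s : seq 'I_n) (U X Y : {set 'I_n}) (z w : R * R).

Lemma motion_subspace (Q : 'M[R]_(n, 3) -> Prop) :
  Q 0 -> (forall t q q', Q q -> Q q' -> Q (q + t *: q')) ->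
  exists M : 'M_(n * 3), forall q, (mxvec q <= M)%MS <-> Q q.
Proof.
move=> Q0 Ql; have [|M hM] := @subspace_mx R (n * 3) (fun u => Q (vec_mx u)).
  by split=> [|t u w hu hw]; rewrite ?linear0 // linearD linearZ; apply: Ql.
by exists M => q; rewrite hM mxvecK.
Qed.

Lemma submx_pred (M M' : 'M[R]_(n * 3)) : 
  (forall q, (mxvec q <= M)%MS -> (mxvec q <= M')%MS) -> (M <= M')%MS.
Proof. by move=> h; apply/row_subP=> i; rewrite -[row i M]vec_mxK h // vec_mxK row_sub. Qed.

Lemma rank_motions p F (M : 'M[R]_(n * 3)) : (forall q, (mxvec q <= M)%MS <-> motion p F q) ->
  (\rank M + rk p F = n * 3)%N.
Proof.
move=> hM; have -> : \rank M = \rank (kermx (Sp p F)^T).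
  apply: eqmx_rank; apply/andP; split; apply: submx_pred => q.
    move=> /hM mq; apply/sub_kermxP; apply: trmx_inj; rewrite trmx_mul trmxK trmx0.
    by apply/row_matrixP=> i; rewrite row_mul row0 (Sp_dot mq) // row_sub.
  move=> /sub_kermxP h; apply/hM => e eF.
  have /submxP[D hD] : (rw p e <= Sp p F)%MS by apply: clos_in.
  have := rw_dot p e q; rewrite hD -mulmxA -[Sp p F]trmxK -trmx_mul h trmx0 mulmx0.
  by move=> /matrixP/(_ 0 0); rewrite !mxE eqxx mulr1n.
by rewrite mxrank_ker mxrank_tr rkE subnK // rank_leq_col.
Qed.

Lemma linform_big (L : 'M[R]_(n, 3) -> R) (I : finType) (x : I -> R) (w : I -> 'M[R]_(n, 3)) :
  linform L -> L (\sum_i x i *: w i) = \sum_i x i * L (w i).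
Proof.
move=> lL; have L0 : L 0 = 0.
  have := lL 1 0 0; rewrite scale1r addr0 mul1r => /eqP.
  by rewrite -subr_eq0 opprD addNKr oppr_eq0 => /eqP.
by elim/big_rec2: _ => // i y1 y2 _ <-; rewrite addrC lL addrC.
Qed.

Definition forms (m : nat) (L : 'I_m -> 'M[R]_(n, 3) -> R) : 'M[R]_(n * 3, m) :=
  \matrix_(i, t) L t (vec_mx (delta_mx 0 i)).

Lemma formsE (m : nat) (L : 'I_m -> 'M[R]_(n, 3) -> R) q : (forall t, linform (L t)) ->
  mxvec q *m forms L = \row_t L t q.
Proof.
move=> lL; apply/rowP=> t; rewrite !mxE -[in RHS](mxvecK q) [in RHS](row_sum_delta (mxvec q)) linear_sum.
rewrite (eq_bigr (fun r => mxvec q 0 r *: vec_mx (delta_mx 0 r))); last by move=> r _; rewrite linearZ.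
by rewrite linform_big //; apply: eq_bigr => r _; rewrite mxE.
Qed.

Lemma three_directions p q v x y t : genpos p -> uniq [:: v; x; y; t] ->
  evq q v (dv p v x) = 0 -> evq q v (dv p v y) = 0 -> evq q v (dv p v t) = 0 ->
  forall k : 'I_3, q v k = 0.
Proof.
move=> g u h1 h2 h3.
have E dd : evq q v dd = 0.
  have := lagrange4 (q v o0) (q v o1) (q v o2) (dv p v x) (dv p v y) (dv p v t) dd.
  rewrite /= -/(evq q v (dv p v x)) -/(evq q v (dv p v y)) -/(evq q v (dv p v t)) -/(evq q v dd) h1 h2 h3 !mul0r subrr !add0r => /eqP.
  rewrite -/(wd p v x y) -/(wd p v x t) -/(wd p v y t) !wdE oppr_eq0 !mulf_eq0.
  have [/negbTE-> /negbTE-> /negbTE->] : [/\ B p v x y != 0, B p v x t != 0 & B p v y t != 0].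
    by split; apply: g; ucut u; uniqs.
  by rewrite !orbF => /eqP.
have := E (1, 0); have := E (0, 1); have := E (1, 1).
rewrite /evq /= !(expr0n, expr1n, mulr0, mul0r, mulr1, addr0, add0r) => e1 e2 e3.
rewrite e2 e3 addr0 add0r in e1 => k.
by case: k => [[|[|[|//]]] hk]; [rewrite -e3|rewrite -e1|rewrite -e2]; congr (q v _); apply: val_inj.
Qed.

End MotionSpaces.

(** * Lower bound for the star of a centre *)

Section CentreBound.
Variables (R : realFieldType) (n : nat).
Implicit Types (e : edge n) (F G H : {set edge n}) (i j k l m v y : 'I_n)
  (q : 'M[R]_(n, 3)) (s : seq 'I_n) (Y : {set 'I_n}) (z w : R * R).
Variables (p : 'I_n -> R * R) (A : {set edge n}) (U P : {set 'I_n}) (c : 'I_n)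
  (X : 'I_n -> {set 'I_n}) (a b d e : 'I_n -> 'I_n).
Hypotheses (gp : good p) (fl : flat p A) (cU : c \in U).
Hypothesis sp : forall v, v \in P -> special p A U v c (X v).
Hypothesis quad : forall v, v \in P ->
  uniq [:: a v; b v; d v; e v] /\ {subset [:: a v; b v; d v; e v] <= X v}.

Let W := U :\: (c |: P).
Let H0 := ins A W.

Lemma quad_uniq v : v \in P -> uniq [:: v; c; a v; b v; d v; e v].
Proof. by move=> vP; have [u s] := quad vP; apply: (special_uniq (sp vP)). Qed.

Lemma quad_in v y : v \in P -> y \in [:: a v; b v; d v; e v] -> y \in W /\ adj A v y.
Proof.
move=> vP yq; have [u s] := quad vP; have yX := s _ yq.
have [yU vy] := special_nbr (sp vP) (setU1r c yX).
split=> //; rewrite !inE yU andbT negb_or; apply/andP; split.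
  by apply: contraNneq (_ : c \notin X v) => [<-//|]; case: (sp vP) => [[]].
apply/negP=> yP; have := special_not_adjacent gp fl (sp vP) (sp yP) (adj_neq vy).
by rewrite vy.
Qed.

Lemma quad_neq u v y : u \in P -> v \in P -> y \in [:: a u; b u; d u; e u] -> y != v /\ y != c.
Proof.
move=> uP vP /(quad_in uP)[+ _]; rewrite !inE negb_or => /andP[/andP[yc yP] _].
by split=> //; apply: contraNneq yP => ->.
Qed.

Lemma P_neq v : v \in P -> v != c.
Proof. by move=> /quad_uniq u; ucut u. Qed.

Lemma W_avoids v : v \in c |: P -> avoids H0 v.
Proof. by move=> h; apply: ins_avoids; rewrite inE h. Qed.

(** The graph [H0] omits [c] and [P], so the position [z] enters only through the normalisation in
    [balanced]. *)
Definition balanced_motion z q := motion p H0 q /\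
  forall v, v \in P -> balanced (moved p c z) (a v) (b v) (d v) (e v) c q.
Definition flat_quad_motion q := motion p H0 q /\ forall v, v \in P -> quad_zero p (a v) (b v) (d v) (e v) q.
Definition full_motion z q := motion (moved p c z) (ins A U) q.
Definition phi_at_pos z v q := phi (moved p c z) (a v) (b v) (d v) c v q.

Lemma H0_moved z q : motion (moved p c z) H0 q <-> motion p H0 q.
Proof. by apply: motion_moved; apply: W_avoids; rewrite setU11. Qed.

Lemma flat_quad_balanced z q : flat_quad_motion q -> balanced_motion z q.
Proof.
move=> [mq zq]; split=> // v vP; apply: quad_zero_balanced (zq v vP) _ => x y hx hy.
have [_ xc] := quad_neq vP vP hx; have [_ yc] := quad_neq vP vP hy.
by rewrite stretch_moved.
Qed.

Section Position.
Variable z : R * R.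
Hypothesis gz : good (moved p c z).

Lemma full_balanced q : full_motion z q -> balanced_motion z q.
Proof.
move=> mq; split.
  by apply/(H0_moved z); apply: motionS mq; apply: insS; apply: subsetDl.
move=> v vP; have [u s] := quad vP.
have [_ h] := special_use gz (flat_good gp gz fl) (special_good gp gz (sp vP)) u s.
by apply: h; apply: motionS mq; apply: insS; apply: subsetDl.
Qed.

Lemma phi_at p' v q : genpos p' -> v \in P -> motion p' (ins A U) q ->
  phi p' (a v) (b v) (d v) c v q = 0.
Proof.
move=> g vP mq; have [u s] := quad vP; have uv := quad_uniq vP.
have adjm x y : adj A x y -> x \in U -> y \in U -> stretch p' x y q = 0.
  by move=> xy xU yU; apply: (motion_adj mq); rewrite ins_adj xy xU.
have inU y : y \in [:: a v; b v; d v; e v] -> y \in U.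
  by move=> /(quad_in vP)[+ _]; rewrite inE => /andP[].
have [[vU _ _ _] [ac _ _]] := sp vP.
have sub y : y \in [:: a v; b v; d v] -> y \in [:: a v; b v; d v; e v].
  by rewrite !inE => /or3P[] ->; rewrite ?orbT.
apply: phi_motion => //; first by ucut uv; uniqs.
  move=> x; rewrite -[[:: a v; b v; d v; v]]/([:: a v; b v; d v] ++ [:: v]) mem_cat => /orP[/sub xq|].
    by apply: adjm => //; [apply: ac; apply: s|apply: inU].
  rewrite mem_seq1 => /eqP->; apply: adjm => //.
  by have [_] := special_nbr (sp vP) (setU11 c _).
move=> x /sub xq; apply: adjm => //; last exact: inU.
by have [_] := quad_in vP xq; rewrite adjC.
Qed.

Lemma phi_Z v q : v \in P -> full_motion z q -> phi_at_pos z v q = 0.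
Proof. by move=> vP mq; apply: phi_at => //; apply: good_genpos. Qed.

Lemma phi_K v q : v \in P -> flat_quad_motion q -> phi_at_pos z v q = 0.
Proof.
move=> vP [_ zq]; have uv := quad_uniq vP.
apply: (@phi_quad_zero _ _ _ _ _ _ (e v)).
have [[h1 h2 h3] [h4 h5 h6]] := zq v vP.
have N y : y \in [:: a v; b v; d v; e v] -> y != c by case/(quad_neq vP vP).
by split; split; rewrite stretch_moved // N // !inE eqxx ?orbT.
Qed.

(** Move [v] off the conic and take a full motion there that stretches [a v], [b v]. Its balance
    does not involve the position of [v], nor do the obstructions at the other special vertices. At
    [v] itself the obstruction vanishes for the new position, so its vanishing for the old one would
    put both positions on one conic. *)
Lemma dual_vector v : v \in P -> exists q, [/\ balanced_motion z q, phi_at_pos z v q != 0 &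
  forall u, u \in P -> u != v -> phi_at_pos z u q = 0].
Proof.
move=> vP; have uv := quad_uniq vP; have vc := P_neq vP.
pose p1 := moved p c z; have gz1 : good p1 := gz.
have [w [g2 cw]] := off_conic gz1 (v := v) (i := a v) (j := b v) (k := d v) (l := e v) ltac:(by ucut uv; uniqs).
set p2 := moved p1 v w in g2.
have f2 := flat_good gp g2 fl; have g1 := good_genpos gz1; have gg2 := good_genpos g2.
have [_ sX] := quad vP; have [_ [_ nX _]] := sp vP.
have nab : ~~ adj A (a v) (b v) by apply: nX; apply: sX; rewrite !inE eqxx ?orbT.
have [q mq sq] := ins_witness U f2 (i := a v) (j := b v) ltac:(by ucut uv) nab.
have bal u : u \in P -> balanced p1 (a u) (b u) (d u) (e u) c q.
  move=> uP; have [uu su] := quad uP.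
  have [_ h] := special_use g2 f2 (special_good gp g2 (sp uP)) uu su.
  apply/(@balanced_moved _ _ p1 v w); last first.
    by apply: h; apply: motionS mq; apply: insS; apply: subsetDl.
  have N y : y \in [:: a u; b u; d u; e u] -> v != y.
    by move=> hy; have [] := quad_neq uP vP hy; rewrite eq_sym.
  have [n1 n2 n3 n4] : [/\ v != a u, v != b u, v != d u & v != e u].
    by split; apply: N; rewrite !inE eqxx ?orbT.
  by have uu' := quad_uniq uP; ucut uu'; uniqs.
exists q; split.
- split=> //; apply/(H0_moved z); apply/(@motion_moved _ _ p1 v w).
    by apply: W_avoids; rewrite setU1r.
  by apply: motionS mq; apply: insS; apply: subsetDl.
- apply/negP=> /eqP ph1.
  have ph2 : phi p2 (a v) (b v) (d v) c v q = 0 by apply: phi_at.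
  have E1 := @phi_conic _ _ p1 (a v) (b v) (d v) (e v) c v q g1 ltac:(by ucut uv; uniqs) (bal v vP) ph1.
  have b2 : balanced p2 (a v) (b v) (d v) (e v) c q by apply/(@balanced_moved _ _ p1 v w) => //; [ucut uv; uniqs|apply: bal].
  have E2 := @phi_conic _ _ p2 (a v) (b v) (d v) (e v) c v q gg2 ltac:(by ucut uv; uniqs) b2 ph2.
  rewrite /p2 (@term_moved _ _ p1 v w q (a v) (b v) (d v) (e v) c) in E2; last by ucut uv; uniqs.
  rewrite (@term_moved _ _ p1 v w q (a v) (d v) (b v) (e v) c) in E2; last by ucut uv; uniqs.
  have Bw x y : x != v -> y != v -> B (moved p1 v w) x y v = br (p1 x) (p1 y) w.
    by move=> xv yv; rewrite /B moved_eq !moved_neq.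
  have [n1 n2 n3 n4] : [/\ a v != v, b v != v, d v != v & e v != v] by ucut uv; split; rewrite eq_sym.
  rewrite !Bw // in E2.
  have b0 : term p1 q (a v) (b v) (d v) (e v) c != 0.
    rewrite term_eq0 //; last by ucut uv; uniqs.
    by move: sq; rewrite /p2 stretch_moved.
  have : term p1 q (a v) (b v) (d v) (e v) c * (br (p1 (a v)) (p1 (d v)) w * br (p1 (b v)) (p1 (e v)) w *
      (B p1 (a v) (b v) v * B p1 (d v) (e v) v) -
      B p1 (a v) (d v) v * B p1 (b v) (e v) v * (br (p1 (a v)) (p1 (b v)) w * br (p1 (d v)) (p1 (e v)) w)) = 0.
    have comb (t x y x' y' r : R) : t * x = - (r * y') -> t * x' = - (r * y) -> t * (x * y - x' * y') = 0.
      move=> h1 h2; have -> : t * (x * y - x' * y') = t * x * y - t * x' * y' by ring.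
      by rewrite h1 h2; ring.
    exact: comb E2 E1.
  by move=> /eqP; rewrite mulf_eq0 (negbTE b0) (negbTE cw).
move=> u uP nuv; have <- : phi p2 (a u) (b u) (d u) c u q = phi_at_pos z u q.
  apply: phi_moved; have N y : y \in [:: a u; b u; d u; e u] -> v != y.
    by move=> hy; have [] := quad_neq uP vP hy; rewrite eq_sym.
  have [n1 n2 n3] : [/\ v != a u, v != b u & v != d u] by split; apply: N; rewrite !inE eqxx ?orbT.
  by have uu' := quad_uniq uP; ucut uu'; uniqs.
exact: phi_at.
Qed.

Definition phimx : 'M[R]_(n * 3, n) := forms (fun v q => if v \in P then phi_at_pos z v q else 0).

Lemma phimxE q : mxvec q *m phimx = \row_v (if v \in P then phi_at_pos z v q else 0).
Proof.
rewrite /phimx formsE // => v; case: (v \in P); first exact: linform_phi.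
by move=> t q1 q2; rewrite mulr0 addr0.
Qed.

Lemma motion_lin p' F t q q' : motion p' F q -> motion p' F q' -> motion p' F (q + t *: q').
Proof. by move=> h h'; apply: motionD => //; apply: motionZ. Qed.

(** All obstructions vanish on full motions and on motions flat on the quadruples, so [rank_dual]
    adds [#|P|] to the span of both. For the first bound, some full motion stretches a quadruple.
    For the second, the forms supported on [c] and [P] are flat on the quadruples and meet the full
    motions only in 0, since each of these vertices has three neighbours in [W]; they contribute
    [3 * (#|P| + 1)]. *)
Lemma position_rank (MK : 'M[R]_(n * 3)) : (forall q, (mxvec q <= MK)%MS <-> flat_quad_motion q) -> (0 < #|P|)%N ->
  exists2 MV : 'M[R]_(n * 3), forall q, (mxvec q <= MV)%MS <-> balanced_motion z q &
   (\rank MK + 1 + #|P| <= \rank MV)%N /\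
   (n * 3 + 3 * (#|P| + 1) + #|P| <= \rank MV + rk p (ins A U))%N.
Proof.
move=> hK P0.
have [|t q q' [m1 v1] [m2 v2]|MV hV] := @motion_subspace R n (balanced_motion z).
- by split=> [|v vP]; [apply: motion0|apply: balanced0].
- by split=> [|v vP]; [apply: motion_lin|apply: balanced_lin; [apply: v1|apply: v2]].
have [|t q q' h1 h2|MZ hZ] := @motion_subspace R n (full_motion z); [exact: motion0|exact: motion_lin|].
exists MV => //.
have rZ := rank_motions hZ; rewrite -(good_rk _ gp gz) in rZ.
have DV : (MZ + MK <= MV)%MS.
  rewrite addsmx_sub; apply/andP; split; apply: submx_pred => q.
    by move=> /hZ h; apply/hV; apply: full_balanced.
  by move=> /hK h; apply/hV; apply: flat_quad_balanced.
have D0 : (MZ + MK)%MS *m phimx = 0.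
  apply/sub_kermxP; rewrite addsmx_sub; apply/andP; split; apply: submx_pred => q.
    move=> /hZ h; apply/sub_kermxP; rewrite phimxE; apply/rowP=> v; rewrite !mxE.
    by case: ifP => // vP; apply: phi_Z.
  move=> /hK h; apply/sub_kermxP; rewrite phimxE; apply/rowP=> v; rewrite !mxE.
  by case: ifP => // vP; apply: phi_K.
have DP := rank_dual (P := P) DV D0.
have {}DP : (\rank (MZ + MK)%MS + #|P| <= \rank MV)%N.
  apply: DP => v vP; have [q [h1 h2 h3]] := dual_vector vP.
  exists (mxvec q); first exact/hV.
  exists (phi_at_pos z v q) => //; rewrite phimxE; apply/rowP=> u; rewrite !mxE eqxx /=.
  case: (eqVneq u v) => [->|uv]; first by rewrite vP mulr1.
  by rewrite mulr0; case: ifP => // uP; apply: h3.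
have /card_gt0P[v vP] := P0; have uv := quad_uniq vP.
have [_ sX] := quad vP; have [_ [_ nX _]] := sp vP.
have nab : ~~ adj A (a v) (b v) by apply: nX; apply: sX; rewrite !inE eqxx ?orbT.
have lt : (\rank MK < \rank (MZ + MK)%MS)%N.
  have : (MK < MZ + MK)%MS.
    rewrite ltmxE addsmxSr addsmx_sub submx_refl andbT; apply/negP=> sub.
    have [q mq sq] := ins_witness U (flat_good gp gz fl) (i := a v) (j := b v) ltac:(by ucut uv) nab.
    have /hK[_ /(_ v vP)[[h _ _] _]] : (mxvec q <= MK)%MS by apply: submx_trans sub; apply/hZ.
    move: sq; rewrite stretch_moved ?h ?eqxx //; ucut uv; rewrite // eq_sym //.
  by rewrite ltmxErank => /andP[].
split; first by move: DP lt; clear; lia.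
pose S := [set mxvec_index x.1 x.2 | x in setX (c |: P) [set: 'I_3]].
have inj : injective (fun x : 'I_n * 'I_3 => mxvec_index x.1 x.2).
  by move=> [i t] [i' t'] /= /cast_ord_inj/enum_rank_inj.
have cS : #|S| = (3 * (#|P| + 1))%N.
  rewrite card_imset // cardsX cardsT card_ord cardsU1 mulnC.
  by case: (boolP (c \in P)) => [/P_neq|_]; rewrite ?eqxx // addnC.
have mS i t : (mxvec_index i t \in S) = (i \in c |: P).
  by apply: etrans (mem_imset _ (i, t) inj) _; rewrite !inE andbT.
have FS q : (mxvec q <= coord_mx R S)%MS -> forall y, y \notin c |: P -> forall t, q y t = 0.
  by move=> /coord_mxP h y yW t; rewrite -(mxvecE q); apply: h; rewrite mS.
have WS y : y \in W -> y \notin c |: P by rewrite inE => /andP[].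
have st0 p' x y q : (forall t, q x t = 0) -> (forall t, q y t = 0) -> stretch p' x y q = 0.
  by move=> hx hy; rewrite /stretch /evq !hx !hy !mul0r !addr0 subrr.
have FK : (coord_mx R S <= MK)%MS.
  apply: submx_pred => q /FS h; apply/hK; split.
    by apply: motionP => x y; rewrite ins_adj => /and3P[_ xW yW]; apply: st0; apply: h; apply: WS.
  move=> u uP; have N y : y \in [:: a u; b u; d u; e u] -> forall t, q y t = 0.
    by case/(quad_in uP) => yW _; apply: h; apply: WS.
  by split; split; apply: st0; apply: N; rewrite !inE eqxx ?orbT.
have gz' := good_genpos gz.
have cap : (MZ :&: coord_mx R S)%MS = 0.
  apply/eqP; rewrite -submx0; apply: submx_pred => q; rewrite sub_capmx => /andP[/hZ mq /FS h].
  suff q0 : q = 0 by rewrite q0 linear0 sub0mx.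
  have star y x1 x2 x3 : y \in U -> uniq [:: y; x1; x2; x3] ->
     (forall x, x \in [:: x1; x2; x3] -> x \in W /\ adj A y x) -> forall t, q y t = 0.
    move=> yU ux hx.
    have ev x : x \in [:: x1; x2; x3] -> evq q y (dv (moved p c z) y x) = 0.
      move=> /hx[xW yx]; have xU : x \in U by move: xW; rewrite inE => /andP[].
      have : stretch (moved p c z) y x q = 0 by apply: (motion_adj mq); rewrite ins_adj yx yU.
      rewrite /stretch (_ : evq q x _ = 0) ?subr0 //.
      by rewrite /evq !h ?WS // !mul0r !addr0.
    by apply: (three_directions gz' ux); apply: ev; rewrite !inE eqxx ?orbT.
  have qP u : u \in P -> forall t, q u t = 0.
    move=> uP; have uu := quad_uniq uP; have [[uU _ _ _] _] := sp uP.
    apply: (star u (a u) (b u) (d u)) => //; first by ucut uu; uniqs.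
    by move=> x hx; apply: quad_in => //; move: hx; rewrite !inE => /or3P[] ->; rewrite ?orbT.
  have qc : forall t, q c t = 0.
    apply: (star c (a v) (b v) (d v)) => //; first by ucut uv; uniqs.
    move=> x hx; have hx' : x \in [:: a v; b v; d v; e v] by move: hx; rewrite !inE => /or3P[] ->; rewrite ?orbT.
    have [xW _] := quad_in vP hx'; split=> //; rewrite adjC.
    by have [_ [ac _ _]] := sp vP; apply: ac; apply: sX.
  apply/matrixP=> y t; rewrite [RHS]mxE.
  case: (boolP (y \in P)) => [/qP->//|yP]; case: (eqVneq y c) => [->|yc]; first exact: qc.
  by apply: h; rewrite !inE negb_or yc yP.
have FKD : (MZ + coord_mx R S <= MZ + MK)%MS by rewrite addsmxS.
have := mxrankS FKD; have := mxrank_sum_cap MZ (coord_mx R S).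
rewrite cap mxrank0 addn0 rank_coord_mx cS; move: rZ DP; clear; lia.
Qed.

End Position.

Lemma three_places : exists z2 z3, [/\ good (moved p c (p c)), good (moved p c z2), good (moved p c z3) &
  br (p c) z2 z3 != 0].
Proof.
have [g1 n1 h1] := good_move c ((p c).1 + 1, (p c).2) gp.
have [g2 n2 h2] := good_move c ((p c).1, (p c).2 + 1) gp.
have [t1 /h1 hg1 t10] := poly_pick n1; have [t2 /h2 hg2 t20] := poly_pick n2.
exists (mid (p c) ((p c).1 + 1, (p c).2) t1), (mid (p c) ((p c).1, (p c).2 + 1) t2); split=> //.
  by apply: good_ext gp => i; rewrite /moved; case: eqP => // ->.
rewrite (_ : br _ _ _ = t1 * t2) ?mulf_neq0 //.
by rewrite /br /mid /=; ring.
Qed.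

(** By [balanced_three] the balanced spaces for three positions of [c] are independent modulo the
    flat ones, so [rank_three] applies. One position uses the second bound of [position_rank], two
    use the first: with [k] special vertices, [3(k + 1) + k + 2(k + 1) = 6k + 5]. *)
Lemma centre_rank : (0 < #|P|)%N -> (rk p H0 + 6 * #|P| + 5 <= rk p (ins A U))%N.
Proof.
move=> P0; have [z2 [z3 [g1 g2 g3 nz]]] := three_places.
have [|t q q' [m1 v1] [m2 v2]|MK hK] := @motion_subspace R n flat_quad_motion.
- by split=> [|v vP]; [apply: motion0|split; split; apply: stretch0].
- by split=> [|v vP]; [apply: motion_lin|apply: quad_zero_lin; [apply: v1|apply: v2]].
have [|t q q' h1 h2|MH hH] := @motion_subspace R n (motion p H0); [exact: motion0|exact: motion_lin|].
have [V1 hV1 [_ r1]] := position_rank g1 hK P0.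
have [V2 hV2 [r2 _]] := position_rank g2 hK P0.
have [V3 hV3 [r3 _]] := position_rank g3 hK P0.
have VH z (V : 'M[R]_(n * 3)) : (forall q, (mxvec q <= V)%MS <-> balanced_motion z q) -> (V <= MH)%MS.
  by move=> hV; apply: submx_pred => q /hV[mq _]; apply/hH.
have three q1 q2 q3 : balanced_motion (p c) q1 -> balanced_motion z2 q2 -> balanced_motion z3 q3 -> q1 + q2 + q3 = 0 -> flat_quad_motion q1 /\ flat_quad_motion q3.
  move=> [m1 b1] [m2 b2] [m3 b3] E.
  suff h v : v \in P -> quad_zero p (a v) (b v) (d v) (e v) q1 /\ quad_zero p (a v) (b v) (d v) (e v) q3.
    by split; split=> // v /h[].
  move=> vP; have uv := quad_uniq vP.
  have [] := balanced_three _ nz (good_genpos g1) (good_genpos g2) (good_genpos g3)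
    (b1 v vP) (b2 v vP) (b3 v vP) E; last by [].
  by ucut uv; uniqs.
have V0 z : balanced_motion z 0.
  by split=> [|v vP]; [apply: motion0|apply: balanced0].
have Vopp z q : balanced_motion z q -> balanced_motion z (- q).
  move=> [m v]; rewrite -[- q]add0r -scaleN1r; split; first by apply: motion_lin => //; apply: motion0.
  by move=> u uP; apply: balanced_lin; [apply: balanced0|apply: v].
have c12 : (V1 :&: V2 <= MK)%MS.
  apply: submx_pred => q; rewrite sub_capmx => /andP[/hV1 a1 /hV2 a2]; apply/hK.
  by have [] := three q (- q) 0 a1 (Vopp _ _ a2) (V0 _) ltac:(by rewrite subrr addr0).
have c3 : ((V1 + V2) :&: V3 <= MK)%MS.
  apply: submx_pred => q; rewrite sub_capmx => /andP[/sub_addsmxP[[x y] E] /hV3 a3]; apply/hK.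
  have a1 : balanced_motion (p c) (vec_mx (x *m V1)) by apply/hV1; rewrite vec_mxK submxMl.
  have a2 : balanced_motion z2 (vec_mx (y *m V2)) by apply/hV2; rewrite vec_mxK submxMl.
  have E' : vec_mx (x *m V1) + vec_mx (y *m V2) + - q = 0 by rewrite -linearD /= -E mxvecK subrr.
  have [_ [m zq]] := three _ _ _ a1 a2 (Vopp _ _ a3) E'.
  rewrite -[q]opprK -[- - q]add0r -scaleN1r; split; first by apply: motion_lin => //; apply: motion0.
  by move=> v vP; apply: quad_zero_lin; [split; split; apply: stretch0|apply: zq].
have := rank_three (VH _ _ hV1) (VH _ _ hV2) (VH _ _ hV3) c12 c3.
have := rank_motions hH; move: r1 r2 r3; clear; lia.
Qed.

(** Away from [c] a special vertex has only the four neighbours of its quadruple. *)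
Lemma centre_card : (rk p (ins A (U :\ c)) <= rk p H0 + 4 * #|P|)%N.
Proof.
pose E := \bigcup_(v in P) star v [:: a v; b v; d v; e v].
have sub : ins A (U :\ c) \subset H0 :|: E.
  apply/subsetP=> f fE; have hf := joins_e f.
  have side x y : adj (ins A (U :\ c)) x y -> joins f x y -> x \in P -> f \in E.
    rewrite ins_adj !inE => /and3P[xy /andP[xc xU] /andP[yc yU]] hxy xP.
    apply/bigcupP; exists x => //; apply: (joins_star _ hxy).
    have [[_ _ N X4] _] := sp xP; have [ux sx] := quad xP.
    have : y \in nbrs A U x by rewrite inE yU.
    rewrite N in_setU1 (negbTE yc) -mem_enum.
    by have [_ ->] := uniq_min_size ux (s2 := enum (X x)) ltac:(by move=> t /sx; rewrite mem_enum)
      ltac:(by rewrite -cardE X4).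
  have ad : adj (ins A (U :\ c)) (e1 f) (e2 f) by rewrite (adjE _ hf).
  case: (boolP (e1 f \in P)) => h1; first by rewrite in_setU (side _ _ ad hf h1) orbT.
  case: (boolP (e2 f \in P)) => h2.
    by rewrite in_setU (side (e2 f) (e1 f)) ?orbT // 1?adjC // joinsC.
  rewrite in_setU; apply/orP; left; rewrite -(adjE _ hf) ins_adj.
  move: ad; rewrite ins_adj !inE => /and3P[-> /andP[n1 ->] /andP[n2 ->]].
  by rewrite (negbTE n1) (negbTE n2) (negbTE h1) (negbTE h2).
apply: leq_trans (rkS p sub) _; apply: leq_trans (rkU _ _ _) _; rewrite leq_add2l.
rewrite mulnC -sum_nat_const.
apply: (@leq_trans (\sum_(v in P) #|star v [:: a v; b v; d v; e v]|)).
  rewrite /E; elim/big_rec2: _ => [|v x Y _ h]; first by rewrite cards0.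
  by apply: leq_trans (leq_card_setU _ _).1 _; rewrite leq_add2l.
apply: leq_sum => v vP; have uv := quad_uniq vP; by rewrite card_star //; ucut uv; uniqs.
Qed.

End CentreBound.

Lemma centre_bound (R : realFieldType) (n : nat) (p : 'I_n -> R * R) (A : {set edge n})
  (U P : {set 'I_n}) (c : 'I_n) : good p -> flat p A -> c \in U ->
  (forall v, v \in P -> exists X, special p A U v c X) -> (0 < #|P|)%N ->
  (rk p (ins A (U :\ c)) + 2 * #|P| + 5 <= rk p (ins A U))%N.
Proof.
move=> gp f cU hP P0.
have /fin_all_exists[X hX] : forall v, exists X, v \in P -> special p A U v c X.
  by move=> v; case: (boolP (v \in P)) => [/hP[X ?]|_]; [exists X|exists set0].
have /fin_all_exists[x hx] : forall v, exists x : 'I_n * 'I_n * 'I_n * 'I_n, v \in P ->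
    uniq [:: x.1.1.1; x.1.1.2; x.1.2; x.2] /\ {subset [:: x.1.1.1; x.1.1.2; x.1.2; x.2] <= X v}.
  move=> v; case: (boolP (v \in P)) => [vP|_]; last by exists (v, v, v, v).
  have [[_ _ _ X4] _] := hX v vP; have [s [us s4 sX]] := pick_seq (eq_leq (esym X4)).
  by case: s us s4 sX => [|i [|j [|k [|l []]]]] // us _ sX; exists (i, j, k, l).
have := centre_rank gp f cU hX hx P0; have := @centre_card _ _ p A U P c X _ _ _ _ hX hx.
lia.
Qed.

(** * The three kinds of stars in a flat *)

Section StarAnalysis.
Variables (R : realFieldType) (n : nat).
Implicit Types (e : edge n) (F G H A : {set edge n}) (i j k l m v a b c d y : 'I_n)
  (p : 'I_n -> R * R) (q : 'M[R]_(n, 3)) (s : seq 'I_n) (U W X Y M : {set 'I_n}).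

Lemma five_special p A W v s : good p -> flat p A -> v \notin W -> uniq s -> size s = 5%N ->
  {subset s <= W} -> (forall x, x \in s -> adj A v x) ->
  (rk p (ins A W :|: star v s) <= rk p (ins A W) + 4)%N ->
  (forall t, uniq t -> size t = 4%N -> {subset t <= s} -> ~ cliq A [set x in t]) ->
  exists c X, [/\ [set x in s] = c |: X, c \notin X, #|X| = 4%N, forall x, x \in X -> adj A x c &
    forall x y, x \in X -> y \in X -> ~~ adj A x y].
Proof.
case: s => [|i [|j [|k [|l [|m []]]]]] // gp f vW us _ sW va dep nK.
have [|x [y [z [w [t [H [[h1 h2 h3 h4] [h5 h6]]]]]]]] := five_star gp f vW us sW va dep.
  move=> a b c d u ss /and5P[a1 a2 a3 a4 a5]; apply/negP=> a6.
  apply: (nK _ u erefl ss) => x y; rewrite !inE.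
  by move=> /or4P[] /eqP-> /or4P[] /eqP->; rewrite ?eqxx // => _; rewrite // adjC.
have ss : {subset [:: x; y; z; w; t] <= [:: i; j; k; l; m]} by case/andP: H => _ /allP; apply.
have u5 : uniq [:: x; y; z; w; t] by case/andP: H.
have [[n1 n2 n3 n4] _ _] := special_rel gp f vW u5 (fun _ h => sW _ (ss _ h)) (fun _ h => va _ (ss _ h))
  h1 h2 h3 h4 h5 h6 ltac:(by rewrite (@star_dep_perm _ _ p _ v [:: i; j; k; l; m])).
have [_ E] := uniq_min_size u5 ss (leqnn _).
exists t, [set x'' in [:: x; y; z; w]]; split.
- by apply/setP=> r; rewrite in_set -E in_setU1 in_set !inE; case: (r == x); case: (r == y); case: (r == z); case: (r == w); case: (r == t).
- by rewrite inE; ucut u5; uniqs.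
- by rewrite cardsE; apply/card_uniqP; ucut u5; uniqs.
- by move=> r; rewrite !inE => /or4P[] /eqP->.
move=> r r'; rewrite !inE.
by move=> /or4P[] /eqP-> /or4P[] /eqP->; rewrite // ?(contraFN _ (eqxx _)) // 1?adjC //;
  apply/negP=> /adj_neq; rewrite eqxx.
Qed.

(* A sixth neighbour would force the two-parameter family of stretches on an
   independent quadruple to be trivial. *)
Lemma five_neighbours p A W v Y : good p -> flat p A -> v \notin W -> Y \subset W ->
  (forall x, x \in Y -> adj A v x) -> (5 <= #|Y|)%N ->
  (forall s, uniq s -> size s = 5%N -> {subset s <= Y} ->
     (rk p (ins A W :|: star v s) <= rk p (ins A W) + 4)%N) ->
  (forall t, uniq t -> size t = 4%N -> {subset t <= Y} -> ~ cliq A [set x in t]) ->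
  exists c X, [/\ Y = c |: X, c \notin X, #|X| = 4%N, forall x, x \in X -> adj A x c &
    forall x y, x \in X -> y \in X -> ~~ adj A x y].
Proof.
move=> gp f vW /subsetP YW va Y5 dep nK; have g := good_genpos gp.
have five s : uniq s -> size s = 5%N -> {subset s <= Y} ->
    exists c X, [/\ [set x in s] = c |: X, c \notin X, #|X| = 4%N, forall x, x \in X -> adj A x c &
    forall x y, x \in X -> y \in X -> ~~ adj A x y].
  move=> us s5 sY; apply: (five_special gp f vW us s5) => [x /sY/YW //|x /sY/va //||t ut t4 ts].
    exact: dep.
  by apply: nK => // x /ts/sY.
have [s [us s5 sY]] := pick_seq Y5.
have [c [X [E cX X4 ac nX]]] := five s us s5 sY.
case: (boolP (Y \subset [set x in s])) => [Ys|/subsetPn[m mY]].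
  have -> : Y = [set x in s] by apply/eqP; rewrite eqEsubset Ys; apply/subsetP=> x; rewrite inE => /sY.
  by exists c, X.
rewrite E => mX; exfalso.
have [t [ut t4 tX]] := pick_seq (eq_leq (esym X4)).
case: t ut t4 tX => [|i [|j [|k [|l []]]]] // ut _ tX.
have XY x : x \in c |: X -> x \in Y by rewrite -E inE; apply: sY.
have cY := XY c (setU11 _ _).
have u6 : uniq [:: m, c & [:: i; j; k; l]].
  rewrite cons_uniq [uniq (c :: _)]cons_uniq ut andbT in_cons negb_or; apply/andP; split; last by apply: contra cX; apply: tX.
  by move: mX; rewrite in_setU1 negb_or => /andP[-> mX]; apply: contra mX; apply: tX.
have [iX jX kX lX] : [/\ i \in X, j \in X, k \in X & l \in X].
  by split; apply: tX; rewrite !inE eqxx ?orbT.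
(* Five neighbours containing [m], [c] and three members of [X] again form a centre with four
   nonadjacent vertices, and the adjacencies of [c] leave only [c] as the centre. *)
have mc x1 x2 x3 : uniq [:: m; c; x1; x2; x3] -> x1 \in X -> x2 \in X -> x3 \in X ->
    adj A m c /\ [/\ ~~ adj A m x1, ~~ adj A m x2 & ~~ adj A m x3].
  move=> u h1 h2 h3.
  have [|//||c' [X' [E' cX' _ ac' nX']]] := five [:: x1; x2; x3; m; c].
  - by ucut u; uniqs.
  - move=> x; rewrite !inE => /or4P[||| /orP[]] /eqP->; [exact: XY (setU1r c h1)|exact: XY (setU1r c h2)|exact: XY (setU1r c h3)|exact: mY|exact: cY].
  have mem x : x \in [:: x1; x2; x3; m; c] -> x \in c' |: X' by move=> h; rewrite -E' in_set.
  have memX x : x \in [:: x1; x2; x3; m; c] -> x != c' -> x \in X'.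
    by move=> /mem; rewrite in_setU1 => /orP[->|].
  have [q1 q2 q3] : [/\ x1 \in [:: x1; x2; x3; m; c], x2 \in [:: x1; x2; x3; m; c] & x3 \in [:: x1; x2; x3; m; c]].
    by split; rewrite !inE eqxx ?orbT.
  have [qm qc] : m \in [:: x1; x2; x3; m; c] /\ c \in [:: x1; x2; x3; m; c].
    by split; rewrite !inE eqxx ?orbT.
  have xc x y : x \in [:: x1; x2; x3; m; c] -> x \in X -> y \in X -> x != y -> c' != y.
    move=> hx xX yX xy; apply: contraNneq (nX _ _ xX yX) => E1; rewrite -E1; apply: ac'.
    by apply: memX => //; rewrite E1.
  have n1 : c' != x1 by apply: (xc x2) => //; ucut u; uniqs.
  have n2 : c' != x2 by apply: (xc x1) => //; ucut u; uniqs.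
  have n3 : c' != x3 by apply: (xc x1) => //; ucut u; uniqs.
  have x1X' : x1 \in X' by apply: memX; rewrite // eq_sym.
  have x2X' : x2 \in X' by apply: memX; rewrite // eq_sym.
  have x3X' : x3 \in X' by apply: memX; rewrite // eq_sym.
  have Ec : c' = c.
    apply/eqP; apply: contraT => c'c; have := nX' x1 c x1X' (memX c qc ltac:(by rewrite eq_sym)).
    by rewrite ac.
  have mX' : m \in X' by apply: memX; rewrite // Ec; ucut u.
  by split; [rewrite -Ec; apply: ac' | split; apply: nX'].
have [mcA [mi mj mk]] := mc i j k ltac:(ucut u6; uniqs) iX jX kX.
have [_ [_ _ ml]] := mc i j l ltac:(ucut u6; uniqs) iX jX lX.
have rel x1 x2 x3 x4 : uniq [:: x1; x2; x3; x4; c] -> {subset [:: x1; x2; x3; x4] <= m |: X} ->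
   (exists q, [/\ motion p (ins A W) q, stretch p x1 x2 q = 0 & stretch p x1 x3 q != 0]) /\
   forall q, motion p (ins A W) q ->
    [/\ term p q x3 x4 x1 x2 c = term p q x1 x2 x3 x4 c, term p q x2 x4 x1 x3 c = term p q x1 x3 x2 x4 c,
        term p q x2 x3 x1 x4 c = term p q x1 x4 x2 x3 c &
        term p q x1 x2 x3 x4 c + term p q x1 x3 x2 x4 c + term p q x1 x4 x2 x3 c = 0].
  move=> u ss.
  have ad x : x \in m |: X -> adj A x c by rewrite in_setU1 => /orP[/eqP->|/ac].
  have nn x y : x \in m |: X -> y \in m |: X -> ~~ adj A x y.
    have nm z : z \in X -> ~~ adj A m z.
      move=> zX; have : z \in [:: i; j; k; l].
        have [_ ->] := uniq_min_size ut (s2 := enum X) ltac:(by move=> r /tX; rewrite mem_enum)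
          ltac:(by rewrite -cardE X4).
        by rewrite mem_enum.
      by rewrite !inE => /or4P[] /eqP->.
    rewrite !in_setU1 => /orP[/eqP->|xX] /orP[/eqP->|yX]; [by apply/negP=> /adj_neq; rewrite eqxx|exact: nm| |exact: nX].
    by rewrite adjC nm.
  have sY5 : {subset [:: x1; x2; x3; x4; c] <= Y}.
    move=> x; rewrite -[[:: x1; x2; x3; x4; c]]/([:: x1; x2; x3; x4] ++ [:: c]) mem_cat mem_seq1.
    case/orP=> [/ss|/eqP->//]; rewrite in_setU1 => /orP[/eqP->//|xX].
    by apply: XY; rewrite setU1r.
  have [h1 h2 h3 h4] : [/\ x1 \in m |: X, x2 \in m |: X, x3 \in m |: X & x4 \in m |: X].
    by split; apply: ss; rewrite !inE eqxx ?orbT.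
  have [|||_ r1 r2] := special_rel gp f vW u _ _ (ad _ h1) (ad _ h2) (ad _ h3) (ad _ h4)
    (nn _ _ h1 h2) (nn _ _ h3 h4) _.
  - by move=> x /sY5/YW.
  - by move=> x /sY5/va.
  - exact: dep.
  by split.
have sub x1 x2 x3 x4 : [&& x1 \in m |: X, x2 \in m |: X, x3 \in m |: X & x4 \in m |: X] ->
   {subset [:: x1; x2; x3; x4] <= m |: X}.
  by move=> /and4P[h1 h2 h3 h4] x; rewrite !inE => /or4P[] /eqP->; rewrite -in_setU1.
have [iX' jX' kX' lX'] : [/\ i \in m |: X, j \in m |: X, k \in m |: X & l \in m |: X].
  by split; rewrite setU1r.
(* Starting from [i j] unstretched and [i k] stretched, balance on [i j k l] and [i j k m] kills
   [k l] and [k m]; then balance on [k l m i] kills [k i]. *)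
have [[q [mq ij ik]] R1] := rel i j k l ltac:(ucut u6; uniqs) ltac:(by apply: sub; rewrite iX' jX' kX').
have [_ R2] := rel i j k m ltac:(ucut u6; uniqs) ltac:(by apply: sub; rewrite iX' jX' kX' setU11).
have [_ R3] := rel k l m i ltac:(ucut u6; uniqs) ltac:(by apply: sub; rewrite iX' lX' kX' setU11).
have [r1 _ _ _] := R1 q mq; have [r2 _ _ _] := R2 q mq; have [_ _ _ r3] := R3 q mq.
have T0 x y a b d : uniq [:: x; y; a; b; d] -> term p q x y a b d = 0 -> stretch p x y q = 0.
  by move=> ux /eqP; rewrite term_eq0 // => /eqP.
have skl : stretch p k l q = 0 by apply: (T0 k l i j c); [ucut u6; uniqs|rewrite r1 term0].
have skm : stretch p k m q = 0 by apply: (T0 k m i j c); [ucut u6; uniqs|rewrite r2 term0].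
have : stretch p k i q = 0.
  apply: (T0 k i l m c); first by ucut u6; uniqs.
  by move: r3; rewrite (term0 _ _ _ skl) (term0 _ _ _ skm) !add0r.
by rewrite stretchC => /eqP; rewrite oppr_eq0 (negbTE ik).
Qed.

Lemma mem_seq4 (t x y z w : 'I_n) : t \in [:: x; y; z; w] -> [\/ t = x, t = y, t = z | t = w].
Proof. by rewrite !inE => /or4P[] /eqP; [constructor 1|constructor 2|constructor 3|constructor 4]. Qed.

(** The first alternative is the reducible one: every omitted neighbour completes a five-clique with
    [v] and three members of [s], so only clique stresses appear when [v] is added. The other two
    feed the counting argument. *)
Lemma star_analysis p A U v : good p -> flat p A -> v \in U ->
  [\/ exists s, [/\ uniq s, {subset s <= nbrs A U v},
        rk p (ins A (U :\ v) :|: star v s) = (rk p (ins A (U :\ v)) + size s)%N &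
        forall x, x \in nbrs A U v -> x \notin s ->
          exists a b d, [/\ uniq [:: a; b; d], {subset [:: a; b; d] <= s} & cliq A [set y in [:: v; a; b; d; x]]]],
      exists c X, special p A U v c X |
      (rk p (ins A (U :\ v)) + 5 <= rk p (ins A U))%N].
Proof.
move=> gp f vU; set W := U :\ v; set N := nbrs A U v; have g := good_genpos gp.
have vW : v \notin W by rewrite !inE eqxx.
have NP x : x \in N -> [/\ x \in W, adj A v x & v != x].
  by rewrite inE => /andP[xU vx]; have vn := adj_neq vx; split; rewrite // !inE xU eq_sym vn.
have vN s : {subset s <= N} -> v \notin s by move=> sN; apply/negP=> /sN/NP[_ _]; rewrite eqxx.
have EN : ins A U = ins A W :|: star v (enum N) by apply: ins_star => // x; rewrite mem_enum.
have av := ins_avoids (A := A) vW.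
have sE : {subset enum N <= N} by move=> x; rewrite mem_enum.
have [N3|N4] := leqP #|N| 3.
  constructor 1; exists (enum N); split; rewrite ?enum_uniq //.
    by apply: star_small => //; rewrite ?cons_uniq ?enum_uniq ?andbT ?vN // -cardE.
  by move=> x; rewrite mem_enum => ->.
case: (boolP (cliqb A N)) => [/cliqP cN|].
  have [s [us s3 sN]] := pick_seq (ltnW N4).
  case: s us s3 sN => [|a [|b [|d []]]] // us _ sN.
  constructor 1; exists [:: a; b; d]; split=> //.
    by apply: star_small => //; rewrite cons_uniq us vN.
  move=> x xN _; exists a, b, d; split=> // y z; rewrite !inE => hy hz.
  have inN t : [|| t == v, t == a, t == b, t == d | t == x] -> t = v \/ t \in N.
    by case/orP=> [/eqP->|h]; [left|right; move: h => /or4P[] /eqP-> //; apply: sN; rewrite !inE eqxx ?orbT].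
  case: (inN y hy) => [->|yN]; case: (inN z hz) => [->|zN]; rewrite ?eqxx // => yz.
  - by have [] := NP z zN.
  - by have [_ h _] := NP y yN; rewrite adjC.
  - exact: cN.
rewrite negb_forall_in => /exists_inP[x xN]; rewrite negb_forall_in => /exists_inP[y yN].
rewrite negb_imply => /andP[xy nxy].
have [s2 [us2 sz2 s2N]] := @pick_seq _ (N :\: [set x; y]) 2 ltac:(by
  have := cardsID [set x; y] N; rewrite -[#|N :\: _|]/(#|N :\: _|);
  have := subset_leq_card (subsetIr N [set x; y]); rewrite cards2 xy => h1 h2; lia).
case: s2 us2 sz2 s2N => [|z [|w []]] // us2 _ s2N.
have s4N : {subset [:: x; y; z; w] <= N}.
  move=> t /mem_seq4[] -> //.
    by have := s2N z (mem_head _ _); rewrite in_setD => /andP[].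
  by have := s2N w ltac:(by rewrite !inE eqxx orbT); rewrite in_setD => /andP[].
have u4 : uniq [:: x; y; z; w].
  have hz := s2N z (mem_head _ _); have hw := s2N w ltac:(by rewrite !inE eqxx orbT).
  move: hz hw; rewrite !in_setD !in_set2 !negb_or => /andP[/andP[? ?] _] /andP[/andP[? ?] _].
  by ucut us2; uniqs.
have r4 : rk p (ins A W :|: star v [:: x; y; z; w]) = (rk p (ins A W) + 4)%N.
  apply: (star4_nonclique gp f vW _ _ _ _ xy nxy); rewrite ?inE ?eqxx ?orbT //.
  by rewrite cons_uniq u4 vN.
case: (ltngtP #|N| 4) => [|N5|N4']; first by rewrite ltnNge N4.
  2: { constructor 1; exists [:: x; y; z; w]; split=> // t tN tn; case/negP: tn.
    have [_ ->] := uniq_min_size u4 (s2 := enum N) ltac:(by move=> r /s4N; rewrite mem_enum)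
      ltac:(by rewrite -cardE N4').
    by rewrite mem_enum. }
have [h5|h4] := leqP (rk p (ins A W) + 5) (rk p (ins A U)); first by constructor 3.
have dep s : {subset s <= N} -> (rk p (ins A W :|: star v s) <= rk p (ins A W) + 4)%N.
  move=> sN; apply: leq_trans (_ : (rk p (ins A U) <= _)%N); last by move: h4; rewrite addnS ltnS.
  rewrite EN; apply: rkS; apply: setUS; apply: starS => t /sN; by rewrite mem_enum.
case: (boolP [exists T : {set 'I_n}, [&& T \subset N, #|T| == 4 & cliqb A T]]) => [|no4]; last first.
  constructor 2.
  have [|||||c [X [E cX X4 ac nX]]] := @five_neighbours p A W v N gp f vW.
  - by apply/subsetP=> t /NP[].
  - by move=> t /NP[].
  - exact: N5.
  - by move=> t _ _; apply: dep.
  - move=> t ut t4 tN cl; case/negP: no4; apply/existsP; exists [set x in t].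
    rewrite cardsE (card_uniqP ut) t4 eqxx; apply/andP; split; last exact/cliqP.
    by apply/subsetP=> r; rewrite inE; apply: tN.
  exists c, X; split; split=> //; apply/eqP; rewrite eqn_leq; apply/andP; split.
    by move: h4; rewrite addnS ltnS.
  rewrite -r4 EN; apply: rkS; apply: setUS; apply: starS => t /s4N; by rewrite mem_enum.
case/existsP=> T /and3P[/subsetP TN /eqP T4 /cliqP clT].
have vT : v \notin T by apply/negP=> /TN/NP[_ _]; rewrite eqxx.
have clvT : cliq A (v |: T).
  move=> i j; rewrite !in_setU1 => /orP[/eqP->|iT] /orP[/eqP->|jT]; rewrite ?eqxx //.
  - by have [] := NP j (TN j jT).
  - by have [_ h _] := NP i (TN i iT); rewrite adjC.
  - exact: clT.
(* Three members of the four-clique and one neighbour outside [M] give four independent edges; every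
   further neighbour has to lie in [M], where it completes a five-clique. *)
have [M hM /subsetP sM] := maxcliques_ex clvT ltac:(by rewrite cardsU1 vT T4).
have [clM _] := maxcliquesP hM.
have vM : v \in M by apply: sM; rewrite setU11.
have [y' y'N y'M] : exists2 y', y' \in N & y' \notin M.
  case: (boolP (x \in M)) => xM; last by exists x.
  by exists y => //; apply: contra nxy => yM; apply: clM.
have [s [us s3 sT]] := @pick_seq _ T 3 ltac:(by rewrite T4).
case: s us s3 sT => [|a [|b [|d []]]] // us _ sT.
have abM t : t \in [:: a; b; d] -> t \in M by move=> /sT tT; apply: sM; rewrite setU1r.
have abN t : t \in [:: a; b; d] -> t \in N by move=> /sT/TN.
have ne t r : t \in [:: a; b; d] -> r \notin M -> t != r.
  by move=> /abM tM; apply: contraNneq => <-.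
have [ia ib id] : [/\ a \in [:: a; b; d], b \in [:: a; b; d] & d \in [:: a; b; d]] by rewrite !inE !eqxx !orbT.
have uy r : r \notin M -> uniq [:: a; b; d; r].
  by move=> rM; have := ne a r ia rM; have := ne b r ib rM; have := ne d r id rM; ucut us => *; uniqs.
have ss r : r \in N -> {subset [:: a; b; d; r] <= N}.
  move=> rN t; rewrite -[[:: a; b; d; r]]/([:: a; b; d] ++ [:: r]) mem_cat mem_seq1.
  by case/orP=> [/abN|/eqP->].
constructor 1; exists [:: a; b; d; y']; split.
- exact: uy.
- exact: ss.
- have [nya|nyb] : ~~ adj A a y' \/ ~~ adj A b y'.
    case: (boolP (adj A a y')) => h1; [right|by left]; apply/negP=> h2; case/negP: y'M.
    have [_ vy _] := NP y' y'N; have [_ _ va] := NP a (abN a ia); have [_ _ vb] := NP b (abN b ib).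
    by apply: (maxcliques_attach g f hM vM (abM a ia) (abM b ib) _ _ _ _); rewrite 1?adjC //; ucut us; uniqs.
  + apply: (star4_nonclique gp f vW _ _ _ _ (ne a y' ia y'M) nya); rewrite ?inE ?eqxx ?orbT //.
    by rewrite cons_uniq uy // vN //; apply: ss.
  apply: (star4_nonclique gp f vW _ _ _ _ (ne b y' ib y'M) nyb); rewrite ?inE ?eqxx ?orbT //.
  by rewrite cons_uniq uy // vN //; apply: ss.
move=> r rN rs; exists a, b, d; split=> //.
  by move=> t; rewrite !inE => /or3P[] ->; rewrite ?orbT.
suff rM : r \in M.
  move=> i j; rewrite !inE => hi hj; apply: clM.
    by move: hi => /or4P[|||/orP[]] /eqP->; rewrite ?(abM a ia, abM b ib, abM d id).
  by move: hj => /or4P[|||/orP[]] /eqP->; rewrite ?(abM a ia, abM b ib, abM d id).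
apply: contraT => rM.
have ry : r != y' by apply: contraNneq rs => ->; rewrite !inE eqxx ?orbT.
pose s5 := [:: a; b; d] ++ [:: r; y'].
have s5N : {subset s5 <= N}.
  by move=> t; rewrite mem_cat => /orP[/abN//|]; rewrite in_cons mem_seq1 => /orP[] /eqP->.
have u5 : uniq s5.
  have := uy r rM; have := uy y' y'M => h1 h2; rewrite /s5 /=; ucut h1; ucut h2; uniqs.
have [||||c [X [E cX _ _ nX]]] := five_special gp f vW u5 (erefl _).
- by move=> t /s5N/NP[].
- by move=> t /s5N/NP[].
- exact: dep.
- move=> t ut t4 ts cl; apply: (maxclique_four g f hM vM (vN _ s5N) (t := t)) => //.
  + by move=> i /s5N/NP[].
  + by move=> i j it jt; apply: cl; rewrite inE.
  + by rewrite /s5 count_cat /= (negbTE rM) (negbTE y'M) !addn0; do 3 case: (_ \in M).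
  have := count_predC (mem M) t; rewrite t4.
  suff : (count (predC (mem M)) t <= 2)%N by move: (count _ t) (count _ t) => c1 c2; clear; lia.
  rewrite -size_filter -[2%N]/(size [:: r; y']); apply: uniq_leq_size; first exact: filter_uniq.
  move=> i; rewrite mem_filter => /andP[/= iM /ts]; rewrite mem_cat => /orP[/abM|//].
  by rewrite (negbTE iM).
have mX t : t \in [:: a; b; d] -> t != c -> t \in X.
  move=> ht tc; have : t \in [set x in s5] by rewrite inE mem_cat ht.
  by rewrite E in_setU1 (negbTE tc).
have ad t t' : t \in [:: a; b; d] -> t' \in [:: a; b; d] -> t != t' -> t != c -> t' != c -> False.
  move=> h1 h2 tt' tc t'c; have := nX t t' (mX t h1 tc) (mX t' h2 t'c).
  by rewrite (clM _ _ (abM _ h1) (abM _ h2) tt').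
ucut us; exfalso.
(* At most one of [a], [b], [d] is the centre, and the other two are adjacent inside [M]. *)
case: (eqVneq a c) => [ac|ac].
  by apply: (ad b d) => //; rewrite -ac eq_sym.
case: (eqVneq b c) => [bc|bc]; last by apply: (ad a b).
by apply: (ad a d) => //; rewrite -bc eq_sym.
Qed.

End StarAnalysis.

(** * Stresses *)

Section Stresses.
Variables (R : realFieldType) (n : nat).
Implicit Types (e : edge n) (F G H A B : {set edge n}) (i j k l m v a b c d y : 'I_n)
  (p : 'I_n -> R * R) (q : 'M[R]_(n, 3)) (s : seq 'I_n) (U W X Y : {set 'I_n}).

Notation E := #|{: edge n}|.
Implicit Types (f w : 'rV[R]_E) (K : 'M[R]_E).

Definition edge_indices F : {set 'I_E} := [set enum_rank e | e in F].
Definition edge_rows p : 'M[R]_(E, n * 3) := \matrix_r rw p (enum_val r).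
(* The self-stresses supported on [F], as a row space. *)
Definition St p F : 'M[R]_E := (coord_mx R (edge_indices F) :&: kermx (edge_rows p))%MS.

Lemma mem_edge_indices F e : (enum_rank e \in edge_indices F) = (e \in F).
Proof. by rewrite mem_imset //; apply: enum_rank_inj. Qed.

Lemma StP p F f : reflect (f *m edge_rows p = 0 /\ forall e, e \notin F -> f 0 (enum_rank e) = 0) (f <= St p F)%MS.
Proof.
rewrite /St sub_capmx; apply: (iffP andP) => -[h1 h2].
  split; first exact/sub_kermxP.
  by move=> e eF; apply: (coord_mxP _ _ h1); rewrite mem_edge_indices.
split; last exact/sub_kermxP.
by apply/coord_mxP => r; rewrite -(enum_valK r) mem_edge_indices; apply: h2.
Qed.

Lemma St_sub p F K : (forall f, (f <= St p F)%MS -> (f <= K)%MS) -> (St p F <= K)%MS.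
Proof. by move=> h; apply/row_subP=> i; apply: h; apply: row_sub. Qed.

Lemma StS p F G : F \subset G -> (St p F <= St p G)%MS.
Proof.
move=> /subsetP s; apply: St_sub => f /StP[h1 h2]; apply/StP; split=> // e eG.
by apply: h2; apply: contra eG; apply: s.
Qed.

Lemma coord_edge_rows p F : (coord_mx R (edge_indices F) *m edge_rows p :=: Sp p F)%MS.
Proof.
apply/eqmxP/andP; split.
  apply/row_subP=> t; rewrite row_mul; have /coord_mxP h : (row t (coord_mx R (edge_indices F)) <= coord_mx R (edge_indices F))%MS by apply: row_sub.
  rewrite mulmx_sum_row; apply: summx_sub => r _; rewrite -(enum_valK r) rowK enum_rankK.
  case: (boolP (enum_val r \in F)) => rF; first by apply: scalemx_sub; apply: clos_in.
  by rewrite h ?scale0r ?sub0mx // mem_edge_indices.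
apply/sumsmx_subP=> e eF; rewrite genmxE.
have -> : rw p e = delta_mx 0 (enum_rank e) *m edge_rows p by rewrite -rowE rowK enum_rankK.
by apply: submxMr; apply: (sumsmx_sup (enum_rank e)); rewrite ?mem_edge_indices // genmxE.
Qed.

Lemma rank_St p F : (\rank (St p F) + rk p F = #|F|)%N.
Proof.
have := mxrank_mul_ker (coord_mx R (edge_indices F)) (edge_rows p).
by rewrite coord_edge_rows rank_coord_mx card_imset ?rkE -/(St p F) 1?addnC // ; apply: enum_rank_inj.
Qed.

Lemma St_indep p F : rk p F = #|F| -> St p F = 0.
Proof. by move=> h; apply/eqP; rewrite -mxrank_eq0; have := rank_St p F; rewrite h; lia. Qed.

Lemma clos_stress p F e : clos p F e -> e \notin F ->
  exists2 f : 'rV[R]_E, (f <= St p (e |: F))%MS & f 0 (enum_rank e) != 0.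
Proof.
rewrite /clos -(coord_edge_rows p F) => /submxP[w hw] eF.
pose f : 'rV[R]_E := delta_mx 0 (enum_rank e) - w *m coord_mx R (edge_indices F).
have wc e' : e' \notin F -> (w *m coord_mx R (edge_indices F)) 0 (enum_rank e') = 0.
  by move=> h; apply: (coord_mxP _ _ (submxMl w (coord_mx R (edge_indices F)))); rewrite mem_edge_indices.
exists f.
  apply/StP; split; first by rewrite mulmxBl -rowE rowK enum_rankK hw mulmxA subrr.
  move=> e'; rewrite in_setU1 negb_or => /andP[ee' eF']; rewrite mxE [X in _ + X]mxE wc // subr0 mxE eqxx /=.
  by rewrite (inj_eq enum_rank_inj) (negbTE ee').
by rewrite mxE [X in _ + X]mxE wc // subr0 mxE !eqxx oner_eq0.
Qed.

(** Gaussian elimination: each given stress meets the complement of [G] in a single edge, so the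
    coordinates outside [G] can be cleared independently, leaving a stress on [G]. *)
Lemma eliminate p G H K : (K <= kermx (edge_rows p))%MS -> G \subset H -> (St p G <= K)%MS ->
  (forall e, e \in H -> e \notin G -> exists f : 'rV[R]_E, [/\ (f <= K)%MS, f 0 (enum_rank e) != 0 &
     forall e', e' \notin G -> e' != e -> f 0 (enum_rank e') = 0]) ->
  (St p H <= K)%MS.
Proof.
move=> Kk /subsetP GH GK h; apply: St_sub => w /StP[w1 w2].
have /fin_all_exists[g hg] : forall e, exists f : 'rV[R]_E, e \in H -> e \notin G ->
    [/\ (f <= K)%MS, f 0 (enum_rank e) != 0 & forall e', e' \notin G -> e' != e -> f 0 (enum_rank e') = 0].
  move=> e; case: (boolP (e \in H)) => eH; last by exists 0.
  case: (boolP (e \in G)) => eG; first by exists 0.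
  by have [f hf] := h e eH eG; exists f.
pose u := \sum_(e in H :\: G) (w 0 (enum_rank e) / g e 0 (enum_rank e)) *: g e.
have uK : (u <= K)%MS.
  apply: summx_sub => e; rewrite inE => /andP[eG eH]; apply: scalemx_sub.
  by have [] := hg e eH eG.
rewrite -[w](subrK u); apply: addmx_sub => //; apply: submx_trans GK; apply/StP; split.
  by rewrite mulmxBl w1 (sub_kermxP (submx_trans uK Kk)) subrr.
move=> e eG; rewrite mxE [X in _ + X]mxE summxE.
case: (boolP (e \in H)) => eH; last first.
  rewrite w2 // big1 ?subrr // => e'; rewrite inE => /andP[e'G e'H].
  have [_ _ z] := hg e' e'H e'G; by rewrite mxE (z e) ?mulr0 //; apply: contraNneq eH => ->.
rewrite (bigD1 e) ?inE ?eG //= big1 => [|e' /andP[]].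
  by have [_ nz _] := hg e eH eG; rewrite addr0 mxE divfK // subrr.
rewrite inE => /andP[e'G e'H] ne; have [_ _ z] := hg e' e'H e'G.
by rewrite mxE (z e) ?mulr0 // eq_sym.
Qed.

Lemma exists_base p F : exists B, [/\ B \subset F, rk p B = rk p F & rk p B = #|B|].
Proof.
have [m] := ubnP #|F|; elim: m F => // m IH F; rewrite ltnS => Fm.
have [h|h] := leqP #|F| (rk p F).
  by exists F; split=> //; apply/eqP; rewrite eqn_leq rk_card h.
case: (boolP [exists e in F, clos p (F :\ e) e]) => [/exists_inP[e eF cl]|].
  have [|B [sB rB cB]] := IH (F :\ e); first by move: Fm; rewrite (cardsD1 e F) eF; lia.
  exists B; split=> //; first by apply: subset_trans sB (subsetDl _ _).
  rewrite rB -[in RHS](setD1K eF) setUC rk_clos // => e'; by rewrite inE => /eqP->.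
rewrite negb_exists_in => /forall_inP nc; exfalso.
suff : rk p F = #|F| by move=> E1; rewrite E1 ltnn in h.
have key (k : nat) G : G \subset F -> #|G| = k -> rk p G = k.
  elim: k G => [|k IHk] G GF; first by move=> /eqP; rewrite cards_eq0 => /eqP->; rewrite rk_set0.
  move=> Gk; have /card_gt0P[e eG] : (0 < #|G|)%N by rewrite Gk.
  rewrite -(setD1K eG) rk_nclos; last first.
    apply: contra (nc e (subsetP GF _ eG)); apply: closS; exact: setSD.
  rewrite (IHk (G :\ e)) //; first by apply: subset_trans GF; apply: subsetDl.
  by move: Gk; rewrite (cardsD1 e) eG => -[].
exact: key.
Qed.

End Stresses.

(** * Decomposition of the stresses of a flat *)

Section CliqueStresses.
Variables (R : realFieldType) (n : nat).
Implicit Types (e : edge n) (F G H A B : {set edge n}) (i j k l m v a b c d y : 'I_n)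
  (p : 'I_n -> R * R) (q : 'M[R]_(n, 3)) (s : seq 'I_n) (U W X Y : {set 'I_n}).

Notation E := #|{: edge n}|.

Definition clique_stress p A U : 'M[R]_E := (\sum_(X : {set 'I_n} | (X \subset U) && cliqb A X) St p (within X))%MS.

Lemma clique_stress_ker p A U : (clique_stress p A U <= kermx (edge_rows p))%MS.
Proof. by apply/sumsmx_subP=> X _; apply: capmxSr. Qed.

Lemma clique_stressS p A U W : U \subset W -> (clique_stress p A U <= clique_stress p A W)%MS.
Proof.
move=> UW; apply/sumsmx_subP=> X /andP[XU cX]; apply: (sumsmx_sup X) => //.
by rewrite cX (subset_trans XU UW).
Qed.

Lemma clique_stress_sub p A U X : X \subset U -> cliq A X -> (St p (within X) <= clique_stress p A U)%MS.
Proof. by move=> XU /cliqP cX; apply: (sumsmx_sup X); rewrite ?XU. Qed.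

Lemma insD A U v : ins A (U :\ v) \subset ins A U.
Proof. by apply: insS; apply: subsetDl. Qed.

(** The independent edges to [s] create no stress. An omitted edge [v x] is eliminated by the stress
    of the five-clique on [v], [a], [b], [d], [x], whose other edges at [v] end in [s]. *)
Lemma reducible_step p A U v s : good p -> v \in U -> (St p (ins A (U :\ v)) <= clique_stress p A U)%MS ->
  uniq s -> {subset s <= nbrs A U v} ->
  rk p (ins A (U :\ v) :|: star v s) = (rk p (ins A (U :\ v)) + size s)%N ->
  (forall x, x \in nbrs A U v -> x \notin s ->
     exists a b d, [/\ uniq [:: a; b; d], {subset [:: a; b; d] <= s} & cliq A [set y in [:: v; a; b; d; x]]]) ->
  (St p (ins A U) <= clique_stress p A U)%MS.
Proof.
move=> gp vU IH us sN rs hx; have g := good_genpos gp.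
have NP x : x \in nbrs A U v -> [/\ x \in U, adj A v x & v != x].
  by rewrite inE => /andP[xU vx]; split=> //; apply: adj_neq vx.
have vs : v \notin s by apply/negP=> /sN/NP[_ _]; rewrite eqxx.
have EN : ins A U = ins A (U :\ v) :|: star v (enum (nbrs A U v)) by apply: ins_star => // x; rewrite mem_enum.
have av := ins_avoids (A := A) (U := U :\ v) (v := v) ltac:(by rewrite !inE eqxx).
apply: (@eliminate _ _ p (ins A (U :\ v) :|: star v s) _ _ (clique_stress_ker p A U)).
- by rewrite EN; apply: setUS; apply: starS => x /sN; rewrite mem_enum.
- apply: submx_trans IH; have : (\rank (St p (ins A (U :\ v) :|: star v s)) = \rank (St p (ins A (U :\ v))))%N.
    have := rank_St p (ins A (U :\ v) :|: star v s); have := rank_St p (ins A (U :\ v)); rewrite rs.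
    have -> : #|ins A (U :\ v) :|: star v s| = (#|ins A (U :\ v)| + size s)%N.
      rewrite cardsU (_ : _ :&: _ = set0) ?cards0 ?subn0 ?card_star //.
      apply/setP=> e; rewrite !in_set0 in_setI; apply/negP=> /andP[/av + /star_joins[x xs he]].
      by rewrite (inc_joins _ he) eqxx.
    lia.
  move=> Er; have := mxrank_leqif_sup (StS p (subsetUl (ins A (U :\ v)) (star v s))).
  by move=> [_]; rewrite Er eqxx => /esym.
move=> e; rewrite EN !in_setU => /orP[->//|/star_joins[x]]; rewrite mem_enum => xN he.
rewrite negb_or => /andP[eW es].
have xs : x \notin s by apply: contra es => xs; apply: (joins_star xs he).
have [a [b [d [ua sa cl]]]] := hx x xN xs.
set K := [set y in [:: v; a; b; d; x]] in cl.
have [xU vx nvx] := NP x xN.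
have sP t : t \in [:: a; b; d] -> [/\ t \in U, adj A v t & v != t] by move=> /sa/sN/NP.
have [[aU va nva] [bU vb nvb] [dU vd nvd]] : [/\ [/\ a \in U, adj A v a & v != a], [/\ b \in U, adj A v b & v != b] &
   [/\ d \in U, adj A v d & v != d]] by split; apply: sP; rewrite !inE eqxx ?orbT.
have nx t : t \in [:: a; b; d] -> t != x by move=> /sa ts; apply: contraNneq xs => <-.
have [nax nbx ndx] : [/\ a != x, b != x & d != x] by split; apply: nx; rewrite !inE eqxx ?orbT.
have u5 : uniq [:: a; b; d; v; x] by ucut ua; uniqs.
have KU : K \subset U.
  by apply/subsetP=> t; rewrite in_set !inE => /or4P[|||/orP[]] /eqP->.
have cK : clos p (within K :\ e) e.
  apply/closP=> q mq; apply/eqP; rewrite (stretch_joins _ _ he); apply/eqP.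
  have z t r : t \in K -> r \in K -> t != r -> ~~ joins e t r -> stretch p t r q = 0.
    move=> tK rK /joins_ex[e' he'] ntr; apply: (motion_adj mq); apply/adjP; exists e' => //.
    rewrite in_setD1 (within_joins _ he') tK rK !andbT; apply: contra ntr => /eqP <-; exact: he'.
  have [aK bK dK [vK xK]] : [/\ a \in K, b \in K, d \in K & v \in K /\ x \in K].
    by split; last split; rewrite /K in_set !inE eqxx ?orbT.
  have nj t r : t != v -> r != v -> ~~ joins e t r.
    move=> tv rv; apply/negP=> h; have := inc_joins v h; rewrite (inc_joins v he).
    by rewrite [v == t]eq_sym [v == r]eq_sym eqxx (negbTE tv) (negbTE rv).
  have nj' t : t != x -> ~~ joins e t v.
    move=> tx; apply/negP=> h; have := inc_joins x h; rewrite (inc_joins x he).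
    by rewrite [x == t]eq_sym [x == v]eq_sym eqxx orbT (negbTE tx) (negbTE nvx).
  ucut ua; apply: (@K5_zero _ _ p a b d v x q g u5); apply: z => //; try (by apply: nj; rewrite // eq_sym);
    try (by apply: nj'); by rewrite eq_sym.
have [f fK fe] := clos_stress cK ltac:(by rewrite !inE eqxx).
have eK : e \in within K by rewrite (within_joins _ he) /K !in_set !inE !eqxx !orbT.
rewrite setD1K // in fK.
exists f; split=> //; first by apply: submx_trans fK (clique_stress_sub p KU cl).
move=> e' e'G ne; have /StP[_ h] := fK; apply: h; apply: contra e'G => e'K.
have hj := joins_e e'; have := e'K; rewrite (within_joins _ hj) => /andP[k1 k2].
have side t r : joins e' t r -> t \in K -> r \in K -> t = v -> e' \in ins A (U :\ v) :|: star v s.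
  move=> h tK rK tv; rewrite tv in h; rewrite in_setU; apply/orP; right.
  have vr := joins_neq h.
  have : [|| r == v, r == a, r == b, r == d | r == x] by move: rK; rewrite /K in_set !inE.
  move=> /or4P[/eqP rv|/eqP rv|/eqP rv|/orP[]/eqP rv].
  - by rewrite rv eqxx in vr.
  - by apply: (joins_star _ h); apply: sa; rewrite rv !inE eqxx.
  - by apply: (joins_star _ h); apply: sa; rewrite rv !inE eqxx orbT.
  - by apply: (joins_star _ h); apply: sa; rewrite rv !inE eqxx !orbT.
  by rewrite rv in h; case/negP: ne; apply/eqP; apply: joins_inj h he.
case: (eqVneq (e1 e') v) => [v1|v1]; first exact: (side _ _ hj).
case: (eqVneq (e2 e') v) => [v2|v2]; first by apply: (side _ _ _ k2 k1 v2); rewrite joinsC.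
rewrite in_setU; apply/orP; left; rewrite -(adjE _ hj) ins_adj !in_setD1 v1 v2 !(subsetP KU) // !andbT.
by apply: cl => //; apply: joins_neq hj.
Qed.

Lemma special_fun p A U (P : {set 'I_n}) : (forall v, v \in P -> exists c X, special p A U v c X) ->
  exists c : 'I_n -> 'I_n, forall v, v \in P -> exists X, special p A U v (c v) X.
Proof.
move=> h; have /fin_all_exists[c hc] : forall v, exists c, v \in P -> exists X, special p A U v c X.
  by move=> v; case: (boolP (v \in P)) => [/h[c ?]|_]; [exists c|exists v].
by exists c.
Qed.

Lemma degree_sum F U : F \subset within U -> 
  (\sum_(v in U) (#|F| - #|F :&: within (U :\ v)|) <= 2 * #|F|)%N.
Proof.
move=> /subsetP FU.
have D v : v \in U -> (#|F| - #|F :&: within (U :\ v)|)%N = (\sum_(e in F) inc v e)%N.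
  move=> vU; rewrite -cardsD -sum1_card big_mkcond [RHS]big_mkcond; apply: eq_bigr => e _.
  rewrite !inE; case: (boolP (e \in F)) => eF; rewrite ?andbF //= andbT.
  have := FU e eF; rewrite !inE /inc => /andP[-> ->].
  by rewrite !andbT negb_and !negbK ![v == _]eq_sym; case: (_ || _).
rewrite (eq_bigr _ D) exchange_big /= mulnC -sum_nat_const; apply: leq_sum => e eF.
rewrite -big_mkcondr /= sum1_card.
apply: leq_trans (_ : (#|[set e1 e; e2 e]| <= _)%N); last by rewrite cards2; case: (_ != _).
by apply: subset_leq_card; apply/subsetP=> v; rewrite !inE => /andP[_].
Qed.

Lemma stress_in_cliques p A U : good p -> flat p A -> (St p (ins A U) <= clique_stress p A U)%MS.
Proof.
move=> gp f; have [m] := ubnP #|U|; elim: m U => // m IHm U; rewrite ltnS => Um.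
have {IHm} IH v : v \in U -> (St p (ins A (U :\ v)) <= clique_stress p A U)%MS.
  move=> vU; apply: submx_trans (clique_stressS _ _ (subsetDl U [set v])); apply: IHm.
  by move: Um; rewrite (cardsD1 v U) vU.
apply: contraT => bad.
pose r := rk p (ins A U); pose rv v := rk p (ins A (U :\ v)).
pose P := [set v in U | (r < rv v + 5)%N].
have ana v : v \in U -> (exists c X, special p A U v c X) \/ (rv v + 5 <= r)%N.
  move=> vU; have [[s [us sN rs hx]]|h|h] := star_analysis gp f vU; [|by left|by right].
  by case/negP: bad; apply: (reducible_step gp vU (IH v vU) us sN rs hx).
have PU v : v \in P -> v \in U by rewrite inE => /andP[].
have [c hc] : exists c : 'I_n -> 'I_n, forall v, v \in P -> exists X, special p A U v (c v) X.
  apply: special_fun => v; rewrite inE => /andP[vU lt]; have [//|h] := ana v vU.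
  by move: lt h; rewrite ltnNge => /negP.
have cU v : v \in P -> c v \in U.
  by move=> /hc[X /special_nbr h]; have [] := h (c v) (setU11 _ _).
have rP v : v \in P -> r = (rv v + 4)%N by move=> /hc[X [_ [_ _ Er]]].
pose k y := #|[set v in P | c v == y]|.
have centre y : y \in U -> (0 < k y)%N -> (rv y + 2 * k y + 5 <= r)%N.
  move=> yU ky; apply: (centre_bound gp f yU _ ky) => v.
  by rewrite inE => /andP[vP /eqP <-]; apply: hc.
(* A special vertex falls short of five by one, while a centre exceeds five by twice the number of
   vertices it serves. Summed over [U], the terms [k v] and [v \in P] cancel. *)
have lower v : v \in U -> (rv v + 5 + k v <= r + (v \in P))%N.
  move=> vU; have [k0|] := leqP (k v) 0; last by move=> /(centre v vU); lia.
  case: (boolP (v \in P)) => [/rP->|]; first by lia.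
  by rewrite inE vU /= -leqNgt; lia.
have sumk : (\sum_(v in U) k v = #|P|)%N.
  rewrite -[RHS]sum1_card [RHS](partition_big c (mem U)) /=; last by move=> v; apply: cU.
  apply: eq_bigr => y _.
  by rewrite sum1dep_card.
have sumP : (\sum_(v in U) (v \in P) = #|P|)%N.
  rewrite -big_mkcondr sum1_card; apply: eq_card => v; rewrite -[RHS]/(v \in P).
  by apply/andP/idP => [[]|vP] //; split; rewrite // PU.
have low : (\sum_(v in U) rv v + 5 * #|U| <= #|U| * r)%N.
  have : (\sum_(v in U) (rv v + 5 + k v) <= \sum_(v in U) (r + (v \in P)))%N by apply: leq_sum.
  by rewrite !big_split /= sumk sumP !sum_nat_const leq_add2r (mulnC 5).
have [B [sB rB cB]] := exists_base p (ins A U).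
have [e [eA eB fbad]] : exists e, [/\ e \in ins A U, e \notin B & ~~ (St p (e |: B) <= clique_stress p A U)%MS].
  case: (boolP [exists e in ins A U, (e \notin B) && ~~ (St p (e |: B) <= clique_stress p A U)%MS]).
    by case/exists_inP=> e eA /andP[eB fbad]; exists e.
  rewrite negb_exists_in => /forall_inP h; case/negP: bad.
  apply: (eliminate (clique_stress_ker p A U) sB); first by rewrite (St_indep cB) sub0mx.
  move=> e eA eB; have := h e eA; rewrite eB /= negbK => sub.
  have cl : clos p B e.
    by apply: clos_rk; rewrite rB; apply: rkS; rewrite subUset sub1set eA.
  have [w hw we] := clos_stress cl eB; exists w; split=> //; first exact: submx_trans hw sub.
  move=> e' e'B ne; have /StP[_ z] := hw; apply: z.
  by rewrite in_setU1 negb_or ne.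
pose F := e |: B.
have FA : F \subset ins A U by rewrite subUset sub1set eA.
have cF : #|F| = r.+1 by rewrite cardsU1 eB -cB rB.
have rF : rk p F = r.
  apply/eqP; rewrite eqn_leq; apply/andP; split; first exact: rkS.
  by apply: leq_trans (eq_leq (esym rB)) (rkS p (subsetUr _ _)).
have St1 : \rank (St p F) = 1%N by have := rank_St p F; rewrite rF cF; lia.
(* The stress of [F] is unique up to a scalar and is not a sum of clique stresses. By induction it
   is not supported away from [v], so the edges of [F] avoiding [v] are independent and number at
   most [rv v]. *)
have deg v : v \in U -> (r.+1 - rv v <= #|F| - #|F :&: within (U :\ v)|)%N.
  move=> vU; rewrite cF leq_sub2l //; set Fv := F :&: _.
  have FvA : Fv \subset ins A (U :\ v).
    by apply: subset_trans (setSI _ FA) _; rewrite /ins -setIA setIS // subsetIr.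
  have z : St p Fv = 0.
    apply/eqP; apply: contraNT fbad => nz.
    have le : (St p Fv <= St p F)%MS by apply: StS; apply: subsetIl.
    have : (St p F <= St p Fv)%MS.
      rewrite -(geq_leqif (mxrank_leqif_sup le)) St1 lt0n mxrank_eq0 //.
    move=> /submx_trans; apply; apply: submx_trans (StS p FvA) (IH v vU).
  have := rank_St p Fv; rewrite z mxrank0 add0n => <-; exact: rkS.
have := degree_sum (subset_trans FA (subsetIr _ _)); rewrite cF => dsum.
have rvr v : (rv v <= r)%N by apply: rkS; apply: insD.
have high : (#|U| * r.+1 <= \sum_(v in U) rv v + 2 * r.+1)%N.
  apply: leq_trans (_ : (\sum_(v in U) (rv v + (r.+1 - rv v)) <= _)%N).
    rewrite -sum_nat_const; apply: leq_sum => v _; have := rvr v; lia.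
  rewrite big_split /= leq_add2l; apply: leq_trans dsum; apply: leq_sum => v vU.
  by rewrite -[X in (_ <= X - _)%N]cF; apply: deg.
have U3 : (2 < #|U|)%N.
  (* A special vertex would need more than two vertices in [U], and so would a star of rank five. *)
  case: (leqP 3 #|U|) => // U2; exfalso.
  case: (set_0Vmem U) => [U0|[v vU]].
    case/negP: bad; rewrite St_indep ?sub0mx // (_ : ins A U = set0) ?rk_set0 ?cards0 //.
    by apply/setP=> e'; rewrite U0 !inE /= ?andbF.
  case: (ana v vU) => [[c' [X spX]]|h].
    have : (#|X| <= #|U|)%N.
      by apply: subset_leq_card; apply/subsetP=> x xX; have [] := special_nbr spX (setU1r c' xX).
    by case: spX => [[_ _ _ ->] _]; move: U2; clear; lia.
  have EN : ins A U = ins A (U :\ v) :|: star v (enum (nbrs A U v)).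
    by apply: ins_star => // x; rewrite mem_enum.
  have : (r <= rv v + #|nbrs A U v|)%N.
    rewrite /r EN cardE -(@card_star _ v) ?enum_uniq ?rkU //.
    by rewrite mem_enum inE; apply/negP=> /andP[_ /adj_neq]; rewrite eqxx.
  have : (#|nbrs A U v| <= #|U|)%N by apply: subset_leq_card; apply/subsetP=> x; rewrite inE => /andP[].
  by move: U2 h; clear; lia.
have rU := rk_within gp U3.
have rle : (r <= rk p (within U))%N by apply: rkS; apply: subsetIr.
have rlt : (r < rk p (within U))%N.
  rewrite ltn_neqAle rle andbT; apply: contraNneq bad => Er.
  have cU' : cliq A U.
    move=> i j iU jU /joins_ex[e' he']; rewrite (adjE A he'); apply: (flat_clos f).
    apply: (closS (ins_sub A U)); apply: (@clos_rkU _ _ p _ (within U)); last by rewrite (within_joins _ he') iU.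
    by rewrite (setUidPr (subsetIr A (within U))) -Er.
  by apply: submx_trans (StS p (subsetIr _ _)) (clique_stress_sub p (subxx U) cU').
(* The two estimates combine to [6 * #|U| <= 2 * (r + 1)], whereas [r < 3 * #|U| - 6]. *)
move: low high rlt rU U3; clear; move: (\sum_(v in U) _)%N (rk p _) (#|U|) => x y z; nia.
Qed.

End CliqueStresses.

(** * Hinges and the rank formula *)

Section Counting.
Variables (R : realFieldType) (n : nat).
Implicit Types (e : edge n) (F G H A B : {set edge n}) (i j k l m v a b c d y : 'I_n)
  (p : 'I_n -> R * R) (U W X Y h : {set 'I_n}) (XX : {set {set 'I_n}}) (s : seq {set 'I_n}).

Definition ends e : {set 'I_n} := [set e1 e; e2 e].
Definition union XX : {set edge n} := \bigcup_(X in XX) within X.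

Lemma ends_within e X : (ends e \subset X) = (e \in within X).
Proof. by rewrite subUset !sub1set inE. Qed.

Lemma card_ends e : #|ends e| = 2%N.
Proof. by rewrite cards2 e12_neq. Qed.

Lemma ends_inj : injective ends.
Proof.
move=> e e' E; apply: (joins_inj (joins_e e)).
have h : e \in within (ends e') by rewrite -ends_within E.
have := h; rewrite inE /ends !in_set2 => /andP[/orP[]/eqP h1 /orP[]/eqP h2].
- by have := e12_neq e; rewrite h1 h2 eqxx.
- by rewrite h1 h2; apply: joins_e.
- by rewrite h1 h2 joinsC; apply: joins_e.
- by have := e12_neq e; rewrite h1 h2 eqxx.
Qed.

Lemma hingesE XX : two_thin XX -> hinges XX = ends @: [set e | (1 < hdeg XX (ends e))%N].
Proof.
move=> thin; apply/setP=> h; apply/idP/imsetP.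
  rewrite inE => /andP[/cards2P[x [y [xy ->]]] /exists_inP[X hX /exists_inP[Y hY /andP[XY /eqP E]]]].
  have [e he] := joins_ex xy; have Ee : ends e = [set x; y].
    by case/joins_cases: he => -[h1 h2]; rewrite /ends h1 h2 // setUC.
  exists e; last by rewrite Ee.
  rewrite inE; apply/card_gt1P; exists X, Y; split; rewrite // inE ?hX ?hY Ee -E ?subsetIl ?subsetIr //.
case=> e; rewrite inE => /card_gt1P[X [Y [hX hY XY]]] ->.
move: hX hY; rewrite !inE => /andP[hX eX] /andP[hY eY]; rewrite card_ends eqxx /=.
apply/exists_inP; exists X => //; apply/exists_inP; exists Y => //; rewrite XY eq_sym eqEcard.
by rewrite subsetI eX eY card_ends thin.
Qed.

(** An edge lying in [d > 0] members counts [d] on the right; on the left it counts 1 in the union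
    and [d - 1] as a hinge, by [hingesE]. *)
Lemma hinge_count XX : two_thin XX ->
  (\sum_(h in hinges XX) (hdeg XX h - 1) + #|union XX| = \sum_(X in XX) #|within X|)%N.
Proof.
move=> thin; pose d e := hdeg XX (ends e).
have dE e : d e = (\sum_(X in XX) (e \in within X))%N.
  rewrite -big_mkcondr /= sum1dep_card; apply: eq_card => X.
  by rewrite !inE subUset !sub1set.
have -> : (\sum_(X in XX) #|within X| = \sum_e d e)%N.
  rewrite (eq_bigr _ (fun e _ => dE e)) exchange_big /=; apply: eq_bigr => X _.
  by rewrite -big_mkcond sum1_card.
have -> : #|union XX| = (\sum_e (0 < d e))%N.
  rewrite -sum1_card big_mkcond; apply: eq_bigr => e _.
  have -> : (e \in union XX) = (0 < d e)%N.
    apply/bigcupP/card_gt0P => [[X hX eX]|[X]].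
      by exists X; rewrite in_set hX ends_within.
    by rewrite in_set ends_within => /andP[hX eX]; exists X.
  by case: (0 < d e)%N.
rewrite hingesE // big_imset /=; last by move=> e e' _ _; apply: ends_inj.
rewrite big_mkcond -big_split /=; apply: eq_bigr => e _; rewrite inE -/(d e).
by case: (d e) => [|[|t]] //=; rewrite subn1 addn1.
Qed.

Lemma valD_count XX : two_thin XX ->
  valD XX = \sum_(X in XX) ((3 * #|X|)%:Z - 6) - (\sum_(X in XX) #|within X|)%N%:Z + #|union XX|%:Z.
Proof.
move=> thin; rewrite /valD -(hinge_count thin) PoszD.
have cancel (x y z : int) : x - (y + z) + z = x - y by lia.
rewrite cancel; congr (_ - _).
rewrite -[RHS]natz natr_sum; apply: eq_bigr => h; rewrite hingesE // => /imsetP[e].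
rewrite inE => d1 ->; rewrite natz; move: d1; case: (hdeg _ _) => [|k] // _; lia.
Qed.

Lemma within_indep p Y : good p -> (#|Y| <= 4)%N -> rk p (within Y) = #|within Y|.
Proof.
move=> gp; have [m] := ubnP #|Y|; elim: m Y => // m IH Y; rewrite ltnS => Ym Y4.
case: (set_0Vmem Y) => [->|[v vY]].
  suff -> : within (set0 : {set 'I_n}) = set0 by rewrite rk_set0 cards0.
  by apply/setP=> e; rewrite !inE.
have nv : v \notin Y :\ v by rewrite !inE eqxx.
have cY : #|Y| = #|Y :\ v|.+1 by rewrite (cardsD1 v) vY.
rewrite -(setD1K vY) rk_within_add // (minn_idPl _); last by move: Y4; rewrite cY.
rewrite IH; [|by move: Ym; rewrite cY; lia|by move: Y4; rewrite cY; lia].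
rewrite within_add // cardsU (_ : _ :&: _ = set0) ?cards0 ?subn0.
  by rewrite card_star ?enum_uniq ?mem_enum // -cardE.
apply/setP=> e; rewrite in_set0 in_setI; apply/negP=> /andP[+ /star_joins[x xs he]].
by rewrite (within_joins _ he) (negbTE nv).
Qed.

Lemma indepS p G H : G \subset H -> rk p H = #|H| -> rk p G = #|G|.
Proof.
move=> s h; apply/eqP; rewrite eqn_leq rk_card /=.
have := rkU p G (H :\: G); rewrite -{1}(setIidPr s) setID h cardsDS // => hh.
by rewrite -(leq_add2r (#|H| - #|G|)) subnKC // subset_leq_card.
Qed.

(** Submodularity, one member at a time. The edges shared with earlier members lie within at most
    four vertices and are therefore independent, so their rank equals the number by which the
    cardinality of the union falls short. *)
Lemma shelling_bound p s : good p -> (forall X, X \in s -> 5 <= #|X|)%N ->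
  (forall i : nat, (1 <= i < size s)%N ->
      (#|nth set0 s i :&: \bigcup_(j < i) nth set0 s j| <= 4)%N) ->
  forall t, (t <= size s)%N ->
  (rk p (\bigcup_(j < t) within (nth set0 s j)) + \sum_(j < t) #|within (nth set0 s j)|
   <= \sum_(j < t) (3 * #|nth set0 s j| - 6) + #|\bigcup_(j < t) within (nth set0 s j)|)%N.
Proof.
move=> gp s5 sh; elim=> [|t IH] ts; first by rewrite !big_ord0 rk_set0 cards0.
have {IH} := IH (ltnW ts); rewrite !big_ord_recr /=.
set C := \bigcup_(j < t) _; set K := within _; set a := (\sum_(j < t) _)%N; set b := (\sum_(j < t) _)%N => IH.
have X5 : (5 <= #|nth set0 s t|)%N by apply: s5; apply: mem_nth.
have rK := rk_within gp (X := nth set0 s t) (ltac:(lia)); rewrite -/K in rK.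
have ind : rk p (C :&: K) = #|C :&: K|.
  case: (posnP t) => [t0|t0].
    have -> : C = set0 by rewrite /C t0 big_ord0.
    by rewrite set0I rk_set0 cards0.
  apply: (@indepS _ _ (within (nth set0 s t :&: \bigcup_(j < t) nth set0 s j))); last first.
    by apply: within_indep => //; apply: sh; rewrite t0.
  apply/subsetP=> e; rewrite in_setI => /andP[/bigcupP[j _]]; rewrite !inE => /andP[h1 h2] /andP[-> ->] /=.
  by apply/andP; split; apply/bigcupP; exists j.
have ar (rC rK' rU cC cK cU cI x u w : nat) : (5 <= x -> rK' + 6 = 3 * x -> rC + u <= w + cC ->
   rU + cI <= rC + rK' -> cU = cC + cK - cI -> cI <= cC -> rU + (u + cK) <= w + (3 * x - 6) + cU)%N by lia.
apply: ar X5 rK IH _ (cardsU C K) (subset_leq_card (subsetIl C K)).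
by rewrite -ind; apply: rk_submod.
Qed.

Lemma union_rank p XX : good p -> four_shellable XX -> two_thin XX ->
  (forall X, X \in XX -> 5 <= #|X|)%N -> (rk p (union XX))%:Z <= valD XX.
Proof.
move=> gp [s [us ms sh]] thin X5; rewrite valD_count //.
have := shelling_bound gp _ sh (leqnn _).
have E (T : Type) (idx : T) (op : Monoid.com_law idx) (f : {set 'I_n} -> T) :
    \big[op/idx]_(j < size s) f (nth set0 s j) = \big[op/idx]_(X in XX) f X.
  rewrite -(big_mkord xpredT (fun t : nat => f (nth set0 s t))) -(big_nth set0 xpredT f) big_uniq //.
  by apply: eq_bigl => X; rewrite ms.
rewrite -/(union XX); have -> : \bigcup_(j < size s) within (nth set0 s j) = union XX by apply: E.
have -> : (\sum_(j < size s) #|within (nth set0 s j)| = \sum_(X in XX) #|within X|)%N by apply: (E nat 0%N _ (fun X => #|within X|)).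
have -> : (\sum_(j < size s) (3 * #|nth set0 s j| - 6) = \sum_(X in XX) (3 * #|X| - 6))%N.
  by apply: (E nat 0%N _ (fun X => 3 * #|X| - 6)%N).
move=> /(_ ltac:(by move=> X; rewrite ms; apply: X5)).
have -> : \sum_(X in XX) ((3 * #|X|)%:Z - 6) = (\sum_(X in XX) (3 * #|X| - 6))%N%:Z.
  rewrite -[RHS]natz natr_sum; apply: eq_bigr => X /X5 h; rewrite natz; lia.
lia.
Qed.

End Counting.

(** * The two inequalities of the rank formula *)

Section Final.
Variables (R : realFieldType) (n : nat).
Implicit Types (e : edge n) (F G H A B : {set edge n}) (i j : 'I_n)
  (p : 'I_n -> R * R) (X Y : {set 'I_n}) (XX : {set {set 'I_n}}).

(** The stress space of [A] has dimension [#|A| - rk p A], and that of a clique [X] has dimension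
    [#|within X| - (3 * #|X| - 6)]. Cliques with at most four vertices carry no stress. *)
Lemma flat_lower p A : good p -> flat p A ->
  (#|A| + \sum_(X in maxcliques A) (3 * #|X| - 6) <= rk p A + \sum_(X in maxcliques A) #|within X|)%N.
Proof.
move=> gp f; have AT : ins A setT = A by apply/setP=> e; rewrite !inE !andbT.
have le : (St p A <= \sum_(X in maxcliques A) St p (within X))%MS.
  have := stress_in_cliques setT gp f; rewrite AT => /submx_trans; apply.
  apply/sumsmx_subP=> X /andP[_ cX]; case: (leqP 5 #|X|) => X5.
    have [Y hY XY] := maxcliques_ex (cliqP _ _ cX) X5.
    apply: (sumsmx_sup Y) => //; apply: StS; apply/subsetP=> e.
    by rewrite -!ends_within => /subset_trans; apply.
  by rewrite (St_indep (within_indep gp X5)) sub0mx.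
have := leq_trans (mxrankS le) (mxrank_sum_leqif _).1 => /=.
have E X : X \in maxcliques A -> (\rank (St p (within X)) + (3 * #|X| - 6) = #|within X|)%N.
  move=> /maxcliquesP[_ X5]; have := rank_St p (within X); have := rk_within gp (X := X) ltac:(lia); lia.
rewrite -(rank_St p A) -(eq_bigr _ E) big_split /=; lia.
Qed.

Definition closure_of p F : {set edge n} := [set e | clos p F e].

Lemma closure_flat p F : flat p (closure_of p F).
Proof.
move=> i j /joins_ex[e he] h; rewrite (adjE _ he) inE; apply/closP=> q mq; apply/eqP.
rewrite (stretch_joins _ _ he); apply/eqP; apply: h; apply: clos_motion mq => e'; by rewrite inE.
Qed.

Lemma closure_rk p F : rk p (closure_of p F) = rk p F.
Proof.
apply/eqP; rewrite eqn_leq; apply/andP; split; first by apply: rk_clos_le => e; rewrite inE.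
by apply: rkS; apply/subsetP=> e eF; rewrite inE clos_in.
Qed.

Lemma rank_formula p F : good p ->
  (exists F0 XX, admissible F F0 XX /\ (rk p F)%:Z = #|F0|%:Z + valD XX) /\
  (forall F0 XX, admissible F F0 XX -> (rk p F)%:Z <= #|F0|%:Z + valD XX).
Proof.
move=> gp; have upper F0 XX : admissible F F0 XX -> (rk p F)%:Z <= #|F0|%:Z + valD XX.
  move=> [sF sh thin [X5 cov]].
  have s : F \subset union XX :|: F0.
    apply/subsetP=> e eF; rewrite in_setU; case: (boolP (e \in F0)) => eF0; first by rewrite orbT.
    rewrite orbF; have [X hX /andP[h1 h2]] := cov e ltac:(by rewrite inE eF0).
    by apply/bigcupP; exists X; rewrite // inE h1.
  have := union_rank gp sh thin X5; have := leq_trans (rkS p s) (rkU p _ _).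
  move: (valD XX) (rk p F) (rk p (union XX)) => *; lia.
split=> //; pose A := closure_of p F; have f : flat p A by apply: closure_flat.
have g := good_genpos gp.
pose XX := maxcliques A; exists (F :\: union XX), XX.
have ad : admissible F (F :\: union XX) XX.
  split; [exact: subsetDl|exact: maxcliques_shellable f|by move=> X Y; apply: maxcliques_thin f|split].
    by move=> X /maxcliquesP[].
  move=> e; rewrite setDDr setDv set0U inE => /andP[_ /bigcupP[X hX]].
  by rewrite inE => h; exists X.
split=> //; apply: le_anti; rewrite upper //=.
have [sh thin] : four_shellable XX /\ two_thin XX by case: ad.
rewrite valD_count // -(closure_rk p F) -/A.
have low := flat_lower gp f.
(* The cliques come from the closure, but [F0] consists of edges of [F] only; the edges of the union
   outside [F] are paid for by [#|A|]. *)
have card : (#|F :\: union XX| + #|union XX| <= #|A|)%N.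
  have uA : union XX \subset A.
    apply/bigcupsP=> X /maxcliquesP[cX _]; apply/subsetP=> e; have he := joins_e e.
    rewrite (within_joins _ he) -(adjE _ he) => /andP[h1 h2]; apply: cX => //; exact: joins_neq he.
  rewrite -cardsUI (_ : _ :&: _ = set0) ?cards0 ?addn0.
    apply: subset_leq_card; rewrite subUset uA andbT; apply: subset_trans (subsetDl _ _) _.
    by apply/subsetP=> e eF; rewrite inE clos_in.
  by apply/setP=> e; rewrite !inE; case: (e \in union XX); rewrite ?andbF.
have -> : \sum_(X in XX) ((3 * #|X|)%:Z - 6) = (\sum_(X in XX) (3 * #|X| - 6))%N%:Z.
  rewrite -[RHS]natz natr_sum; apply: eq_bigr => X /maxcliquesP[_ X5]; rewrite natz; lia.
move: low card; rewrite -/XX.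
move: (rk p A) #|A| #|union XX| #|_ :\: _| (\sum_(X in XX) _)%N (\sum_(X in XX) _)%N => *; lia.
Qed.

End Final.

(** Over the polynomial ring with rational coefficients, the minor that witnesses the rank at [p] is
    a nonzero polynomial, so it does not vanish at algebraically independent coordinates. *)
Lemma alg_indep_good (R : realType) (n : nat) (x y : 'I_n -> R) :
  alg_indep_Q x y -> good (fun i => (x i, y i)).
Proof.
move=> gen F p.
pose ev (u w : 'I_n -> R) : {rmorphism {mpoly rat[n + n]} -> R} :=
  meval (coords u w) \o map_mpoly (ratr : rat -> R).
pose X (i : 'I_n) : {mpoly rat[n + n]} := 'X_(lshift n i).
pose Y (i : 'I_n) : {mpoly rat[n + n]} := 'X_(rshift n i).
have evX u w : ev u w \o X =1 u.
  move=> i; rewrite /ev /= map_mpolyX mevalXU /coords.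
  by rewrite (unsplitK (inl i)).
have evY u w : ev u w \o Y =1 w.
  by move=> i; rewrite /ev /= map_mpolyX mevalXU /coords (unsplitK (inr i)).
have [s [fs hs]] := rank_transfer (rowmx X Y F) (ev (fun i => (p i).1) (fun i => (p i).2)).
have E u w : \rank (map_mx (ev u w) (rowmx X Y F)) = cofactor_rank u w F.
  rewrite map_rowmx -rank_rowmx.
  exact: (@eq_cof _ _ (fun i => ((ev u w \o X) i, (ev u w \o Y) i)) (fun i => (u i, w i)) F
    (fun i => congr2 pair (evX u w i) (evY u w i))).
have s0 : ev x y s != 0.
  by apply: contraNneq fs => /gen->; rewrite rmorph0.
by rewrite /rk -E -[X in (_ <= X)%N]E hs.
Qed.

Theorem theorem6p1 (n : nat) (Hn : (5 <= n)%N) (R : realType) (x y : 'I_n -> R)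
  (Hgen : alg_indep_Q x y) (F : {set edge n}) :
  (exists F0 XX, admissible F F0 XX /\
     (cofactor_rank x y F)%:Z = (#|F0|)%:Z + valD XX) /\
  (forall F0 XX, admissible F F0 XX ->
     ((cofactor_rank x y F)%:Z <= (#|F0|)%:Z + valD XX)%R).
Proof. exact: rank_formula (alg_indep_good Hgen). Qed.
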